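(* Let $(\Gamma_n)_{n\in\mathbb{N}}$ be a sequence of open subarcs of the unit circle $\mathbb{T}$ whose closures in $\mathbb{T}$ are pairwise disjoint, let $a_n\in\Gamma_n$ for each $n$, and let $\epsilon>0$ and $\delta_n>0$ ($n\in\mathbb{N}$) satisfy $\sum_{n\in\mathbb{N}}\delta_n<\epsilon<1$. Let $(g_n)_{n\in\mathbb{N}}$ be a sequence in the disk algebra $A(\mathbb{D})$ such that, for each $n$, $g_n(a_n)=1$, $|g_n|<1$ on $\mathbb{T}\setminus\{a_n\}$, and $|g_n|<\delta_n$ on $\mathbb{T}\setminus\Gamma_n$. Then the linear mapping $$T: c=(c_n)_{n\in\mathbb{N}}\mapsto T(c)=\sum_{n\in\mathbb{N}}c_ng_n$$ (the series converging weak* in $H^\infty$) implements a weak*- and norm-homeomorphism between $\ell^\infty$ and the subspace $\mathcal{E}=T(\ell^\infty)$ of $H^\infty$, such that $\|T\|\le 1+\epsilon$ and $\|T^{-1}\|\le(1-\epsilon)^{-1}$.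
   Context: $\mathbb{D}$ is the open unit disk. $A(\mathbb{D})$ is the algebra of functions continuous on $\overline{\mathbb{D}}$ and analytic in $\mathbb{D}$. $H^\infty$ is the space of bounded analytic functions on $\mathbb{D}$ with sup norm; it is the dual of $L^1/H^1_0$ under $\langle[f],h\rangle=\int_{\mathbb{T}}fh\,dm$ ($m$ normalized Lebesgue measure on $\mathbb{T}$, $L^1=L^1(m)$, $H^1_0$ the functions in the Hardy space $H^1$ vanishing at $0$), and its weak* topology is the one from this duality. $\ell^\infty$ carries the weak* topology as the dual of $\ell^1$. $\mathcal{E}$ carries the relative weak* topology of $H^\infty$. *)

(* Defs.v *)
From HB Require Import structures.
From mathcomp Require Import all_boot all_order all_algebra.
From mathcomp Require Import all_classical all_reals all_analysis.
From mathcomp Require Import complex.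
Set Implicit Arguments.
Unset Strict Implicit.
Unset Printing Implicit Defensive.
Import Order.TTheory GRing.Theory Num.Theory.
Import numFieldNormedType.Exports.
Local Open Scope classical_set_scope.
Local Open Scope ring_scope.
Local Open Scope complex_scope.

(* The topological instances of numFieldNormedType are keyed on abstract
   structures; these give the same topology to the concrete type [R[i]]. *)
HB.instance Definition _ (R : rcfType) := GRing.ComAlgebra.copy R[i] R[i]^o.
HB.instance Definition _ (R : rcfType) := NormedModule.copy R[i] R[i]^o.

Section Plane.
Variable R : realType.
Local Notation C := R[i].

Definition open_disk : set C := [set z | `|z| < 1].
Definition closed_disk : set C := [set z | `|z| <= 1].
Definition unit_circle : set C := [set z | `|z| = 1].

(* The norm of [R[i]] and of any normed module over it is [R[i]]-valued, with
   zero imaginary part; [rnorm] is the same norm read in [R]. *)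
Definition rnorm (V : normedZmodType C) (x : V) : R := complex.Re `|x|.

Definition expi (t : R) : C := cos t +i* sin t.

(* Any [a < b <= a + 2 pi] gives a nonempty arc; [b = a + 2 pi] is the circle
   minus one point. *)
Definition open_arc (G : set C) : Prop :=
  exists a b : R, [/\ a < b, b <= a + pi *+ 2 & G = expi @` `]a, b[%classic].

Definition disk_algebra (g : C -> C) : Prop :=
  {within closed_disk, continuous g} /\
  (forall z, open_disk z -> derivable g z 1).

Lemma rnormE (V : normedZmodType C) (x : V) : `|x| = (rnorm x)%:C.
Proof.
have := normr_ge0 x; rewrite /rnorm.
by case: `|x| => a b; rewrite lecE /= => /andP[/eqP -> _].
Qed.

Lemma rnorm_ge0 (V : normedZmodType C) (x : V) : 0 <= rnorm x.
Proof. by have := normr_ge0 x; rewrite rnormE lecR. Qed.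

Lemma rnormD (x y : C) : rnorm (x + y) <= rnorm x + rnorm y.
Proof. by have := ler_normD x y; rewrite !rnormE -rmorphD lecR. Qed.

Lemma rnormM (x y : C) : rnorm (x * y) = rnorm x * rnorm y.
Proof.
apply/eqP; rewrite -(inj_eq (@complexI R)) rmorphM /= -!rnormE.
by rewrite normrM.
Qed.

Lemma Re_continuous : continuous (@complex.Re R : C -> R).
Proof.
move=> z; apply/(@cvgrPdist_lt _ R _ _ (nbhs_filter z)) => e e0.
have : nbhs z (ball z e%:C) by apply: nbhsx_ballx; rewrite ltcR.
apply: filterS => w; rewrite -ball_normE /= rnormE ltcR; apply: le_lt_trans.
case: z w => a b [c d]; rewrite /rnorm normc_def /=.
by rewrite -sqrtr_sqr ler_wsqrtr // lerDl sqr_ge0.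
Qed.

Lemma rnorm_continuous : continuous (@rnorm C : C -> R).
Proof.
move=> z; apply: (@continuous_comp C C R (fun z => `|z|) (@complex.Re R)).
  exact: norm_continuous.
exact: Re_continuous.
Qed.

Lemma complex_continuous : continuous (fun p : R * R => p.1 +i* p.2 : C).
Proof.
have cr (f : R * R -> R) : continuous f -> continuous (fun p => (f p)%:C : C).
  move=> cf p; apply/(@cvgrPdist_lt _ C _ _ (nbhs_filter p)) => -[e e'].
  rewrite ltcE /= => /andP[/eqP -> e0].
  have : \forall q \near p, `|f p - f q| < e 
    by move: e0; apply/(@cvgrPdist_lt _ R _ _ (nbhs_filter p)): e; exact: cf.
  apply: filterS => q H.
  rewrite -rmorphB normc_def /= expr0n addr0 sqrtr_sqr.
  by rewrite ltcE /= eqxx.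
have -> : (fun p : R * R => p.1 +i* p.2 : C) =
    (fun p => (p.1)%:C + 'i * (p.2)%:C).
  by apply/funext => -[a b]; rewrite /= [LHS]complexE.
move=> p; apply: cvgD; first by apply: cr => q; exact: cvg_fst.
apply: cvgM; first exact: cvg_cst.
by apply: cr => q; exact: cvg_snd.
Qed.

Lemma closed_disk_compact : compact closed_disk.
Proof.
pose S := (fun p : R * R => p.1 +i* p.2 : C) @` (`[-1, 1] `*` `[-1, 1]).
have cS : compact S.
  apply: continuous_compact.
    exact/continuous_subspaceT/complex_continuous.
  by apply: compact_setX; exact: segment_compact.
apply: (subclosed_compact _ cS).
  have -> : closed_disk = (@rnorm C) @^-1` [set x | x <= 1].
    by apply/seteqP; split=> z; rewrite /closed_disk /= rnormE lecR.
  apply: (closed_comp _ (@closed_le _ 1)) => z _; exact: rnorm_continuous.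
move=> -[a b]; rewrite /closed_disk /= normc_def /= lecR => H.
have lt1 (x : R) : 0 <= x -> Num.sqrt x <= 1 -> x <= 1.
  by move=> x0; rewrite -{1}sqrtr1 ler_sqrt.
have {}H := lt1 _ (addr_ge0 (sqr_ge0 a) (sqr_ge0 b)) H.
exists (a, b) => //=; rewrite !in_itv /= -!ler_norml.
rewrite -[`|a| <= 1](@ler_pXn2r _ 2) ?nnegrE// -[`|b| <= 1](@ler_pXn2r _ 2) ?nnegrE//.
rewrite !real_normK ?num_real// expr1n; split.
  by apply: le_trans H; rewrite lerDl sqr_ge0.
by apply: le_trans H; rewrite lerDr sqr_ge0.
Qed.

Lemma disk_algebra_bounded (g : C -> C) : disk_algebra g ->
  exists M : R, forall z, closed_disk z -> rnorm (g z) <= M.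
Proof.
move=> [cg _].
have cr : {within closed_disk, continuous (fun z => rnorm (g z))}.
  move=> z; apply: (@continuous_comp (subspace closed_disk) C R g (@rnorm C)).
    exact: cg.
  exact: rnorm_continuous.
have /compact_bounded[M [_ /(_ (M + 1))]] :=
  continuous_compact cr closed_disk_compact.
rewrite ltrDl ltr01 => /(_ isT) H; exists (M + 1) => z Dz.
by apply: le_trans (H _ _); [exact: ler_norm | exists z].
Qed.

End Plane.

Section SupNorm.
Variables (R : realType) (T : Type) (A : set T).
Local Notation C := R[i].
Implicit Types f g : T -> C.

Definition bounded_on f := exists M : R, forall x, A x -> rnorm (f x) <= M.

Definition supnorm f : R := sup [set rnorm (f x) | x in A].

Lemma supnorm_ub f x : bounded_on f -> A x -> rnorm (f x) <= supnorm f.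
Proof.
move=> [M fM] Ax; apply: ub_le_sup; last by exists x.
by exists M => _ [y Ay <-]; exact: fM.
Qed.

Lemma supnorm_le f (M : R) : A !=set0 ->
  (forall x, A x -> rnorm (f x) <= M) -> supnorm f <= M.
Proof.
move=> [x Ax] fM; apply: ge_sup; first by exists (rnorm (f x)), x.
by move=> _ [y Ay <-]; exact: fM.
Qed.

Lemma bounded_on0 : bounded_on 0.
Proof. by exists 0 => x _; rewrite [X in rnorm X]/(0 : C) /rnorm normr0. Qed.

Lemma bounded_onZD a f g :
  bounded_on f -> bounded_on g -> bounded_on (a *: f + g).
Proof.
move=> [M fM] [N gN]; exists (rnorm a * M + N) => x Ax.
apply: le_trans (rnormD _ _) _; rewrite lerD ?gN //.
by rewrite [X in rnorm X]/(a * f x) rnormM ler_wpM2l ?rnorm_ge0 ?fM.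
Qed.

Lemma supnormD f g : A !=set0 -> bounded_on f -> bounded_on g ->
  supnorm (f + g) <= supnorm f + supnorm g.
Proof.
move=> A0 bf bg; apply: supnorm_le => // x Ax.
by apply: le_trans (rnormD _ _) _; rewrite lerD ?supnorm_ub.
Qed.

Lemma supnormZ a f : A !=set0 -> bounded_on f ->
  supnorm (a *: f) = rnorm a * supnorm f.
Proof.
move=> A0 bf; apply/eqP; rewrite eq_le; apply/andP; split.
  apply: supnorm_le => // x Ax.
  by rewrite [X in rnorm X]/(a * f x) rnormM ler_wpM2l ?rnorm_ge0 ?supnorm_ub.
have [->|a0] := eqVneq a 0.
  rewrite /rnorm normr0 mul0r scale0r; case: A0 => x Ax.
  have := @supnorm_ub 0 x bounded_on0 Ax.
  by rewrite [X in rnorm X]/(0 : C) /rnorm normr0.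
have ra0 : 0 < rnorm a by rewrite -ltcR -rnormE normr_gt0.
rewrite mulrC -ler_pdivlMr //; apply: supnorm_le => // x Ax.
rewrite ler_pdivlMr // mulrC -rnormM.
apply: (@supnorm_ub (a *: f) x) => //.
by rewrite -[a *: f]addr0; exact: bounded_onZD bf bounded_on0.
Qed.

Lemma supnorm_eq0 f x : bounded_on f -> supnorm f = 0 -> A x -> f x = 0.
Proof.
move=> bf f0 Ax; apply/eqP; rewrite -normr_le0 rnormE lecR -f0.
exact: supnorm_ub.
Qed.

End SupNorm.

Section Linf.
Variable R : realType.
Local Notation C := R[i].

Definition linf_pred : {pred nat -> C} := [pred c | `[< bounded_on setT c >]].

Record linf := Linf { linf_val :> nat -> C; linfP : linf_val \in linf_pred }.

HB.instance Definition _ := [isSub for linf_val].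
HB.instance Definition _ := [Choice of linf by <:].

Lemma linf_submod_closed : submod_closed linf_pred.
Proof.
split=> [|a f g]; first by apply/asboolP; exact: bounded_on0.
by move=> /asboolP bf /asboolP bg; apply/asboolP; exact: bounded_onZD.
Qed.

HB.instance Definition _ :=
  GRing.isSubmodClosed.Build _ _ linf_pred linf_submod_closed.
HB.instance Definition _ := [SubChoice_isSubLmodule of linf by <:].

Definition linf_norm (c : linf) : C := (supnorm setT c)%:C.

Lemma linf_bounded (c : linf) : bounded_on setT c.
Proof. by apply/asboolP; exact: linfP. Qed.

Local Lemma setT_neq0 : [set: nat] !=set0. Proof. by exists 0%N. Qed.

Lemma linf_normD (c d : linf) : linf_norm (c + d) <= linf_norm c + linf_norm d.
Proof. by rewrite -rmorphD lecR; apply: supnormD; first exact: setT_neq0; exact: linf_bounded. Qed.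

Lemma linf_normZ (l : C) (c : linf) : linf_norm (l *: c) = `|l| * linf_norm c.
Proof.
by rewrite rnormE -rmorphM; congr _%:C; apply: supnormZ; [exact: setT_neq0 | exact: linf_bounded].
Qed.

Lemma linf_norm0_eq0 (c : linf) : linf_norm c = 0 -> c = 0.
Proof.
move=> /complexI c0; apply/val_inj/funext => n /=.
exact: (@supnorm_eq0 R nat setT c n (linf_bounded c)).
Qed.

HB.instance Definition _ :=
  Lmodule_isNormed.Build C linf linf_normD linf_normZ linf_norm0_eq0.

End Linf.

Section Hinf.
Variable R : realType.
Local Notation C := R[i].
Local Notation D := (@open_disk R).

(* Functions on the disk are represented by their extension by 0, so that
   equality in [Hinf] is equality on the disk. *)
Definition bounded_analytic (h : C -> C) : Prop :=
  [/\ forall z, ~ D z -> h z = 0,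
      forall z, D z -> derivable h z 1
    & bounded_on D h].

Definition Hinf_pred : {pred C -> C} := [pred h | `[< bounded_analytic h >]].

Record Hinf := MkHinf { Hinf_val :> C -> C; HinfP : Hinf_val \in Hinf_pred }.

HB.instance Definition _ := [isSub for Hinf_val].
HB.instance Definition _ := [Choice of Hinf by <:].

Lemma Hinf_submod_closed : submod_closed Hinf_pred.
Proof.
split=> [|a f g].
  by apply/asboolP; split=> //; exact: bounded_on0.
move=> /asboolP[f0 df bf] /asboolP[g0 dg bg]; apply/asboolP; split.
- move=> z Dz; rewrite -[LHS]/(a * f z + g z).
  by rewrite f0 // g0 // mulr0 addr0.
- by move=> z Dz; apply: derivableD; [apply: derivableZ; exact: df|exact: dg].
- exact: bounded_onZD.
Qed.

HB.instance Definition _ :=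
  GRing.isSubmodClosed.Build _ _ Hinf_pred Hinf_submod_closed.
HB.instance Definition _ := [SubChoice_isSubLmodule of Hinf by <:].

Definition Hinf_norm (h : Hinf) : C := (supnorm D h)%:C.

Lemma Hinf_bounded (h : Hinf) : bounded_on D h.
Proof. by have /asboolP[] := HinfP h. Qed.

Lemma open_disk_neq0 : D !=set0.
Proof. by exists 0; rewrite /open_disk /= normr0. Qed.

Lemma Hinf_normD (f g : Hinf) : Hinf_norm (f + g) <= Hinf_norm f + Hinf_norm g.
Proof. by rewrite -rmorphD lecR; apply: supnormD; first exact: open_disk_neq0; exact: Hinf_bounded. Qed.

Lemma Hinf_normZ (l : C) (h : Hinf) : Hinf_norm (l *: h) = `|l| * Hinf_norm h.
Proof. by rewrite rnormE -rmorphM; congr _%:C; apply: supnormZ; [exact: open_disk_neq0 | exact: Hinf_bounded]. Qed.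

Lemma Hinf_norm0_eq0 (h : Hinf) : Hinf_norm h = 0 -> h = 0.
Proof.
move=> /complexI h0; apply/val_inj/funext => z /=.
have [Dz|Dz] := pselect (D z); first exact: (@supnorm_eq0 R C D h z (Hinf_bounded h)).
by have /asboolP[-> //] := HinfP h.
Qed.

HB.instance Definition _ :=
  Lmodule_isNormed.Build C Hinf Hinf_normD Hinf_normZ Hinf_norm0_eq0.

Lemma disk_algebra_Hinf (g : C -> C) : disk_algebra g -> g \_ D \in Hinf_pred.
Proof.
move=> gA; apply/asboolP; split.
- by move=> z Dz; rewrite patchE memNset.
- move=> z Dz; have [_ /(_ z Dz)] := gA.
  apply: near_eq_derivable.
  have : \forall w \near z, D w.
    apply: open_nbhs_nbhs; split => //.
    have -> : D = (@rnorm R C) @^-1` [set x | x < 1].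
      by apply/seteqP; split=> w; rewrite /open_disk /= rnormE ltcR.
    by apply: (open_comp _ (@open_lt _ 1)) => w _; exact: rnorm_continuous.
  by apply: filterS => w Dw; rewrite patchE mem_set.
- have [M gM] := disk_algebra_bounded gA; exists M => z Dz.
  by rewrite patchE mem_set //; apply: gM; exact: ltW.
Qed.

(* The inclusion of the disk algebra into [Hinf]. *)
Definition toHinf (g : C -> C) (gA : disk_algebra g) : Hinf :=
  MkHinf (disk_algebra_Hinf gA).

End Hinf.

Section WeakStar.
Variable R : realType.
Local Notation C := R[i].

Definition ell1 := {a : nat -> C | cvgn (series (fun n => rnorm (a n)))}.

Definition linf_pairing (c : linf R) (a : ell1) : C :=
  limn (series (fun n => sval a n * c n)).

(* The weak* topology of a dual space: the coarsest topology that makes the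
   pairing with each element of the predual continuous. *)
Definition linf_wstar := initial_topology
  (linf_pairing : linf R -> {ptws ell1 -> C}).

HB.instance Definition _ := Topological.copy linf_wstar
  (initial_topology (linf_pairing : linf R -> {ptws ell1 -> C})).

Local Notation leb := (@lebesgue_measure R).

(* The normalized Lebesgue measure of the circle is the image of [dt / (2 pi)]
   on [0, 2 pi] under [expi]. *)
Definition circle_integrable (f : C -> C) : Prop :=
  leb.-integrable `[0, pi *+ 2] (fun t => (complex.Re (f (expi t)))%:E) /\
  leb.-integrable `[0, pi *+ 2] (fun t => (complex.Im (f (expi t)))%:E).

Definition circle_integral (f : C -> C) : C :=
  ((\int[leb]_(t in `[0, pi *+ 2]) complex.Re (f (expi t))) / (pi *+ 2)) +i*
  ((\int[leb]_(t in `[0, pi *+ 2]) complex.Im (f (expi t))) / (pi *+ 2)).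

Definition L1_circle := {f : C -> C | circle_integrable f}.

(* Radial boundary values, which exist almost everywhere on the circle for
   [h] in [Hinf] (Fatou). *)
Definition boundary_value (h : C -> C) (w : C) : C :=
  lim (h (r%:C * w) @[r --> (1 : R)^'-]).

(* [<[f], h>] does not depend on the representative [f] of the class [[f]]
   modulo [H^1_0], so the weak* topology of [Hinf] is given by all [f] in
   [L^1]. *)
Definition Hinf_pairing (h : Hinf R) (f : L1_circle) : C :=
  circle_integral (fun w => sval f w * boundary_value h w).

Definition Hinf_wstar := initial_topology
  (Hinf_pairing : Hinf R -> {ptws L1_circle -> C}).

HB.instance Definition _ := Topological.copy Hinf_wstar
  (initial_topology (Hinf_pairing : Hinf R -> {ptws L1_circle -> C})).

(* The norm of [f] restricted to the subspace [E]. *)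
Definition opnorm (V W : normedModType C) (E : set V) (f : V -> W) : \bar R :=
  ereal_sup [set (rnorm (f x))%:E | x in E `&` [set x | rnorm x <= 1]].

End WeakStar.

(* [S] is the inverse of [T] on the image of [T], which carries the relative
   topology; [S] is arbitrary elsewhere. *)
Definition homeo_onto_image (X Y : topologicalType) (T : X -> Y) (S : Y -> X) :=
  [/\ cancel T S, continuous T & {within range T, continuous S}].

(* Main.v *)
(** For [w] on the circle put [u_c w = \sum_n c_n g_n(w)]. At most one [Gamma_n]
    contains [w], so the series converges absolutely, with
    [\sum_n |g_n| <= 1 + eps]. [T c] is the Cauchy integral of [u_c]; summing the
    Cauchy and the Poisson formulas of the [g_n], it is also the Poisson integral
    of [u_c]. Hence [|T c| <= (1 + eps) |c|], and the radial limits of [T c] are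
    [u_c] almost everywhere (at the Lebesgue points). So [<f, T c>] is
    [\sum_n c_n \int f g_n] with summable moments [\int f g_n], which makes [T]
    weak* continuous and the defining series weak* convergent.
    For the inverse, let [P_n] be the set where [g_n] is close to [1]: it has
    positive measure, and [|u_c - c_n| <= eps |c|] on it, which gives
    [(1 - eps) |c| <= |T c|]. Let [p_n] be a probability density carried by [P_n].
    The matrix [\int p_n g_k] is within [eps] of the identity as an operator on l1,
    so by a Neumann series every [a] in l1 is the moment sequence of some [f] in L1:
    [<c, a> = <f, T c>], and [T^-1] is weak* continuous on the image. *)
From HB Require Import structures.
Require Import Defs.
From mathcomp Require Import all_boot all_order all_algebra.
From mathcomp Require Import all_classical all_reals all_analysis.
From mathcomp Require Import measurable_realfun complex ring lra.
Import Order.TTheory GRing.Theory Num.Theory.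
Import numFieldNormedType.Exports.
Local Open Scope classical_set_scope.
Local Open Scope ring_scope.
Local Open Scope complex_scope.

Set Implicit Arguments.
Unset Strict Implicit.
Unset Printing Implicit Defensive.

(** * Complex norms and limits *)

(** The hypotheses bound [\sum_n |g_n|] on the circle only, so every estimate is made there and
    carried into the disk by an integral formula. Two kernels are needed. The Cauchy kernel is
    analytic in [z] and makes [T c] analytic, but it is not positive; the Poisson kernel is positive
    with mean 1, so it preserves bounds and returns the boundary function along radii, but it is not
    analytic. They differ by a kernel that integrates to 0 against the disk algebra, so they agree
    on sums of the [g_n]. The pairing of [Hinf] reads [T c] through radial limits, which are
    identified only almost everywhere. The strict inequality between [\sum_n delta_n] and [eps] pays
    for the error of this replacement. Weak* continuity is in both directions a fact about preduals:
    the moment map sends L1 into l1, which makes [T] continuous, and it is onto, which makes the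
    inverse continuous. *)

Section ComplexNorm.
Variable R : realType.
Local Notation C := R[i].
Implicit Types x y z : C.

Lemma rnorm_le x (M : R) : (rnorm x <= M) = (`|x| <= M%:C).
Proof. by rewrite rnormE lecR. Qed.

Lemma rnorm_lt x (M : R) : (rnorm x < M) = (`|x| < M%:C).
Proof. by rewrite rnormE ltcR. Qed.

Lemma rnormN x : rnorm (- x) = rnorm x.
Proof. by rewrite /rnorm normrN. Qed.

Lemma rnorm_distC x y : rnorm (x - y) = rnorm (y - x).
Proof. by rewrite /rnorm distrC. Qed.

Lemma rnorm0 : rnorm (0 : C) = 0.
Proof. by rewrite /rnorm normr0. Qed.

Lemma rnorm1 : rnorm (1 : C) = 1.
Proof. by rewrite /rnorm normr1. Qed.

Lemma rnorm_eq0 x : (rnorm x == 0) = (x == 0).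
Proof. by rewrite -(inj_eq (@complexI R)) -rnormE normr_eq0. Qed.

Lemma rnorm_gt0 x : (0 < rnorm x) = (x != 0).
Proof. by rewrite lt_neqAle rnorm_ge0 andbT eq_sym rnorm_eq0. Qed.

Lemma rnormV x : rnorm x^-1 = (rnorm x)^-1.
Proof.
by apply/eqP; rewrite -(inj_eq (@complexI R)) fmorphV /= -!rnormE normfV.
Qed.

Lemma rnorm_real (r : R) : rnorm r%:C = `|r|.
Proof. by rewrite /rnorm normc_def /= expr0n addr0 sqrtr_sqr. Qed.

Lemma rnorm_i : rnorm ('i : C) = 1.
Proof. by rewrite /rnorm normc_def /= expr0n add0r expr1n sqrtr1. Qed.

Lemma rnormB_le x y : rnorm (x - y) <= rnorm x + rnorm y.
Proof. by apply: le_trans (rnormD _ _) _; rewrite rnormN. Qed.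

Lemma rnorm_lerB x y : rnorm x - rnorm y <= rnorm (x - y).
Proof. by rewrite lerBlDr; apply: le_trans (rnormD _ _); rewrite subrK. Qed.

Lemma rnorm_sum I (r : seq I) (P : pred I) (F : I -> C) :
  rnorm (\sum_(i <- r | P i) F i) <= \sum_(i <- r | P i) rnorm (F i).
Proof.
elim/big_ind2 : _ => [|a x b y ax bY|//]; first by rewrite rnorm0.
by apply: le_trans (rnormD _ _) _; exact: lerD.
Qed.

Lemma norm_Re z : `|complex.Re z| <= rnorm z.
Proof.
case: z => a b; rewrite /rnorm normc_def /= -sqrtr_sqr.
by rewrite ler_wsqrtr // lerDl sqr_ge0.
Qed.

Lemma norm_Im z : `|complex.Im z| <= rnorm z.
Proof.
case: z => a b; rewrite /rnorm normc_def /= -sqrtr_sqr.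
by rewrite ler_wsqrtr // lerDr sqr_ge0.
Qed.

Lemma rnorm_ReIm z : rnorm z <= `|complex.Re z| + `|complex.Im z|.
Proof.
case: z => a b /=; rewrite [X in rnorm X]complexE /=.
by apply: le_trans (rnormD _ _) _; rewrite rnormM rnorm_i mul1r !rnorm_real.
Qed.

Lemma rnorm_conj z : rnorm (conjc z) = rnorm z.
Proof. by case: z => a b; rewrite /rnorm !normc_def /= sqrrN. Qed.

Lemma mulc_conj z : z * conjc z = (rnorm z ^+ 2)%:C.
Proof.
case: z => a b; rewrite /rnorm normc_def /= sqr_sqrtr ?addr_ge0 ?sqr_ge0//.
by apply/eqP; rewrite eq_complex /=; apply/andP; split; apply/eqP; ring.
Qed.

Lemma RecM x y : complex.Re (x * y) =
  complex.Re x * complex.Re y - complex.Im x * complex.Im y.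
Proof. by case: x y => a b [c d]. Qed.

Lemma ImcM x y : complex.Im (x * y) =
  complex.Re x * complex.Im y + complex.Im x * complex.Re y.
Proof. by case: x y => a b [c d]. Qed.

Lemma RecD x y : complex.Re (x + y) = complex.Re x + complex.Re y.
Proof. by case: x y => a b [c d]. Qed.

Lemma ImcD x y : complex.Im (x + y) = complex.Im x + complex.Im y.
Proof. by case: x y => a b [c d]. Qed.

Lemma RecB x y : complex.Re (x - y) = complex.Re x - complex.Re y.
Proof. by case: x y => a b [c d]. Qed.

Lemma ImcB x y : complex.Im (x - y) = complex.Im x - complex.Im y.
Proof. by case: x y => a b [c d]. Qed.

Lemma realcM (a b : R) : (a * b)%:C = a%:C * b%:C :> C.
Proof. by rewrite rmorphM. Qed.

Lemma complexP x y : complex.Re x = complex.Re y ->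
  complex.Im x = complex.Im y -> x = y.
Proof. by case: x y => a b [c d] /= -> ->. Qed.

End ComplexNorm.

Section ComplexConvergence.
Variable R : realType.
Local Notation C := R[i].

(** In the order of [R[i]] a positive radius has zero imaginary part, so it suffices to test real
    radii. *)
Lemma cvgC_distP (T : Type) (F : set_system T) (FF : Filter F) (f : T -> C)
    (l : C) :
  f @ F --> l <-> forall e : R, 0 < e -> \forall x \near F, rnorm (l - f x) < e.
Proof.
split=> [/(@cvgrPdist_lt _ C _ _ FF) H e e0|H].
  have := H e%:C; rewrite ltcR => /(_ e0); apply: filterS => x.
  by rewrite rnorm_lt.
apply/(@cvgrPdist_lt _ C _ _ FF) => -[e e'].
rewrite ltcE /= => /andP[/eqP -> e0].
by apply: filterS (H e e0) => x; rewrite rnorm_lt.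
Qed.

Lemma Im_continuous : continuous (@complex.Im R : C -> R).
Proof.
move=> z; apply/(@cvgrPdist_lt _ R _ _ (nbhs_filter z)) => e e0.
have /cvgC_distP/(_ e e0) := @cvg_id C (nbhs z).
apply: filterS => w; apply: le_lt_trans.
by rewrite -ImcB norm_Im.
Qed.

Lemma cvgC_ReImP (T : Type) (F : set_system T) (FF : Filter F) (f : T -> C)
    (l : C) :
  f @ F --> l <->
  (fun x => complex.Re (f x)) @ F --> complex.Re l /\
  (fun x => complex.Im (f x)) @ F --> complex.Im l.
Proof.
split=> [H|[H1 H2]].
  split; first exact: (continuous_cvg _ (@Re_continuous R l) H).
  exact: (continuous_cvg _ (@Im_continuous l) H).
apply/cvgC_distP => e e0; have e20 : 0 < e / 2 by rewrite divr_gt0.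
move: H1 => /cvgrPdist_lt /(_ _ e20); move: H2 => /cvgrPdist_lt /(_ _ e20).
apply: filterS2 => x H2 H1; apply: le_lt_trans (rnorm_ReIm _) _.
by rewrite RecB ImcB (splitr e) ltrD.
Qed.

Lemma rnorm_cvg (T : Type) (F : set_system T) (FF : Filter F) (f : T -> C)
    (l : C) : f @ F --> l -> (fun x => rnorm (f x)) @ F --> rnorm l.
Proof. by move=> H; exact: (continuous_cvg _ (@rnorm_continuous R l) H). Qed.

Lemma rnorm_cvg_le (f : nat -> C) (l : C) (M : R) :
  f @ \oo --> l -> (forall n, rnorm (f n) <= M) -> rnorm l <= M.
Proof.
move=> /rnorm_cvg fl fM; rewrite -(cvg_lim _ fl) //.
by apply: limr_le; [exact: cvgP fl | exact: nearW].
Qed.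

Lemma cvgC_unique (T : Type) (F : set_system T) (FF : ProperFilter F)
    (f : T -> C) (l l' : C) : f @ F --> l -> f @ F --> l' -> l = l'.
Proof.
move=> /cvgC_ReImP[a b] /cvgC_ReImP[c d].
apply: complexP; first exact: (cvg_unique (@norm_hausdorff _ R) a c).
exact: (cvg_unique (@norm_hausdorff _ R) b d).
Qed.

Lemma cvgC_lim (T : Type) (F : set_system T) (FF : ProperFilter F)
    (f : T -> C) (l : C) : f @ F --> l -> lim (f @ F) = l.
Proof. by move=> fl; apply: (@cvg_lim C _ T F FF f l). Qed.

Lemma cvgCM (T : Type) (F : set_system T) (FF : Filter F) (f g : T -> C)
    (a b : C) : f @ F --> a -> g @ F --> b -> (fun x => f x * g x) @ F --> a * b.
Proof. by move=> fa gb; exact: (@cvgM C T F FF f g a b fa gb). Qed.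

Lemma cvgCD (T : Type) (F : set_system T) (FF : Filter F) (f g : T -> C)
    (a b : C) : f @ F --> a -> g @ F --> b -> (fun x => f x + g x) @ F --> a + b.
Proof. by move=> fa gb; exact: (@cvgD C C T F FF f g a b fa gb). Qed.

Lemma cvgCB (T : Type) (F : set_system T) (FF : Filter F) (f g : T -> C)
    (a b : C) : f @ F --> a -> g @ F --> b -> (fun x => f x - g x) @ F --> a - b.
Proof. by move=> fa gb; exact: (@cvgB C C T F FF f g a b fa gb). Qed.

Lemma cvgCV (T : Type) (F : set_system T) (FF : Filter F) (f : T -> C)
    (a : C) : a != 0 -> f @ F --> a -> (fun x => (f x)^-1) @ F --> a^-1.
Proof. by move=> a0 fa; exact: (@cvgV C T F FF f a a0 fa). Qed.

Lemma cvgC_real (T : Type) (F : set_system T) (FF : Filter F) (f : T -> R)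
    (a : R) : f @ F --> a -> (fun x => (f x)%:C) @ F --> (a%:C : C).
Proof. by move=> fa; apply/cvgC_ReImP; split => //=; exact: cvg_cst. Qed.

Lemma cvgC_sum (T : Type) (F : set_system T) (FF : Filter F) (f : nat -> T -> C)
    (l : nat -> C) N : (forall k, f k @ F --> l k) ->
  (fun x => \sum_(0 <= k < N) f k x) @ F --> \sum_(0 <= k < N) l k.
Proof.
move=> fl; elim: N => [|N IH].
  have -> : (fun x => \sum_(0 <= k < 0) f k x) = (fun=> 0).
    by apply/funext => x; rewrite big_geq.
  by rewrite big_geq //; exact: cvg_cst.
have -> : (fun x => \sum_(0 <= k < N.+1) f k x) =
    (fun x => \sum_(0 <= k < N) f k x + f N x).
  by apply/funext => x; rewrite big_nat_recr.
have -> : \sum_(0 <= k < N.+1) l k = \sum_(0 <= k < N) l k + l N by rewrite big_nat_recr.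
by apply: cvgCD; [exact: IH|exact: fl].
Qed.

Lemma cvgC_comp (T : Type) (F : set_system T) (FF : Filter F) (f : T -> C)
    (g : C -> C) (a : C) : {for a, continuous g} -> f @ F --> a ->
  (fun x => g (f x)) @ F --> g a.
Proof. by move=> cg fa; exact: (continuous_cvg _ cg fa). Qed.

Lemma ctsC_id (z : C) : {for z, continuous (fun w : C => w)}.
Proof. by move=> P. Qed.

Lemma Re_series (u : nat -> C) n :
  complex.Re (series u n) = series (fun k => complex.Re (u k)) n.
Proof. by rewrite /series /= raddf_sum. Qed.

Lemma Im_series (u : nat -> C) n :
  complex.Im (series u n) = series (fun k => complex.Im (u k)) n.
Proof. by rewrite /series /= raddf_sum. Qed.

(** Completeness is taken from [R]: the series of real and of imaginary parts are dominated by the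
    series of norms. *)
Lemma cvg_series_rnorm (u : nat -> C) :
  cvgn (series (fun n => rnorm (u n))) -> cvgn (series u).
Proof.
move=> H.
have cr (v : nat -> R) : (forall n, `|v n| <= rnorm (u n)) -> cvgn (series v).
  move=> vu; apply: normed_cvg.
  by apply: series_le_cvg H => n //=; exact: rnorm_ge0.
have /cvg_ex[a Ha] := cr _ (fun n => norm_Re (u n)).
have /cvg_ex[b Hb] := cr _ (fun n => norm_Im (u n)).
apply/cvg_ex; exists (a +i* b); apply/cvgC_ReImP; split => /=.
  by apply: cvg_trans Ha; apply: near_eq_cvg; apply: nearW => n; rewrite Re_series.
by apply: cvg_trans Hb; apply: near_eq_cvg; apply: nearW => n; rewrite Im_series.
Qed.

End ComplexConvergence.

(** * Integration of complex-valued functions *)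

Section ComplexIntegral.
Context d (T : measurableType d) (R : realType).
Variable mu : {measure set T -> \bar R}.
Local Notation C := R[i].
Implicit Types (D : set T) (f g : T -> C).

(** Measurability, integrability and the integral are all taken componentwise, in agreement with
    [circle_integral]. *)
Definition cmeas D f := measurable_fun D (fun t => complex.Re (f t)) /\
  measurable_fun D (fun t => complex.Im (f t)).

Definition cintegrable D f :=
  mu.-integrable D (fun t => (complex.Re (f t))%:E) /\
  mu.-integrable D (fun t => (complex.Im (f t))%:E).

Definition cint D f : C :=
  (\int[mu]_(t in D) complex.Re (f t)) +i* (\int[mu]_(t in D) complex.Im (f t)).

Lemma eq_cmeas D f g : (forall t, D t -> f t = g t) -> cmeas D f -> cmeas D g.
Proof.
by move=> fg [m1 m2]; split; [move: m1|move: m2]; apply: eq_measurable_fun => t;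
  rewrite inE => /fg ->.
Qed.

Lemma eq_cint D f g : (forall t, D t -> f t = g t) -> cint D f = cint D g.
Proof.
by move=> fg; rewrite /cint; congr (_ +i* _); apply: eq_Rintegral => t;
  rewrite inE => /fg ->.
Qed.

Lemma eq_cintegrable D f g : measurable D ->
  (forall t, D t -> f t = g t) -> cintegrable D f -> cintegrable D g.
Proof.
by move=> mD fg [m1 m2]; split; [move: m1|move: m2]; apply: eq_integrable => // t;
  rewrite inE => /fg ->.
Qed.

Lemma cintegrable_meas D f : cintegrable D f -> cmeas D f.
Proof.
by move=> [/integrableP[m1 _] /integrableP[m2 _]]; split;
  exact/measurable_EFinP.
Qed.

Lemma cmeas_cst D c : cmeas D (fun=> c).
Proof. by split; exact: measurable_cst. Qed.

Lemma cmeasD D f g : cmeas D f -> cmeas D g -> cmeas D (fun t => f t + g t).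
Proof.
move=> [f1 f2] [g1 g2]; split.
  by under eq_fun do rewrite RecD; exact: measurable_funD.
by under eq_fun do rewrite ImcD; exact: measurable_funD.
Qed.

Lemma cmeasM D f g : cmeas D f -> cmeas D g -> cmeas D (fun t => f t * g t).
Proof.
move=> [f1 f2] [g1 g2]; split.
  by under eq_fun do rewrite RecM; apply: measurable_funB; exact: measurable_funM.
by under eq_fun do rewrite ImcM; apply: measurable_funD; exact: measurable_funM.
Qed.

Lemma cmeas_sum D (h : nat -> T -> C) n : (forall k, cmeas D (h k)) ->
  cmeas D (fun t => \sum_(0 <= k < n) h k t).
Proof.
move=> mh; elim: n => [|n IH].
  by apply: eq_cmeas (cmeas_cst D 0) => t _; rewrite big_geq.
apply: eq_cmeas (cmeasD IH (mh n)) => t _.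
by rewrite big_nat_recr.
Qed.

Lemma cmeas_lim D (h : nat -> T -> C) f : measurable D ->
  (forall k, cmeas D (h k)) ->
  (forall t, D t -> h ^~ t @ \oo --> f t) -> cmeas D f.
Proof.
move=> mD mh hf; split.
  apply: (measurable_fun_cvg (h := fun k t => complex.Re (h k t))).
    by move=> k; exact: (mh k).1.
  by move=> t /hf /cvgC_ReImP[].
apply: (measurable_fun_cvg (h := fun k t => complex.Im (h k t))).
  by move=> k; exact: (mh k).2.
by move=> t /hf /cvgC_ReImP[].
Qed.

Lemma cmeas_rnorm D f : measurable D -> cmeas D f ->
  measurable_fun D (fun t => rnorm (f t)).
Proof.
move=> mD [m1 m2].
have -> : (fun t => rnorm (f t)) =
    (fun t => Num.sqrt (complex.Re (f t) ^+ 2 + complex.Im (f t) ^+ 2)).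
  by apply/funext => t; rewrite /rnorm normc_def.
apply: (@measurableT_comp _ _ _ _ _ _ (@Num.sqrt R)).
  by apply: continuous_measurable_fun; exact: sqrt_continuous.
by apply: measurable_funD; exact: measurable_funX.
Qed.

Lemma cintegrable_dom D f (g : T -> R) : measurable D -> cmeas D f ->
  mu.-integrable D (EFin \o g) -> (forall t, D t -> rnorm (f t) <= g t) ->
  cintegrable D f.
Proof.
move=> mD [m1 m2] ig fg; split; apply: (le_integrable mD _ _ ig).
- exact/measurable_EFinP.
- move=> t Dt; rewrite /= lee_fin; apply: le_trans (norm_Re _) _.
  by apply: le_trans (fg t Dt) (ler_norm _).
- exact/measurable_EFinP.
- move=> t Dt; rewrite /= lee_fin; apply: le_trans (norm_Im _) _.
  by apply: le_trans (fg t Dt) (ler_norm _).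
Qed.

Lemma integrable_rnorm D f : measurable D -> cintegrable D f ->
  mu.-integrable D (fun t => (rnorm (f t))%:E).
Proof.
move=> mD fi; have [m1 m2] := fi.
apply: (le_integrable mD _ _ (integrableD mD (integrable_abse m1) (integrable_abse m2))).
  exact/measurable_EFinP/cmeas_rnorm/cintegrable_meas.
move=> t Dt /=; rewrite lee_fin ger0_norm ?rnorm_ge0 //.
by apply: le_trans (rnorm_ReIm _) (ler_norm _).
Qed.

Lemma cintegrableD D f g : measurable D -> cintegrable D f -> cintegrable D g ->
  cintegrable D (fun t => f t + g t).
Proof.
move=> mD [f1 f2] [g1 g2]; split.
  by under eq_fun do rewrite RecD EFinD; exact: integrableD.
by under eq_fun do rewrite ImcD EFinD; exact: integrableD.
Qed.

Lemma cintegrableZ D c f : measurable D -> cintegrable D f ->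
  cintegrable D (fun t => c * f t).
Proof.
move=> mD [f1 f2]; split.
  under eq_fun do rewrite RecM EFinB !EFinM.
  by apply: integrableB => //; exact: integrableZl.
under eq_fun do rewrite ImcM EFinD !EFinM.
by apply: integrableD => //; exact: integrableZl.
Qed.

Lemma cintD D f g : measurable D -> cintegrable D f -> cintegrable D g ->
  cint D (fun t => f t + g t) = cint D f + cint D g.
Proof.
move=> mD [f1 f2] [g1 g2]; apply: complexP => /=; rewrite -RintegralD //;
  by apply: eq_Rintegral => t _; rewrite ?RecD ?ImcD.
Qed.

Lemma cintZ D c f : measurable D -> cintegrable D f ->
  cint D (fun t => c * f t) = c * cint D f.
Proof.
move=> mD [f1 f2].
have iZ (r : R) (h : T -> R) : mu.-integrable D (EFin \o h) ->
    mu.-integrable D (fun t => (r * h t)%:E).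
  by move=> ih; under eq_fun do rewrite EFinM; exact: integrableZl.
apply: complexP => /=; rewrite ?RecM ?ImcM /= -!RintegralZl //.
  rewrite -RintegralB //; [|exact: iZ|exact: iZ].
  by apply: eq_Rintegral => t _; rewrite RecM.
rewrite -RintegralD //; [|exact: iZ|exact: iZ].
by apply: eq_Rintegral => t _; rewrite ImcM.
Qed.

Lemma cintegrableB D f g : measurable D -> cintegrable D f -> cintegrable D g ->
  cintegrable D (fun t => f t - g t).
Proof.
move=> mD fi gi; apply: eq_cintegrable (cintegrableD mD fi (cintegrableZ (-1) mD gi)) => //.
by move=> t _; rewrite mulN1r.
Qed.

Lemma cintB D f g : measurable D -> cintegrable D f -> cintegrable D g ->
  cint D (fun t => f t - g t) = cint D f - cint D g.
Proof.
move=> mD fi gi; rewrite -[- cint D g]mulN1r -cintZ // -cintD //.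
  by apply: eq_cint => t _; rewrite mulN1r.
exact: cintegrableZ.
Qed.

Lemma cint_cst D c : measurable D -> cint D (fun=> c) = c * (fine (mu D))%:C.
Proof.
move=> mD; rewrite /cint !Rintegral_cst //.
by apply: complexP; rewrite ?RecM ?ImcM /= mulr0 ?subr0 ?add0r.
Qed.

Lemma cintegrable_sum D (h : nat -> T -> C) n : measurable D ->
  (forall k, cintegrable D (h k)) ->
  cintegrable D (fun t => \sum_(0 <= k < n) h k t).
Proof.
move=> mD hi; elim: n => [|n IH].
  apply: (@eq_cintegrable D (fun=> 0)) => //.
    by move=> t _; rewrite big_geq.
  by split; exact: integrable0.
apply: eq_cintegrable (cintegrableD mD IH (hi n)) => // t _.
by rewrite big_nat_recr.
Qed.

Lemma cint_sum D (h : nat -> T -> C) n : measurable D ->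
  (forall k, cintegrable D (h k)) ->
  cint D (fun t => \sum_(0 <= k < n) h k t) = \sum_(0 <= k < n) cint D (h k).
Proof.
move=> mD hi; elim: n => [|n IH].
  rewrite big_geq //; under eq_cint do rewrite big_geq //.
  by rewrite cint_cst // mul0r.
rewrite big_nat_recr //= -IH -cintD //; last exact: cintegrable_sum.
by apply: eq_cint => t _; rewrite big_nat_recr.
Qed.

(* Rotating the integral to the real axis turns its modulus into a real part,
   so that the bound has constant 1. *)
Lemma le_rnorm_cint D f : measurable D -> cintegrable D f ->
  rnorm (cint D f) <= \int[mu]_(t in D) rnorm (f t).
Proof.
move=> mD fi.
have ir := integrable_rnorm mD fi.
have [I0|I0] := eqVneq (cint D f) 0.
  by rewrite I0 rnorm0; apply: Rintegral_ge0 => t _; exact: rnorm_ge0.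
set I := cint D f in I0 *.
pose u : C := (conjc I) / (rnorm I)%:C.
have rI : rnorm I != 0 by rewrite rnorm_eq0.
have u1 : rnorm u = 1.
  by rewrite rnormM rnorm_conj rnormV rnorm_real ger0_norm ?rnorm_ge0 // divff.
have -> : rnorm I = complex.Re (u * I).
  have -> : u * I = (rnorm I)%:C.
    rewrite mulrAC [conjc _ * _]mulrC mulc_conj expr2 rmorphM mulfK //.
    by rewrite -(inj_eq (@complexI R)) in rI.
  by [].
rewrite /I -cintZ //=.
apply: le_Rintegral => //.
  exact: (cintegrableZ u mD fi).1.
move=> t Dt; apply: le_trans (ler_norm _) _; apply: le_trans (norm_Re _) _.
by rewrite rnormM u1 mul1r.
Qed.

Lemma cint_dominated D (h : nat -> T -> C) f (g : T -> R) : measurable D ->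
  (forall k, cmeas D (h k)) ->
  (forall t, D t -> h ^~ t @ \oo --> f t) ->
  mu.-integrable D (EFin \o g) ->
  (forall k t, D t -> rnorm (h k t) <= g t) ->
  cint D (h k) @[k --> \oo] --> cint D f.
Proof.
move=> mD mh hf ig hg.
have [mf1 mf2] := cmeas_lim mD mh hf.
have key (p : C -> R) : (forall k, measurable_fun D (fun t => p (h k t))) ->
    measurable_fun D (fun t => p (f t)) ->
    (forall t, D t -> p (h k t) @[k --> \oo] --> p (f t)) ->
    (forall z, `|p z| <= rnorm z) ->
    \int[mu]_(t in D) p (h k t) @[k --> \oo] --> \int[mu]_(t in D) p (f t).
  move=> m1 m2 cv pb.
  have [] := @dominated_convergence _ T R mu D mD
    (fun k t => (p (h k t))%:E) (fun t => (p (f t))%:E) (EFin \o g) _ _ _ ig _.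
  - by move=> k; exact/measurable_EFinP.
  - exact/measurable_EFinP.
  - apply: aeW => t Dt; apply: cvg_EFin; last exact: cv.
    exact: nearW.
  - apply: aeW => t k Dt /=; rewrite lee_fin.
    by apply: le_trans (pb _) _; exact: hg.
  move=> if_ _ H; apply: fine_cvg; rewrite fineK //.
  exact: integrable_fin_num.
apply/cvgC_ReImP; split.
  apply: key => [k||t Dt|z]; [exact: (mh k).1|by []| |exact: norm_Re].
  by have /cvgC_ReImP[] := hf t Dt.
apply: key => [k||t Dt|z]; [exact: (mh k).2|by []| |exact: norm_Im].
by have /cvgC_ReImP[] := hf t Dt.
Qed.

Lemma cintegrableM D f g (M : R) : measurable D -> cintegrable D f -> cmeas D g ->
  (forall t, D t -> rnorm (g t) <= M) -> cintegrable D (fun t => f t * g t).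
Proof.
move=> mD fi mg gM.
have ir := integrableZl mD M (integrable_rnorm mD fi).
apply: (@cintegrable_dom D _ (fun t => M * rnorm (f t)) mD _ ir).
  by apply: cmeasM => //; exact: cintegrable_meas.
by move=> t Dt; rewrite rnormM mulrC ler_wpM2r ?rnorm_ge0 ?gM.
Qed.

End ComplexIntegral.

(** * Goursat's lemma in the plane *)

Section Goursat.
Variable R : realType.
Local Notation C := R[i].
Local Notation mu := (@lebesgue_measure R).
Local Notation "\oint_ ( a , b ) f" := (cint mu `[a, b]%classic f)
  (at level 36, a at level 10, b at level 10, f at level 36).

Lemma continuous_cmeas (f : R -> C) D : measurable D -> continuous f -> cmeas D f.
Proof.
move=> mD cf; split; apply: measurable_funTS; apply: continuous_measurable_fun => x.
  by apply: (@continuous_comp R C R f (@complex.Re R)); [exact: cf|exact: Re_continuous].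
by apply: (@continuous_comp R C R f (@complex.Im R)); [exact: cf|exact: Im_continuous].
Qed.

Lemma continuous_cintegrable (f : R -> C) a b : continuous f ->
  cintegrable mu `[a, b]%classic f.
Proof.
move=> cf.
have ci (g : R -> R) : continuous g -> mu.-integrable `[a, b] (EFin \o g).
  move=> cg; apply: continuous_compact_integrable; first exact: segment_compact.
  exact: continuous_subspaceT.
split; apply: ci => x.
  by apply: (@continuous_comp R C R f (@complex.Re R)); [exact: cf|exact: Re_continuous].
by apply: (@continuous_comp R C R f (@complex.Im R)); [exact: cf|exact: Im_continuous].
Qed.

Lemma cint_split (f : R -> C) a b c : a <= b -> b <= c -> continuous f ->
  \oint_(a, c) f = \oint_(a, b) f + \oint_(b, c) f.
Proof.
move=> ab bc cf.
have [i1 i2] := continuous_cintegrable a c cf.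
have key (g : R -> R) : mu.-integrable `[a, c] (EFin \o g) ->
    \int[mu]_(t in `[a, c]) g t =
    \int[mu]_(t in `[a, b]) g t + \int[mu]_(t in `[b, c]) g t.
  move=> ig; apply/eqP; rewrite addrC -subr_eq; apply/eqP.
  rewrite Rintegral_itvB ?bnd_simp //.
  apply: Rintegral_itv_obnd_cbnd; apply: integrableS ig => //.
  by apply: subset_itvr; rewrite bnd_simp.
by apply: complexP => /=; exact: key.
Qed.

Lemma fine_mu_itv a b : a <= b -> fine (mu `[a, b]%classic) = b - a.
Proof.
move=> ab; rewrite /= lebesgue_measure_itv /= lte_fin.
by case: ltgtP ab => //= -> _; rewrite subrr.
Qed.

Lemma le_cint_itv (f : R -> C) a b (M : R) : a <= b -> continuous f ->
  (forall t, a <= t <= b -> rnorm (f t) <= M) ->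
  rnorm (\oint_(a, b) f) <= M * (b - a).
Proof.
move=> ab cf fM; have fi := continuous_cintegrable a b cf.
apply: le_trans (le_rnorm_cint _ fi) _ => //.
have -> : M * (b - a) = \int[mu]_(t in `[a, b]) M.
  by rewrite Rintegral_cst // fine_mu_itv.
apply: le_Rintegral => //; first exact: integrable_rnorm.
  apply: continuous_compact_integrable; first exact: segment_compact.
  by apply: continuous_subspaceT; exact: cst_continuous.
Qed.

Lemma cint_itv_cst c a b : a <= b -> \oint_(a, b) (fun=> c) = c * (b - a)%:C.
Proof.
by move=> ab; rewrite cint_cst // fine_mu_itv.
Qed.

(** The contour integral of [F dz] around the rectangle with lower left corner [(x, y)] and sides
    [s], [t]: bottom minus top, plus ['i] times right minus left. *)
Definition rect_int (F : R -> R -> C) (x y s t : R) : C :=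
  \oint_(x, x + s) (fun u => F u y - F u (y + t)) +
  'i * \oint_(y, y + t) (fun v => F (x + s) v - F x v).

(** Complex differentiability at [x0 + i y0] in real coordinates, in the form without quotients that
    integrates directly over the sides of a rectangle. *)
Definition plane_derivable (F : R -> R -> C) (x0 y0 : R) := exists l : C,
  forall e : R, 0 < e -> exists2 r : R, 0 < r &
  forall x y, `|x - x0| < r -> `|y - y0| < r ->
  rnorm (F x y - F x0 y0 - l * ((x - x0)%:C + 'i * (y - y0)%:C)) <=
  e * (`|x - x0| + `|y - y0|).

Section Rectangle.
Variable F : R -> R -> C.
Hypothesis cF1 : forall y, continuous (F ^~ y).
Hypothesis cF2 : forall x, continuous (F x).

Let contB (f g : R -> C) : continuous f -> continuous g ->
  continuous (fun t => f t - g t).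
Proof. by move=> cf cg t; apply: cvgB; [exact: cf|exact: cg]. Qed.

Lemma rect_intE x y s t : rect_int F x y s t =
  \oint_(x, x + s) (F ^~ y) - \oint_(x, x + s) (F ^~ (y + t)) +
  'i * (\oint_(y, y + t) (F (x + s)) - \oint_(y, y + t) (F x)).
Proof.
by rewrite /rect_int !cintB //; exact: continuous_cintegrable.
Qed.

Lemma rect_int_quad x y s t : 0 <= s -> 0 <= t ->
  rect_int F x y (s + s) (t + t) =
  rect_int F x y s t + rect_int F (x + s) y s t +
  rect_int F x (y + t) s t + rect_int F (x + s) (y + t) s t.
Proof.
move=> s0 t0; rewrite !rect_intE !addrA.
rewrite !(@cint_split _ x (x + s) (x + s + s)) ?lerDl // .
rewrite !(@cint_split _ y (y + t) (y + t + t)) ?lerDl // .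
ring.
Qed.

(** If each quarter had less than a fourth of the total modulus, the four could not add up to the
    whole. *)
Lemma rect_int_quad_exists x y s t : 0 <= s -> 0 <= t ->
  exists p : R * R, [/\ x <= p.1 <= x + s, y <= p.2 <= y + t &
    rnorm (rect_int F x y (s + s) (t + t)) <= 4 * rnorm (rect_int F p.1 p.2 s t)].
Proof.
move=> s0 t0; apply: contrapT => H.
have K x' y' : x <= x' <= x + s -> y <= y' <= y + t ->
    4 * rnorm (rect_int F x' y' s t) < rnorm (rect_int F x y (s + s) (t + t)).
  by move=> hx hy; rewrite ltNge; apply/negP => h; apply: H; exists (x', y').
have xs : x <= x + s by rewrite lerDl.
have yt : y <= y + t by rewrite lerDl.
have := K x y; have := K (x + s) y; have := K x (y + t); have := K (x + s) (y + t).
rewrite !lexx xs yt => /(_ isT isT) k1 /(_ isT isT) k2 /(_ isT isT) k3 /(_ isT isT) k4.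
have := rect_int_quad x y s0 t0 => E.
suff : rnorm (rect_int F x y (s + s) (t + t)) <=
    rnorm (rect_int F x y s t) + rnorm (rect_int F (x + s) y s t) +
    rnorm (rect_int F x (y + t) s t) + rnorm (rect_int F (x + s) (y + t) s t) by lra.
rewrite {1}E; apply: le_trans (rnormD _ _) _; rewrite lerD2r.
by apply: le_trans (rnormD _ _) _; rewrite lerD2r; exact: rnormD.
Qed.

Lemma rect_int_local x0 y0 : plane_derivable F x0 y0 -> forall e, 0 < e ->
  exists2 r : R, 0 < r & forall x y s t, 0 <= s < r -> 0 <= t < r ->
  x <= x0 <= x + s -> y <= y0 <= y + t ->
  rnorm (rect_int F x y s t) <= e * (s + t) ^+ 2.
Proof.
move=> [l Fl] e e0; have e20 : 0 < e / 2 by rewrite divr_gt0.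
have [r r0 H] := Fl _ e20; exists r => // x y s t /andP[s0 sr] /andP[t0 tr].
move=> /andP[x1 x2] /andP[y1 y2].
pose Q u v := F u v - F x0 y0 - l * ((u - x0)%:C + 'i * (v - y0)%:C).
have QE u v : x <= u <= x + s -> y <= v <= y + t -> rnorm (Q u v) <= e / 2 * (s + t).
  move=> /andP[u1 u2] /andP[v1 v2].
  have hu : `|u - x0| <= s by rewrite ler_norml; apply/andP; split; lra.
  have hv : `|v - y0| <= t by rewrite ler_norml; apply/andP; split; lra.
  apply: le_trans (H u v _ _) _; [exact: le_lt_trans sr|exact: le_lt_trans tr|].
  by rewrite ler_pM2l // lerD.
have sl : s = (x + s) - x by ring.
have tl : t = (y + t) - y by ring.
have xs : x <= x + s by rewrite lerDl.
have yt : y <= y + t by rewrite lerDl.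
(* The affine part of [F] contributes [l * 'i * s * t] along the horizontal sides and its opposite
   along the vertical ones, so it can be subtracted for free; only the remainder [Q] is left to
   estimate. *)
have -> : rect_int F x y s t =
    \oint_(x, x + s) (fun u => F u y - F u (y + t) - (- (l * ('i * t%:C)))) +
    'i * \oint_(y, y + t) (fun v => F (x + s) v - F x v - l * s%:C).
  rewrite /rect_int !(@cintB _ _ _ _ _ (fun u => F _ _ - F _ _)) //; last first.
  - exact/continuous_cintegrable/cst_continuous.
  - by apply: continuous_cintegrable; apply: contB.
  - exact/continuous_cintegrable/cst_continuous.
  - by apply: continuous_cintegrable; apply: contB.
  by rewrite !cint_itv_cst // -sl -tl; ring.
have cc (c : C) (f g : R -> C) : continuous f -> continuous g ->
    continuous (fun u => f u - g u - c).
  by move=> cf cg; apply: contB; [exact: contB | exact: cst_continuous].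
apply: le_trans (rnormD _ _) _; rewrite rnormM rnorm_i mul1r.
have -> : e * (s + t) ^+ 2 = e * (s + t) * s + e * (s + t) * t by ring.
apply: lerD; [rewrite [X in _ <= _ * X]sl|rewrite [X in _ <= _ * X]tl];
  apply: le_cint_itv => //; try exact: cc.
- move=> u hu; have -> : F u y - F u (y + t) - - (l * ('i * t%:C)) =
    Q u y - Q u (y + t) by rewrite /Q !rmorphB rmorphD /=; ring.
  apply: le_trans (rnormB_le _ _) _.
  have := QE u y hu; have := QE u (y + t) hu; rewrite !lexx yt => /(_ isT) + /(_ isT).
  lra.
- move=> v hv; have -> : F (x + s) v - F x v - l * s%:C =
    Q (x + s) v - Q x v by rewrite /Q !rmorphB rmorphD /=; ring.
  apply: le_trans (rnormB_le _ _) _.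
  have := QE (x + s) v; have := QE x v; rewrite !lexx xs => /(_ isT hv) + /(_ isT hv).
  lra.
Qed.

(** Left ends increase and right ends decrease, so the limit of the left ends lies in every
    interval. *)
Lemma nested_bisection (x : nat -> R) (s : R) : 0 <= s ->
  (forall n, x n <= x n.+1 <= x n + s / 2 ^+ n.+1) ->
  exists x0, forall n, x n <= x0 <= x n + s / 2 ^+ n.
Proof.
move=> s0 H.
have E n : s / 2 ^+ n = s / 2 ^+ n.+1 + s / 2 ^+ n.+1.
  by rewrite exprS; field; rewrite expf_neq0.
have nd : nondecreasing_seq x by apply/nondecreasing_seqP => n; case/andP: (H n).
have ni : nonincreasing_seq (fun n => x n + s / 2 ^+ n).
  apply/nonincreasing_seqP => n; rewrite (E n); have /andP[_] := H n; lra.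
have pos n : 0 <= s / 2 ^+ n by rewrite divr_ge0 // exprn_ge0.
have xub m n : x m <= x n + s / 2 ^+ n.
  have [mn|nm] := leqP m n.
    by apply: le_trans (nd _ _ mn) _; rewrite lerDl.
  by apply: le_trans (ni _ _ (ltnW nm)); rewrite lerDl.
have cx : cvgn x.
  by apply: nondecreasing_is_cvgn => //; exists (x 0%N + s / 2 ^+ 0) => _ [m _ <-].
exists (limn x) => n; apply/andP; split; first exact: nondecreasing_cvgn_le.
by apply: limr_le => //; apply: nearW.
Qed.

(** Each bisection may cost a factor 4 in the modulus of the integral, and this is exactly the
    factor gained by the squared size in [rect_int_local] when the sides are halved. *)
Lemma goursat X Y S T : 0 <= S -> 0 <= T ->
  (forall x y, X <= x <= X + S -> Y <= y <= Y + T -> plane_derivable F x y) ->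
  rect_int F X Y S T = 0.
Proof.
move=> S0 T0 dF; apply/eqP; rewrite -rnorm_eq0.
have [//|c0] := eqVneq (rnorm (rect_int F X Y S T)) 0.
have {}c0 : 0 < rnorm (rect_int F X Y S T) by rewrite lt_neqAle eq_sym c0 rnorm_ge0.
set c := rnorm _ in c0 *.
have E n (u : R) : u / 2 ^+ n = u / 2 ^+ n.+1 + u / 2 ^+ n.+1.
  by rewrite exprS; field; rewrite expf_neq0.
have pos n (u : R) : 0 <= u -> 0 <= u / 2 ^+ n.
  by move=> u0; rewrite divr_ge0 // exprn_ge0.
have /choice[f Hf] : forall q : R * R * nat, exists p : R * R,
    [/\ q.1.1 <= p.1 <= q.1.1 + S / 2 ^+ q.2.+1,
        q.1.2 <= p.2 <= q.1.2 + T / 2 ^+ q.2.+1 &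
    rnorm (rect_int F q.1.1 q.1.2 (S / 2 ^+ q.2) (T / 2 ^+ q.2)) <=
    4 * rnorm (rect_int F p.1 p.2 (S / 2 ^+ q.2.+1) (T / 2 ^+ q.2.+1))].
  move=> [[x y] n] /=; rewrite (E n S) (E n T).
  by apply: rect_int_quad_exists; exact: pos.
pose fix Q n := if n is m.+1 then f (Q m, m) else (X, Y).
have QS n := Hf (Q n, n).
have Qc n : c <= 4 ^+ n * rnorm (rect_int F (Q n).1 (Q n).2 (S / 2 ^+ n) (T / 2 ^+ n)).
  elim: n => [|n IH]; first by rewrite /c !expr0 mul1r !divr1.
  apply: le_trans IH _; rewrite exprSr -mulrA ler_pM2l ?exprn_gt0 //.
  by have [_ _] := QS n.
have [x0 Hx] := @nested_bisection (fun n => (Q n).1) S S0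
  (fun n => let: And3 a _ _ := QS n in a).
have [y0 Hy] := @nested_bisection (fun n => (Q n).2) T T0
  (fun n => let: And3 _ b _ := QS n in b).
have := dF x0 y0; have := Hx 0%N; have := Hy 0%N; rewrite /= !expr0 !divr1.
move=> h1 h2 /(_ h2 h1) /rect_int_local.
(* Chosen so that [e * (S + T) ^+ 2 < c]; the added 1 covers the rectangle reduced to a point. *)
pose e := c / (2 * ((S + T) ^+ 2 + 1)).
have K0 : 0 < (S + T) ^+ 2 + 1 by rewrite ltr_wpDl ?sqr_ge0.
have e0 : 0 < e by rewrite divr_gt0 // mulr_gt0.
move=> /(_ e e0)[r r0 Hr].
have [n [nS nT]] : exists n, S / 2 ^+ n < r /\ T / 2 ^+ n < r.
  have cv (u : R) : (u / 2 ^+ n) @[n --> \oo] --> (0 : R).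
    have -> : (fun n => u / 2 ^+ n) = geometric u 2^-1.
      by apply/funext => n; rewrite /geometric /= exprVn.
    by apply: cvg_geometric; rewrite ger0_norm ?invr_ge0 // invf_lt1 ?ltr1n.
  near \oo => n; exists n; split; near: n.
    by move: (cv S) => /cvgrPdist_lt/(_ r r0); apply: filterS => n; rewrite sub0r normrN;
      apply: le_lt_trans; exact: ler_norm.
  by move: (cv T) => /cvgrPdist_lt/(_ r r0); apply: filterS => n; rewrite sub0r normrN;
      apply: le_lt_trans; exact: ler_norm.
have := Hr (Q n).1 (Q n).2 (S / 2 ^+ n) (T / 2 ^+ n).
rewrite !pos // nS nT => /(_ isT isT (Hx n) (Hy n)) B.
have := Qc n; have p4 : 0 < (4 : R) ^+ n by rewrite exprn_gt0.
have : 4 ^+ n * (e * (S / 2 ^+ n + T / 2 ^+ n) ^+ 2) = e * (S + T) ^+ 2.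
  have -> : (4 : R) ^+ n = 2 ^+ n * 2 ^+ n by rewrite -exprMn; congr (_ ^+ _); ring.
  by field; rewrite expf_neq0.
have : 4 ^+ n * rnorm (rect_int F (Q n).1 (Q n).2 (S / 2 ^+ n) (T / 2 ^+ n)) <=
   4 ^+ n * (e * (S / 2 ^+ n + T / 2 ^+ n) ^+ 2) by rewrite ler_pM2l.
move=> a E1 b; rewrite E1 in a.
have : e * (S + T) ^+ 2 < c.
  rewrite /e mulrAC ltr_pdivrMr ?mulr_gt0 // ltr_pM2l //.
  have := sqr_ge0 (S + T); lra.
lra.
Unshelve. all: by end_near. Qed.

End Rectangle.
End Goursat.

(** * Polar coordinates *)

Section Expi.
Variable R : realType.

Lemma rnorm_expi t : rnorm (@expi R t) = 1.
Proof. by rewrite /rnorm /expi normc_def /= cos2Dsin2 sqrtr1. Qed.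

Lemma expiD s t : @expi R (s + t) = expi s * expi t.
Proof.
apply: complexP; rewrite ?RecM ?ImcM /expi /=; first by rewrite cosD.
by rewrite sinD; ring.
Qed.

Lemma expiD2pi t : @expi R (t + pi *+ 2) = expi t.
Proof. by rewrite /expi cosD2pi sinD2pi. Qed.

Lemma expi_continuous : continuous (@expi R).
Proof.
move=> t; apply/cvgC_ReImP; split => /=; first exact: continuous_cos.
exact: continuous_sin.
Qed.

Lemma expi_unit t : unit_circle (@expi R t).
Proof. by rewrite /unit_circle /= rnormE rnorm_expi. Qed.

End Expi.

Section Derivatives.
Variable R : realType.
Local Notation C := R[i].

Lemma nbhsC_rnormP (z : C) (P : set C) :
  nbhs z P <-> exists2 r : R, 0 < r & forall w, rnorm (w - z) < r -> P w.
Proof.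
split=> [/nbhs_ballP[e e0 zP]|[r r0 rP]].
  exists (rnorm e); first by rewrite rnorm_gt0 gt_eqF.
  move=> w wz; apply: zP; rewrite -ball_normE /=.
  have -> : e = (rnorm e)%:C by rewrite -rnormE gtr0_norm.
  by rewrite distrC -rnorm_lt.
have : nbhs z (ball z r%:C) by apply: nbhsx_ballx; rewrite ltcR.
by apply: filterS => w; rewrite -ball_normE /= distrC -rnorm_lt; exact: rP.
Qed.

(** The derivative without a quotient: it includes [w = z] and composes with a change of
    variables. *)
Definition cderiv (f : C -> C) (z l : C) := forall e : R, 0 < e ->
  exists2 r : R, 0 < r & forall w, rnorm (w - z) < r ->
  rnorm (f w - f z - l * (w - z)) <= e * rnorm (w - z).

Lemma derivable_cderiv (f : C -> C) z : derivable f z 1 ->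
  exists l, cderiv f z l.
Proof.
move=> /cvg_ex[l]; rewrite /= => H; exists l => e e0.
have {}H := (cvgC_distP (dnbhs_filter (0 : C)) _ _).1 H.
have /(nbhsC_rnormP 0)[r r0 rP] := H e e0.
exists r => // w wr; have [->|wz] := eqVneq w z.
  by rewrite !subrr mulr0 subr0 rnorm0 mulr0.
have wz0 : w - z != 0 by rewrite subr_eq0.
have := rP (w - z); rewrite subr0 => /(_ wr wz0).
rewrite /= -[_ *: 1]/((w - z) * 1) mulr1 subrK => {}H.
rewrite -ler_pdivrMr ?rnorm_gt0 // -rnormV -rnormM.
apply: ltW; apply: le_lt_trans H.
rewrite rnorm_distC -[_ *: _]/((w - z)^-1 * _).
by rewrite mulrC mulrBr [_ * (l * _)]mulrC mulfK.
Qed.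

Lemma cderiv_derivable (f : C -> C) z l : cderiv f z l -> derivable f z 1.
Proof.
move=> H; apply/cvg_ex; exists l.
apply/(cvgC_distP (dnbhs_filter (0 : C))) => e e0.
have e20 : 0 < e / 2 by rewrite divr_gt0.
have [r r0 Hr] := H _ e20.
apply/(nbhsC_rnormP 0); exists r => // w; rewrite subr0 => wr /= w0.
have := Hr (w + z); rewrite addrK => /(_ wr).
rewrite -ler_pdivrMr ?rnorm_gt0 // -rnormV -rnormM.
have -> : l - w^-1 *: (f (w *: 1 + z) - f z) =
    - ((f (w + z) - f z - l * w) / w).
  rewrite -[w *: 1]/(w * 1) mulr1 -[_ *: (f _ - _)]/(w^-1 * _).
  by field.
rewrite rnormN => K; apply: le_lt_trans K _; lra.
Qed.

Lemma is_derive_eps (f : R -> R) (x d : R) : is_derive x (1 : R) f d -> forall e, 0 < e ->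
  exists2 r : R, 0 < r & forall h, `|h| < r ->
  `|f (x + h) - f x - d * h| <= e * `|h|.
Proof.
move=> [df fd] e e0.
have : (fun h => h^-1 *: ((f \o shift x) (h *: 1) - f x)) @ 0^' --> d.
  by rewrite -fd; exact: df.
move=> /cvgrPdist_lt/(_ e e0) /nbhs_ballP[r /= r0 rP].
exists r => // h hr; have [->|h0] := eqVneq h 0.
  by rewrite addr0 subrr mulr0 subr0 normr0 mulr0.
have := rP h; rewrite -ball_normE /= sub0r normrN => /(_ hr h0).
rewrite -[h *: 1]/(h * 1) mulr1 -[_ *: (f _ - _)]/(h^-1 * _) [h + x]addrC => {}H.
rewrite -ler_pdivrMr ?normr_gt0 // -normfV -normrM; apply: ltW.
apply: le_lt_trans H; rewrite distrC.
by rewrite [leRHS](_ : _ = `|(f (x + h) - f x - d * h) * h^-1|) ?lexx //; congr `|_|; field.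
Qed.

(** This is the exponential of [x + i y]. It wraps a rectangle of height [2 pi] around an annulus,
    so Goursat's lemma for rectangles yields Cauchy's theorem for concentric circles; vertical sides
    become circles with the measure [dt]. *)
Definition polar (x y : R) : C := (expR x)%:C * expi y.

Lemma polarD x y h k : polar (x + h) (y + k) = polar x y * polar h k.
Proof. by rewrite /polar expRD expiD rmorphM /=; ring. Qed.

Lemma rnorm_polar x y : rnorm (polar x y) = expR x.
Proof. by rewrite rnormM rnorm_expi mulr1 rnorm_real gtr0_norm ?expR_gt0. Qed.

(** The derivative at 0 follows from those of [expR], [sin] and [cos]; [polarD] then carries it to
    every other point. *)
Lemma polar_deriv0 e : 0 < e -> exists2 r : R, 0 < r & forall h k,
  `|h| < r -> `|k| < r ->
  rnorm (polar h k - 1 - (h%:C + 'i * k%:C)) <= e * (`|h| + `|k|).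
Proof.
(* Two of the errors below are at most [3 * m * |k|], whence the 6; [m] also serves as a bound for
   [|k|] in the mixed term, and [m <= 1] keeps [expR h] below 3. *)
move=> e0; have [m [m0 me m1]] : exists m, [/\ 0 < m, m <= e / 6 & m <= 1].
  by exists (Num.min (e / 6) 1); rewrite lt_min divr_gt0 //= ltr01 !ge_min !lexx orbT.
have [r1 r10 H1] := is_derive_eps (is_derive_expR 0) m0.
have [r2 r20 H2] := is_derive_eps (is_derive_sin 0) m0.
have [r3 r30 H3] := is_derive_eps (is_derive_cos 0) m0.
exists (Num.min (Num.min r1 m) (Num.min r2 r3)).
  by rewrite !lt_min r10 m0 r20 r30.
move=> h k; rewrite !lt_min => /andP[/andP[h1 hm] /andP[h2 h3]].
move=> /andP[/andP[k1 km] /andP[k2 k3]].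
have := H1 h h1; have := H2 k k2; have := H3 k k3.
rewrite !add0r expR0 sin0 cos0 oppr0 mul0r !subr0 ?addr0 !mul1r => {}H3 {}H2 {}H1.
have D1 : `|expR h - 1| <= 2 * `|h|.
  have : `|expR h - 1| <= `|expR h - 1 - h| + `|h|.
    by rewrite -[X in `|X|](subrK h) (le_trans (ler_normD _ _)) // subrK.
  have : m * `|h| <= 1 * `|h| by rewrite ler_wpM2r.
  lra.
have E3 : expR h <= 3.
  have := ler_norm (expR h - 1); lra.
apply: le_trans (rnorm_ReIm _) _.
rewrite !RecB !ImcB /polar /expi !RecM !ImcM /= ?RecM ?ImcM /=.
rewrite !(mul0r, mul1r, mulr0, subr0, sub0r, addr0, add0r).
have -> : expR h * cos k - 1 - h = (expR h - 1 - h) + expR h * (cos k - 1) by ring.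
have -> : expR h * sin k - k = expR h * (sin k - k) + (expR h - 1) * k by ring.
have t1 : `|expR h * (cos k - 1)| <= 3 * (m * `|k|).
  by rewrite normrM (gtr0_norm (expR_gt0 h)); apply: ler_pM.
have t2 : `|expR h * (sin k - k)| <= 3 * (m * `|k|).
  by rewrite normrM (gtr0_norm (expR_gt0 h)); apply: ler_pM.
have t3 : `|(expR h - 1) * k| <= 2 * m * `|h|.
  rewrite normrM; apply: le_trans (ler_pM _ _ D1 (ltW km)) _ => //; lra.
have := ler_normD (expR h - 1 - h) (expR h * (cos k - 1)).
have := ler_normD (expR h * (sin k - k)) ((expR h - 1) * k).
have := ler_wpM2r (normr_ge0 h) me; have := ler_wpM2r (normr_ge0 k) me.
have := mulr_ge0 (ltW m0) (normr_ge0 h); have := mulr_ge0 (ltW e0) (normr_ge0 h).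
have := mulr_ge0 (ltW e0) (normr_ge0 k); lra.
Qed.

Lemma polar_plane_derivable (f : C -> C) x0 y0 l : cderiv f (polar x0 y0) l ->
  plane_derivable (fun x y => f (polar x y)) x0 y0.
Proof.
move=> fl; set w0 := polar x0 y0 in fl *.
exists (l * w0) => e e0.
have N0 := rnorm_ge0 w0; have L0 := rnorm_ge0 l.
(* The error splits into two halves [e / 2]: the one of [f] is multiplied by an increment of at most
   [2 * rnorm w0 * s], the one of [polar] by [rnorm l * rnorm w0]. Adding 1 keeps both denominators
   positive. *)
have P1 : 0 < 4 * rnorm w0 + 1 by lra.
have P2 : 0 < 2 * (rnorm l * rnorm w0) + 1 by have := mulr_ge0 L0 N0; lra.
have e10 : 0 < e / (4 * rnorm w0 + 1) by rewrite divr_gt0.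
have e20 : 0 < Num.min 1 (e / (2 * (rnorm l * rnorm w0) + 1)).
  by rewrite lt_min ltr01 divr_gt0.
have [r1 r10 H1] := fl _ e10; have [r2 r20 H2] := polar_deriv0 e20.
have r30 : 0 < r1 / (4 * rnorm w0 + 1) by rewrite divr_gt0.
exists (Num.min r2 (r1 / (4 * rnorm w0 + 1))); first by rewrite lt_min r20 r30.
move=> x y; rewrite !lt_min => /andP[x2 x1] /andP[y2 y1].
have := H2 _ _ x2 y2; set h := x - x0 in x1 x2 *; set k := y - y0 in y1 y2 *.
set d := _ - 1 - _; set s := `|h| + `|k| => dE.
have s0 : 0 <= s by rewrite addr_ge0.
have wE : polar x y = w0 * polar h k.
  by rewrite /w0 -polarD; congr polar; rewrite /h /k; ring.
have hk : rnorm (h%:C + 'i * k%:C) <= s.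
  by apply: le_trans (rnormD _ _) _; rewrite rnormM rnorm_i mul1r !rnorm_real.
have ww0 : polar x y - w0 = w0 * (d + (h%:C + 'i * k%:C)) by rewrite wE /d; ring.
have d1 : rnorm d <= s.
  apply: le_trans dE _; rewrite -[leRHS]mul1r ler_wpM2r // ge_min lexx //.
have dl : rnorm d <= e / (2 * (rnorm l * rnorm w0) + 1) * s.
  by apply: le_trans dE _; rewrite ler_wpM2r // ge_min lexx orbT.
have wn : rnorm (polar x y - w0) <= rnorm w0 * (2 * s).
  rewrite ww0 rnormM ler_wpM2l //; apply: le_trans (rnormD _ _) _; lra.
have wr : rnorm (polar x y - w0) < r1.
  apply: le_lt_trans wn _.
  have : s < 2 * (r1 / (4 * rnorm w0 + 1)) by rewrite /s; lra.
  move=> sr; have [n0|n0] := eqVneq (rnorm w0) 0; first by rewrite n0 mul0r.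
  have n1 : 0 < rnorm w0 by rewrite lt_neqAle eq_sym n0.
  apply: (@lt_trans _ _ (rnorm w0 * (4 * (r1 / (4 * rnorm w0 + 1))))).
    by rewrite ltr_pM2l //; lra.
  have -> : rnorm w0 * (4 * (r1 / (4 * rnorm w0 + 1))) =
     r1 * (4 * rnorm w0 / (4 * rnorm w0 + 1)) by field; lra.
  by rewrite gtr_pMr // ltr_pdivrMr //; lra.
have -> : f (polar x y) - f w0 - l * w0 * (h%:C + 'i * k%:C) =
   (f (polar x y) - f w0 - l * (polar x y - w0)) + l * (w0 * d).
  by rewrite ww0; ring.
apply: le_trans (rnormD _ _) _.
have -> : e * s = e / 2 * s + e / 2 * s by field.
apply: lerD.
  apply: le_trans (H1 _ wr) _; apply: le_trans (ler_wpM2l (ltW e10) wn) _.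
  rewrite !mulrA ler_wpM2r // -!mulrA ler_wpM2l ?(ltW e0) //.
  by rewrite mulrC ler_pdivrMr //; lra.
rewrite (rnormM l) (rnormM w0) mulrA; apply: le_trans (ler_wpM2l (mulr_ge0 L0 N0) dl) _.
rewrite [leLHS]mulrA ler_wpM2r // [leLHS]mulrCA ler_wpM2l ?(ltW e0) //.
by rewrite ler_pdivrMr //; have := mulr_ge0 L0 N0; lra.
Qed.

End Derivatives.

(** * The mean value property *)

Section MeanValue.
Variable R : realType.
Local Notation C := R[i].
Local Notation mu := (@lebesgue_measure R).
Local Notation D := (@open_disk R).
Local Notation cD := (@closed_disk R).

Lemma open_diskP (z : C) : D z <-> rnorm z < 1.
Proof. by rewrite /open_disk /= rnormE ltcR. Qed.

Lemma closed_diskP (z : C) : cD z <-> rnorm z <= 1.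
Proof. by rewrite /closed_disk /= rnormE lecR. Qed.

Lemma open_disk_near (z : C) : D z -> \forall w \near z, D w.
Proof.
move=> /open_diskP Dz; apply/nbhsC_rnormP; exists (1 - rnorm z).
  by rewrite subr_gt0.
move=> w wz; apply/open_diskP.
have := rnormD (w - z) z; rewrite subrK; lra.
Qed.

(** The radial projection onto the closed disk. Composing with it turns continuity within the disk
    into continuity on the whole plane, as the integration lemmas require. *)
Definition retract (w : C) : C := w / (Num.max 1 (rnorm w))%:C.

Lemma retract_id w : cD w -> retract w = w.
Proof. by move=> /closed_diskP w1; rewrite /retract max_l // divr1. Qed.

Lemma retract_closed_disk w : cD (retract w).
Proof.
apply/closed_diskP; rewrite rnormM rnormV rnorm_real.
have m0 : 0 < Num.max 1 (rnorm w) by rewrite lt_max ltr01.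
by rewrite gtr0_norm // ler_pdivrMr // mul1r le_max lexx orbT.
Qed.

Lemma retract_continuous : continuous retract.
Proof.
rewrite /retract => w.
have m0 : 0 < Num.max 1 (rnorm w) by rewrite lt_max ltr01.
apply: (cvgCM (nbhs_filter w)); first exact: ctsC_id.
apply: (cvgCV (nbhs_filter w)).
  by rewrite (inj_eq (@complexI R) _ 0) gt_eqF.
apply: (cvgC_real (nbhs_filter w)).
apply: (@continuous_max _ _ (fun=> 1)); first exact: cst_continuous.
exact: rnorm_continuous.
Qed.

Lemma within_closed_diskP (f : C -> C) :
  {within cD, continuous f} <->
  forall z, cD z -> f @ within cD (nbhs z) --> f z.
Proof. exact: subspace_continuousP. Qed.

Lemma retract_comp_continuous (f : C -> C) :
  {within cD, continuous f} -> continuous (f \o retract).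
Proof.
move=> /within_closed_diskP cf w.
have : retract @ nbhs w --> within cD (nbhs (retract w)).
  move=> P; rewrite /within /= => nP.
  have : \forall x \near w, cD (retract x) -> P (retract x).
    exact: (retract_continuous nP).
  by apply: filterS => x; apply; exact: retract_closed_disk.
by move=> H; apply: cvg_comp H (cf _ (retract_closed_disk w)).
Qed.

Lemma closed_disk_bounded (f : C -> C) : {within cD, continuous f} ->
  exists M : R, forall w, cD w -> rnorm (f w) <= M.
Proof.
move=> /retract_comp_continuous cf.
have /compact_bounded[M [_ /(_ (M + 1))]] :
    compact ((fun z => rnorm (f (retract z))) @` cD).
  apply: continuous_compact; last exact: closed_disk_compact.
  by apply: continuous_subspaceT => z; apply: (rnorm_cvg (nbhs_filter z)); exact: cf.
rewrite ltrDl ltr01 => /(_ isT) H; exists (M + 1) => z Dz.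
apply: le_trans (ler_norm _) _; apply: H; exists z => //=.
by rewrite retract_id.
Qed.

Section CircleMean.
Variable f : C -> C.
Hypothesis cf : continuous f.

Definition circle_mean (r : R) : C :=
  cint mu `[0, pi *+ 2]%classic (fun t => f (r%:C * expi t)).

Lemma polar_continuous2 x : continuous (@polar R x).
Proof. by move=> y; apply: (cvgCM (nbhs_filter y)); [exact: cvg_cst|exact: expi_continuous]. Qed.

Lemma polar_continuous1 y : continuous (@polar R ^~ y).
Proof.
move=> x; apply: (cvgCM (nbhs_filter x)); last exact: cvg_cst.
by apply: (cvgC_real (nbhs_filter x)); exact: continuous_expR.
Qed.

(** In logarithmic coordinates the two horizontal sides cancel by [2 pi]-periodicity, and the
    vertical sides are the two circular means. *)
Lemma circle_mean_annulus r1 r2 : 0 < r1 -> r1 <= r2 ->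
  (forall w, r1 <= rnorm w <= r2 -> derivable f w 1) ->
  circle_mean r1 = circle_mean r2.
Proof.
move=> r10 r12 df; have r20 := lt_le_trans r10 r12.
pose F x y := f (polar x y).
have cF1 y : continuous (F ^~ y).
  by move=> x; apply: (cvgC_comp (nbhs_filter x)); [exact: cf|exact: polar_continuous1].
have cF2 x : continuous (F x).
  by move=> y; apply: (cvgC_comp (nbhs_filter y)); [exact: cf|exact: polar_continuous2].
have FE r : 0 < r -> circle_mean r = cint mu `[0, pi *+ 2]%classic (F (ln r)).
  by move=> r0; apply: eq_cint => t _; rewrite /F /polar lnK.
have s0 : 0 <= ln r2 - ln r1 by rewrite subr_ge0 ler_ln.
have t0 : 0 <= pi *+ 2 :> R by rewrite mulrn_wge0 ?pi_ge0.
have := goursat cF1 cF2 s0 t0 (X := ln r1) (Y := 0).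
rewrite rect_intE // !add0r [ln r1 + _]addrC subrK -!FE //.
have -> : F ^~ (pi *+ 2) = F ^~ 0.
  by apply/funext => x; rewrite /F /polar -[pi *+ 2]add0r expiD2pi.
rewrite subrr add0r => H; apply/esym/eqP; rewrite -subr_eq0.
have /eqP : 'i * (circle_mean r2 - circle_mean r1) = 0.
  apply: H => x y /andP[x1 x2] _.
  have [|l] := @derivable_cderiv R f (polar x y); last exact: polar_plane_derivable.
  apply: df; rewrite rnorm_polar; apply/andP; split.
    by rewrite -[r1]lnK ?posrE // ler_expR.
  by rewrite -[r2]lnK ?posrE // ler_expR.
by rewrite mulf_eq0 -rnorm_eq0 rnorm_i oner_eq0.
Qed.

Lemma circle_mean_cvg (M : R) (r : nat -> R) (r0 : R) :
  (forall n t, rnorm (f ((r n)%:C * expi t)) <= M) -> r @ \oo --> r0 ->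
  circle_mean (r n) @[n --> \oo] --> circle_mean r0.
Proof.
move=> fM rr0.
apply: (@cint_dominated _ _ R mu _ _ _ (fun=> M)) => //.
- move=> k; apply: continuous_cmeas => // t; apply: (cvgC_comp (nbhs_filter t)); first exact: cf.
  by apply: (cvgCM (nbhs_filter t)); [exact: cvg_cst|exact: expi_continuous].
- move=> t _; apply: cvgC_comp; first exact: cf.
  by apply: cvgCM; [exact: cvgC_real | exact: cvg_cst].
apply: continuous_compact_integrable; first exact: segment_compact.
by apply: continuous_subspaceT; exact: cst_continuous.
Qed.

(** Analyticity is available only strictly between the two radii; continuity of the means reaches
    the end radii, including [u = 0], where the logarithm would break down. *)
Lemma circle_mean_open (M u v : R) :
  (forall w, cD w -> rnorm (f w) <= M) -> 0 <= u -> u <= v -> v <= 1 ->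
  (forall w, u < rnorm w < v -> derivable f w 1) ->
  circle_mean u = circle_mean v.
Proof.
move=> fM u0 uv v1 df; have [->//|uNv] := eqVneq u v.
have {uNv} uv' : u < v by rewrite lt_neqAle uNv.
(* With [n.+3] in the denominator, [2 * e n < v - u], so both shifted radii are strictly inside and
   in the right order from [n = 0] on. *)
pose e n : R := (v - u) / n.+3%:R.
have e0 n : 0 < e n by rewrite divr_gt0 ?subr_gt0.
have e2 n : e n + e n < v - u.
  rewrite -mulr2n -mulr_natr mulrAC ltr_pdivrMr // ltr_pM2l ?subr_gt0 //.
  by rewrite ltr_nat.
have ecv : e @ \oo --> (0 : R).
  rewrite -[0](mulr0 (v - u)); apply: cvgM; first exact: cvg_cst.
  have := @cvg_harmonic R; rewrite -(cvg_shiftn 2).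
  by apply: cvg_trans; apply: near_eq_cvg; apply: nearW => n; rewrite /= addn2.
have c1 : circle_mean (u + e n) @[n --> \oo] --> circle_mean u.
  apply: (@circle_mean_cvg M).
    move=> n t; apply: fM; apply/closed_diskP; rewrite rnormM rnorm_expi mulr1 rnorm_real.
    by have := e0 n; have := e2 n => ? ?; rewrite ger0_norm; lra.
  by rewrite -[X in _ --> X]addr0; apply: cvgD; [exact: cvg_cst|].
have c2 : circle_mean (v - e n) @[n --> \oo] --> circle_mean v.
  apply: (@circle_mean_cvg M).
    move=> n t; apply: fM; apply/closed_diskP; rewrite rnormM rnorm_expi mulr1 rnorm_real.
    by have := e0 n; have := e2 n => ? ?; rewrite ger0_norm; lra.
  by rewrite -[X in _ --> X]subr0; apply: cvgB; [exact: cvg_cst|].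
apply: cvgC_unique c1 _; apply: cvg_trans c2; apply: near_eq_cvg; apply: nearW => n.
have := e0 n; have := e2 n => h1 h2.
apply/esym/circle_mean_annulus; [lra|lra|move=> w h; apply: df].
by apply/andP; case/andP: h => *; split; lra.
Qed.

End CircleMean.

Lemma circle_integralE (f : C -> C) : circle_integral f =
  ((pi *+ 2)^-1)%:C * cint mu `[0, pi *+ 2]%classic (f \o @expi R).
Proof.
by apply: complexP; rewrite ?RecM ?ImcM /= mul0r ?subr0 ?addr0 mulrC.
Qed.

(* The circular means of [f] are constant on each side of the circle through
   [p] and depend continuously on the radius, so that the possible singularity
   at [p] is harmless. *)
Lemma mean_value (f : C -> C) (p : C) : {within cD, continuous f} ->
  (forall w, D w -> w <> p -> derivable f w 1) ->
  circle_integral f = f 0.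
Proof.
move=> cf df; pose g := f \o retract.
have cg : continuous g by exact: retract_comp_continuous.
have gE w : cD w -> g w = f w by move=> h; rewrite /g /= retract_id.
have dg w : rnorm w < 1 -> w <> p -> derivable g w 1.
  move=> /open_diskP w1 wp; have := df w w1 wp; apply: near_eq_derivable.
  by have := open_disk_near w1; apply: filterS => x Dx; rewrite gE //; exact: ltW.
have [M gM] := closed_disk_bounded (continuous_subspaceT cg).
have m01 : circle_mean g 0 = circle_mean g 1.
  have [p1|p1] := ltP (rnorm p) 1; last first.
    apply: (circle_mean_open cg gM) => // w /andP[_ w1].
    by apply: dg => // wp; move: w1; rewrite wp ltNge p1.
  apply: (@etrans _ _ (circle_mean g (rnorm p))).
    apply: (circle_mean_open cg gM) => //; [exact: rnorm_ge0|exact: ltW|].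
    move=> w /andP[_ w1]; apply: dg; first exact: lt_trans p1.
    by move=> wp; move: w1; rewrite wp ltxx.
  apply: (circle_mean_open cg gM) => //; [exact: rnorm_ge0|exact: ltW|].
  move=> w /andP[w1 w2]; apply: dg => // wp.
  by move: w1; rewrite wp ltxx.
rewrite circle_integralE.
have -> : cint mu `[0, pi *+ 2]%classic (f \o @expi R) = circle_mean g 1.
  apply: eq_cint => t _ /=; rewrite mul1r gE //.
  by apply/closed_diskP; rewrite rnorm_expi.
rewrite -m01.
have pp : 0 < pi *+ 2 :> R by rewrite mulrn_wgt0 ?pi_gt0.
have -> : circle_mean g 0 = f 0 * (pi *+ 2)%:C.
  rewrite -[X in _ * X%:C]subr0 -cint_itv_cst ?ltW //.
  apply: eq_cint => t _; rewrite mul0r gE //.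
  by apply/closed_diskP; rewrite rnorm0.
by rewrite mulrCA -rmorphM /= mulVf ?gt_eqF // mulr1.
Qed.

End MeanValue.

(** * Means over the unit circle *)

Section CircleIntegral.
Variable R : realType.
Local Notation C := R[i].
Local Notation mu := (@lebesgue_measure R).
Local Notation I2pi := (`[0, pi *+ 2]%classic : set R).
Implicit Types (f g : C -> C).

Definition circle_meas f := cmeas I2pi (f \o @expi R).

Lemma pi2_gt0 : 0 < pi *+ 2 :> R.
Proof. by rewrite mulrn_wgt0 ?pi_gt0. Qed.

Lemma rnorm_unit_circle (w : C) : unit_circle w -> rnorm w = 1.
Proof. by rewrite /unit_circle /= rnormE => /complexI. Qed.

Lemma continuous_circle_meas f : {within @closed_disk R, continuous f} ->
  circle_meas f.
Proof.
move=> /retract_comp_continuous cf.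
apply: (@eq_cmeas _ _ _ _ ((f \o @retract R) \o @expi R)).
  by move=> t _ /=; rewrite retract_id //; apply/closed_diskP; rewrite rnorm_expi.
apply: continuous_cmeas => // t.
by apply: (cvgC_comp (nbhs_filter t)); [exact: cf|exact: expi_continuous].
Qed.

Lemma circle_integrable_bounded f (M : R) : circle_meas f ->
  (forall w, unit_circle w -> rnorm (f w) <= M) -> circle_integrable f.
Proof.
move=> mf fM; apply: (@cintegrable_dom _ _ _ mu I2pi _ (fun=> M)) => //.
  apply: continuous_compact_integrable; first exact: segment_compact.
  by apply: continuous_subspaceT; exact: cst_continuous.
by move=> t _; apply: fM; exact: expi_unit.
Qed.

Lemma closed_disk_circle (w : C) : unit_circle w -> closed_disk w.
Proof. by move=> /rnorm_unit_circle w1; apply/closed_diskP; rewrite w1. Qed.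

Lemma continuous_circle_integrable f : {within @closed_disk R, continuous f} ->
  circle_integrable f.
Proof.
move=> cf; have [M fM] := closed_disk_bounded cf.
apply: circle_integrable_bounded (continuous_circle_meas cf) _ => w /closed_disk_circle.
exact: fM.
Qed.

Lemma eq_circle_integral f g : (forall w, unit_circle w -> f w = g w) ->
  circle_integral f = circle_integral g.
Proof.
move=> fg; rewrite !circle_integralE; congr (_ * _); apply: eq_cint => t _ /=.
by rewrite fg //; exact: expi_unit.
Qed.

Lemma circle_integrableZ c f : circle_integrable f ->
  circle_integrable (fun w => c * f w).
Proof. by move=> fi; exact: (@cintegrableZ _ _ _ mu I2pi c (f \o @expi R)). Qed.

Lemma circle_integrableB f g : circle_integrable f -> circle_integrable g ->
  circle_integrable (fun w => f w - g w).
Proof.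
by move=> fi gi; exact: (@cintegrableB _ _ _ mu I2pi (f \o @expi R) (g \o @expi R)).
Qed.

Lemma circle_integralZ c f : circle_integrable f ->
  circle_integral (fun w => c * f w) = c * circle_integral f.
Proof.
move=> fi; rewrite !circle_integralE mulrCA; congr (_ * _).
exact: (@cintZ _ _ _ mu _ c (f \o @expi R)).
Qed.

Lemma circle_integralD f g : circle_integrable f -> circle_integrable g ->
  circle_integral (fun w => f w + g w) = circle_integral f + circle_integral g.
Proof.
move=> fi gi; rewrite !circle_integralE -mulrDr; congr (_ * _).
exact: (@cintD _ _ _ mu _ (f \o @expi R) (g \o @expi R)).
Qed.

Lemma circle_integralB f g : circle_integrable f -> circle_integrable g ->
  circle_integral (fun w => f w - g w) = circle_integral f - circle_integral g.
Proof.
move=> fi gi; rewrite !circle_integralE -mulrBr; congr (_ * _).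
exact: (@cintB _ _ _ mu _ (f \o @expi R) (g \o @expi R)).
Qed.

Lemma circle_integral_sum (h : nat -> C -> C) n :
  (forall k, circle_integrable (h k)) ->
  circle_integral (fun w => \sum_(0 <= k < n) h k w) =
  \sum_(0 <= k < n) circle_integral (h k).
Proof.
move=> hi; rewrite circle_integralE.
under [RHS]eq_bigr do rewrite circle_integralE.
rewrite -mulr_sumr; congr (_ * _).
exact: (@cint_sum _ _ _ mu _ (fun k => h k \o @expi R)).
Qed.

Lemma circle_integral_cvg (h : nat -> C -> C) f (g : C -> R) :
  (forall k, circle_meas (h k)) ->
  (forall w, unit_circle w -> h ^~ w @ \oo --> f w) ->
  mu.-integrable I2pi (fun t => (g (expi t))%:E) ->
  (forall k w, unit_circle w -> rnorm (h k w) <= g w) ->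
  circle_integral (h k) @[k --> \oo] --> circle_integral f.
Proof.
move=> mh hf gi hg; rewrite circle_integralE.
under [X in X @ _]funext do rewrite circle_integralE.
apply: cvgCM; first exact: cvg_cst.
apply: (@cint_dominated _ _ R mu _ (fun k => h k \o @expi R) _ (g \o @expi R)) => //.
  by move=> t _; apply: hf; exact: expi_unit.
by move=> k t _; apply: hg; exact: expi_unit.
Qed.

Lemma circle_integral_cst c : circle_integral (fun=> c : C) = c.
Proof.
rewrite circle_integralE (@cint_itv_cst R c) ?ltW ?pi2_gt0 // subr0 mulrCA -rmorphM /=.
by rewrite mulVf ?gt_eqF ?pi2_gt0 // mulr1.
Qed.

Lemma circle_integral_real (g : C -> R) : circle_integral (fun w => (g w)%:C) =
  ((pi *+ 2)^-1 * \int[mu]_(t in I2pi) g (expi t))%:C.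
Proof. by rewrite circle_integralE /cint /= Rintegral_cst // mul0r -rmorphM. Qed.

Lemma le_rnorm_circle_integral f (g : C -> R) : circle_integrable f ->
  mu.-integrable I2pi (fun t => (g (expi t))%:E) ->
  (forall w, unit_circle w -> rnorm (f w) <= g w) ->
  rnorm (circle_integral f) <= (pi *+ 2)^-1 * \int[mu]_(t in I2pi) g (expi t).
Proof.
move=> fi gi fg; rewrite circle_integralE rnormM rnorm_real.
have p0 : 0 < ((pi : R) *+ 2)^-1 by rewrite invr_gt0 pi2_gt0.
rewrite gtr0_norm // ler_pM2l //.
apply: le_trans (le_rnorm_cint _ fi) _ => //.
apply: le_Rintegral => //; first exact: (integrable_rnorm _ fi).
by move=> t _; apply: fg; exact: expi_unit.
Qed.

Lemma rnorm_circle_integral_le f (M : R) : circle_meas f ->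
  (forall w, unit_circle w -> rnorm (f w) <= M) -> rnorm (circle_integral f) <= M.
Proof.
move=> mf fM; have := @le_rnorm_circle_integral f (fun=> M).
rewrite -lecR -circle_integral_real circle_integral_cst lecR; apply => //.
  exact: circle_integrable_bounded fM.
apply: continuous_compact_integrable; first exact: segment_compact.
by apply: continuous_subspaceT; exact: cst_continuous.
Qed.

Lemma circle_integral_conj f : circle_integrable f ->
  circle_integral (fun w => conjc (f w)) = conjc (circle_integral f).
Proof.
move=> [f1 f2]; apply: complexP => /=.
  by congr (_ / _); apply: eq_Rintegral => t _; case: (f _).
rewrite -mulNr -mulN1r -RintegralZl //; congr (_ / _).
by apply: eq_Rintegral => t _; rewrite mulN1r; case: (f _).
Qed.

Lemma circle_integrable_conj f : circle_integrable f ->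
  circle_integrable (fun w => conjc (f w)).
Proof.
move=> [i1 i2]; split.
  by move: i1; apply: eq_integrable => // t _; case: (f _).
have : mu.-integrable I2pi
    (fun t => (-1)%:E * (complex.Im (f (expi t)))%:E)%E by exact: integrableZl.
apply: eq_integrable => // t _ /=.
by case: (f _) => a b /=; rewrite -EFinM mulN1r.
Qed.

Lemma eq_circle_integrable f g : (forall w, unit_circle w -> f w = g w) ->
  circle_integrable f -> circle_integrable g.
Proof.
move=> fg; apply: (@eq_cintegrable _ _ _ mu I2pi (f \o @expi R) (g \o @expi R)) => //.
by move=> t _ /=; apply: fg; exact: expi_unit.
Qed.

End CircleIntegral.

(** * The Cauchy kernel and Cauchy's formula *)

Section Kernels.
Variable R : realType.
Local Notation C := R[i].
Local Notation D := (@open_disk R).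
Local Notation cD := (@closed_disk R).

(** On the circle [dw = i w dt], and the numerator [w] absorbs this factor: the Cauchy integral
    becomes a mean for normalized Lebesgue measure. *)
Definition cauchy_kernel (z w : C) : C := w / (w - z).

Definition poisson_kernel (z w : C) : R := (1 - rnorm z ^+ 2) / rnorm (w - z) ^+ 2.

(** On the circle this is the conjugate of [cauchy_kernel z w]; unlike the latter it has no pole in
    the disk as a function of [w]. *)
Definition conj_kernel (z w : C) : C := (1 - conjc z * w)^-1.

Lemma within_continuousM (f g : C -> C) : {within cD, continuous f} ->
  {within cD, continuous g} -> {within cD, continuous (fun w => f w * g w)}.
Proof.
move=> /within_closed_diskP cf /within_closed_diskP cg.
apply/within_closed_diskP => z Dz.
by apply: (cvgCM (within_filter _ (nbhs_filter z))); [exact: cf|exact: cg].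
Qed.

Lemma conj_kernel_neq0 z w : D z -> cD w -> 1 - conjc z * w != 0.
Proof.
move=> /open_diskP z1 /closed_diskP w1; apply/negP; rewrite subr_eq0 => /eqP E.
have := congr1 (@rnorm R C) E; rewrite rnorm1 rnormM rnorm_conj.
have := rnorm_ge0 z; have := ler_wpM2l (rnorm_ge0 z) w1; lra.
Qed.

Lemma conj_kernel_continuous z : D z -> {within cD, continuous (conj_kernel z)}.
Proof.
move=> Dz; apply/within_closed_diskP => w Dw.
have FF := within_filter cD (nbhs_filter w).
apply: cvgCV; first exact: conj_kernel_neq0.
apply: cvgCB; first exact: cvg_cst.
apply: cvgCM; first exact: cvg_cst.
by move=> P nP; rewrite /nbhs /= /within /=; apply: filterS nP => x + _.
Qed.

Lemma conj_kernel_derivable z w : D z -> D w -> derivable (conj_kernel z) w 1.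
Proof.
move=> Dz Dw; have n0 : 1 - conjc z * w != 0.
  by apply: conj_kernel_neq0 => //; exact: ltW.
apply: (@derivableV C C); first exact: n0.
apply: derivableB; first exact: derivable_cst.
by apply: derivableM; [exact: derivable_cst|exact: derivable_id].
Qed.

Lemma circle_integral_conj_kernel z : D z -> circle_integral (conj_kernel z) = 1.
Proof.
(* The exceptional point 2 is outside the disk, that is, there is none. *)
move=> Dz; rewrite (@mean_value _ _ 2); first by rewrite /conj_kernel mulr0 subr0 invr1.
  exact: conj_kernel_continuous.
by move=> w Dw _; exact: conj_kernel_derivable.
Qed.

Lemma conjCV (z : C) : conjc z^-1 = (conjc z)^-1.
Proof. exact: (fmorphV (conjc : {rmorphism C -> C})). Qed.

Lemma unit_circle_conj (w : C) : unit_circle w -> conjc w = w^-1.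
Proof.
move=> /rnorm_unit_circle w1; have := mulc_conj w; rewrite w1 expr1n => E.
have w0 : w != 0 by rewrite -rnorm_eq0 w1 oner_eq0.
by rewrite -[conjc w](mulKf w0) E mulr1.
Qed.

Lemma unit_circle_neq0 (w : C) : unit_circle w -> w != 0.
Proof. by move=> /rnorm_unit_circle w1; rewrite -rnorm_eq0 w1 oner_eq0. Qed.

Lemma unit_disk_neq (z w : C) : D z -> unit_circle w -> w - z != 0.
Proof.
move=> /open_diskP z1 /rnorm_unit_circle w1; rewrite subr_eq0.
by apply: contraTneq z1 => <-; rewrite w1 ltxx.
Qed.

Lemma cauchy_kernelE z w : D z -> unit_circle w ->
  cauchy_kernel z w = (conjc (conj_kernel z w)).
Proof.
move=> Dz w1; have w0 := unit_circle_neq0 w1; have wz := unit_disk_neq Dz w1.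
have E : (conjc (1 - conjc z * w)) = 1 - z * conjc w.
  by case: (z) (w) => a b [c d]; apply: complexP => /=; ring.
have -> : (conjc (conj_kernel z w)) = (1 - z * conjc w)^-1.
  by rewrite conjCV; congr (_^-1); exact: E.
rewrite unit_circle_conj //; by rewrite /cauchy_kernel; field; rewrite w0 wz.
Qed.

Lemma circle_integrable_cauchy_kernel z : D z -> circle_integrable (cauchy_kernel z).
Proof.
move=> Dz; apply: (@eq_circle_integrable _ (fun w => conjc (conj_kernel z w))).
  by move=> w w1; rewrite cauchy_kernelE.
exact/circle_integrable_conj/continuous_circle_integrable/conj_kernel_continuous.
Qed.

(** The pole at [z] excludes the mean value property, which is applied to the conjugate kernel
    instead. *)
Lemma circle_integral_cauchy_kernel z : D z ->
  circle_integral (cauchy_kernel z) = 1.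
Proof.
move=> Dz.
rewrite (@eq_circle_integral _ _ (fun w => (conjc (conj_kernel z w)))).
  rewrite circle_integral_conj; first by rewrite circle_integral_conj_kernel // conjc1.
  exact/continuous_circle_integrable/conj_kernel_continuous.
by move=> w w1; exact: cauchy_kernelE.
Qed.

(* Division by [w - z] of a function vanishing at [z] leaves a removable
   singularity, to which the mean value property applies. *)
Lemma cauchy_formula (g : C -> C) z : disk_algebra g -> D z ->
  circle_integral (fun w => g w * cauchy_kernel z w) = g z.
Proof.
move=> [cg dg] Dz; have [l gl] := derivable_cderiv (dg z Dz).
pose q w := if w == z then l else (g w - g z) / (w - z).
have qE w : w != z -> q w = (g w - g z) / (w - z).
  by rewrite /q => /negbTE ->.
have near_neq w : w != z -> \forall x \near w, q x = (g x - g z) / (x - z).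
  move=> wz; apply/nbhsC_rnormP; exists (rnorm (w - z)).
    by rewrite rnorm_gt0 subr_eq0.
  move=> x xw; apply: qE; apply: contraTneq xw => ->.
  by rewrite rnorm_distC ltxx.
have cq : {within cD, continuous q}.
  apply/within_closed_diskP => w Dw.
  have FF := within_filter cD (nbhs_filter w).
  have [->|wz] := eqVneq w z.
    apply/(cvgC_distP (within_filter cD (nbhs_filter z))) => e e0.
    have e20 : 0 < e / 2 by rewrite divr_gt0.
    have [r r0 Hr] := gl _ e20.
    apply/(nbhsC_rnormP z); exists r => // x xr _.
    rewrite {1}/q eqxx; have [->|xz] := eqVneq x z; first by rewrite /q eqxx subrr rnorm0.
    have xz0 : x - z != 0 by rewrite subr_eq0.
    have := Hr x xr; rewrite -ler_pdivrMr ?rnorm_gt0 // -rnormV -rnormM => K.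
    rewrite qE //.
    have -> : l - (g x - g z) / (x - z) = - ((g x - g z - l * (x - z)) / (x - z)).
      by field.
    by rewrite rnormN; lra.
  rewrite qE //; apply: cvg_trans.
    apply: (@near_eq_cvg _ _ _ _ (fun x => (g x - g z) / (x - z))).
    apply: (cvg_within (F := nbhs w)); apply: filterS (near_neq w wz) => x /esym.
    exact.
  apply: cvgCM.
    apply: cvgCB; last exact: cvg_cst.
    by move/within_closed_diskP : cg; apply.
  apply: cvgCV; first by rewrite subr_eq0.
  apply: cvgCB; last exact: cvg_cst.
  by move=> P nP; rewrite /nbhs /= /within /=; apply: filterS nP => x + _.
have id_cts : {within cD, continuous (fun w : C => w)}.
  apply/within_closed_diskP => w _ P nP.
  by rewrite /nbhs /= /within /=; apply: filterS nP => x + _.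
(* The mean of [w * q w] is its value at the centre, which the factor [w] makes 0. What remains of
   [g w * cauchy_kernel z w] is [g z] times a kernel of mean 1. *)
have m0 := mean_value (p := z) (within_continuousM id_cts cq).
rewrite mul0r in m0.
have {}m0 : circle_integral (fun w => w * q w) = 0.
  apply: m0 => w Dw /eqP wz; apply: derivableM; first exact: derivable_id.
  have H : derivable (fun x => (g x - g z) / (x - z)) w 1.
    apply: derivableM; first by apply: derivableB; [exact: dg|exact: derivable_cst].
    apply: (@derivableV C C); first by rewrite subr_eq0.
    by apply: derivableB; [exact: derivable_id|exact: derivable_cst].
  apply: near_eq_derivable H; apply: filterS (near_neq w wz) => x /esym.
  exact.
have iq := continuous_circle_integrable (within_continuousM id_cts cq).
have ik := circle_integrable_cauchy_kernel Dz.
rewrite (@eq_circle_integral _ _ (fun w => w * q w + g z * cauchy_kernel z w)).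
  rewrite circle_integralD //; first by rewrite m0 add0r circle_integralZ //
    circle_integral_cauchy_kernel // mulr1.
  exact: circle_integrableZ.
move=> w w1; have wz := unit_disk_neq Dz w1.
have wz' : w != z by rewrite -subr_eq0.
rewrite qE // /cauchy_kernel; move: (g w) (g z) => x y.
by field.
Qed.

End Kernels.

(** * The Poisson formula and the analyticity of Cauchy integrals *)

Section Poisson.
Variable R : realType.
Local Notation C := R[i].
Local Notation mu := (@lebesgue_measure R).
Local Notation D := (@open_disk R).
Local Notation cD := (@closed_disk R).
Local Notation I2pi := (`[0, pi *+ 2]%classic : set R).

(** The second summand is analytic in [w] and vanishes at 0, so its product with a disk algebra
    function has mean 0; Cauchy's formula thereby implies Poisson's. *)
Lemma poisson_kernelE (z w : C) : D z -> unit_circle w ->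
  (poisson_kernel z w)%:C = cauchy_kernel z w + conjc z * w * conj_kernel z w.
Proof.
move=> Dz w1; have w0 := unit_circle_neq0 w1; have wz := unit_disk_neq Dz w1.
have k0 := conj_kernel_neq0 Dz (closed_disk_circle w1).
have E : conjc (w - z) = w^-1 - conjc z.
  rewrite -unit_circle_conj //; case: (z) (w) => a b [c d].
  by apply: complexP => /=; ring.
have -> : (poisson_kernel z w)%:C =
    (1 - z * conjc z) / ((w - z) * (w^-1 - conjc z)).
  by rewrite -E !mulc_conj /poisson_kernel rmorphM fmorphV rmorphB rmorph1.
rewrite /cauchy_kernel /conj_kernel; move: (conjc z) k0 => zb k0.
by field; rewrite w0 wz k0.
Qed.

Lemma poisson_formula (g : C -> C) z : disk_algebra g -> D z ->
  circle_integral (fun w => g w * (poisson_kernel z w)%:C) = g z.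
Proof.
move=> gA Dz; have [cg dg] := gA.
pose f w := g w * (conjc z * w * conj_kernel z w).
have cf : {within cD, continuous f}.
  have c0 : {within cD, continuous (fun=> conjc z)}.
    by apply: continuous_subspaceT => x; exact: cst_continuous.
  have c1 : {within cD, continuous (fun w : C => w)}.
    by apply: continuous_subspaceT => x; exact: ctsC_id.
  have c2 := within_continuousM (within_continuousM c0 c1) (conj_kernel_continuous Dz).
  exact: (within_continuousM cg c2).
have f0 : circle_integral f = 0.
  rewrite (@mean_value _ _ 2) //; first by rewrite /f mulr0 mul0r mulr0.
  move=> w Dw _; apply: derivableM; first exact: dg.
  apply: derivableM; last exact: conj_kernel_derivable.
  by apply: derivableM; [exact: derivable_cst|exact: derivable_id].
have ig : circle_integrable (fun w => g w * cauchy_kernel z w).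
  have [M gM] := closed_disk_bounded cg.
  have ik := circle_integrable_cauchy_kernel Dz.
  have := @cintegrableM _ _ _ mu I2pi (cauchy_kernel z \o @expi R) (g \o @expi R) M.
  move=> /(_ _ ik (continuous_circle_meas cg)) H.
  apply: (@eq_circle_integrable _ (fun w => cauchy_kernel z w * g w)).
    by move=> w _; rewrite mulrC.
  by apply: H => // t _; apply: gM; apply/closed_disk_circle/expi_unit.
rewrite -(cauchy_formula gA Dz) -[RHS]addr0 -f0 -circle_integralD //; last first.
  exact: continuous_circle_integrable.
by apply: eq_circle_integral => w w1; rewrite poisson_kernelE // mulrDr.
Qed.

Lemma poisson_kernel_ge0 (z w : C) : D z -> 0 <= poisson_kernel z w.
Proof.
move=> /open_diskP z1; rewrite divr_ge0 ?sqr_ge0 // subr_ge0.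
by rewrite expr_le1 ?rnorm_ge0 // ltW.
Qed.

Lemma poisson_kernel_continuous z : D z ->
  continuous (fun t => poisson_kernel z (expi t)).
Proof.
move=> Dz t; have wz := unit_disk_neq Dz (expi_unit t).
apply: cvgM; first exact: cvg_cst.
apply: cvgV; first by rewrite expf_neq0 // rnorm_eq0.
apply: (@continuous_cvg _ _ _ _ _ (fun t => rnorm (expi t - z)) (fun x => x ^+ 2)).
  exact: exprn_continuous.
apply: (rnorm_cvg (nbhs_filter t)); apply: (cvgCB (nbhs_filter t)).
  exact: expi_continuous.
exact: cvg_cst.
Qed.

Lemma poisson_kernel_integrable z : D z ->
  mu.-integrable I2pi (fun t => (poisson_kernel z (expi t))%:E).
Proof.
move=> Dz; apply: continuous_compact_integrable; first exact: segment_compact.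
by apply: continuous_subspaceT; exact: poisson_kernel_continuous.
Qed.

Lemma poisson_kernel_integrableZ (M : R) z : D z ->
  mu.-integrable I2pi (fun t => (M * poisson_kernel z (expi t))%:E).
Proof.
move=> Dz; have ik := poisson_kernel_integrable Dz.
have : mu.-integrable I2pi (fun t => M%:E * (poisson_kernel z (expi t))%:E)%E.
  exact: integrableZl.
by [].
Qed.

Lemma disk_algebra_cst (c : C) : disk_algebra (fun=> c).
Proof.
split=> [|z _]; last exact: derivable_cst.
by apply: continuous_subspaceT => x; exact: cst_continuous.
Qed.

Lemma circle_integral_poisson_kernel z : D z ->
  circle_integral (fun w => (poisson_kernel z w)%:C) = 1.
Proof.
move=> Dz; rewrite -[RHS](poisson_formula (disk_algebra_cst 1) Dz).
by apply: eq_circle_integral => w _; rewrite mul1r.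
Qed.

Lemma poisson_kernel_meas z : D z ->
  circle_meas (fun w => (poisson_kernel z w)%:C).
Proof.
move=> Dz; apply: continuous_cmeas => // t.
by apply: (cvgC_real (nbhs_filter t)); exact: poisson_kernel_continuous.
Qed.

Lemma poisson_integrable (u : C -> C) (M : R) z : circle_meas u ->
  (forall w, unit_circle w -> rnorm (u w) <= M) -> D z ->
  circle_integrable (fun w => u w * (poisson_kernel z w)%:C).
Proof.
move=> mu_ uM Dz.
have iM := poisson_kernel_integrableZ M Dz.
apply: (@cintegrable_dom _ _ _ mu I2pi _ (fun t => M * poisson_kernel z (expi t))) => //.
  exact: cmeasM mu_ (poisson_kernel_meas Dz).
move=> t _ /=; rewrite rnormM rnorm_real ger0_norm ?poisson_kernel_ge0 //.
by rewrite ler_wpM2r ?poisson_kernel_ge0 // uM //; exact: expi_unit.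
Qed.

(** A nonnegative kernel of mean 1 keeps the constant [M]; the Cauchy kernel would lose a factor
    that grows as [z] approaches the circle. *)
Lemma poisson_bound (u : C -> C) (M : R) z : circle_meas u ->
  (forall w, unit_circle w -> rnorm (u w) <= M) -> D z ->
  rnorm (circle_integral (fun w => u w * (poisson_kernel z w)%:C)) <= M.
Proof.
move=> mu_ uM Dz.
rewrite -lecR -[M%:C]mulr1 -(circle_integral_poisson_kernel Dz).
rewrite -circle_integralZ; last first.
  apply: (@cintegrable_dom _ _ _ mu I2pi _ (fun t => poisson_kernel z (expi t))) => //.
    exact: poisson_kernel_meas.
  exact: poisson_kernel_integrable.
  by move=> t _; rewrite rnorm_real ger0_norm ?poisson_kernel_ge0.
rewrite [X in _ <= X](@eq_circle_integral _ _ (fun w => (M * poisson_kernel z w)%:C)); last first.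
  by move=> w _; rewrite realcM.
rewrite [X in _ <= X](circle_integral_real (fun w => M * poisson_kernel z w)) lecR.
apply: (@le_rnorm_circle_integral _ _ (fun w => M * poisson_kernel z w)).
  exact: poisson_integrable uM Dz.
  exact: poisson_kernel_integrableZ.
move=> w w1; rewrite rnormM rnorm_real ger0_norm ?poisson_kernel_ge0 //.
by rewrite ler_wpM2r ?poisson_kernel_ge0 // uM.
Qed.

(* Differentiation under the integral sign by the exact second-order remainder
   [h^2 w / ((w - z - h) (w - z)^2)] of the Cauchy kernel. *)
Lemma cauchy_integral_derivable (u : C -> C) (M : R) z : circle_meas u ->
  (forall w, unit_circle w -> rnorm (u w) <= M) -> D z ->
  derivable (fun z => circle_integral (fun w => u w * cauchy_kernel z w)) z 1.
Proof.
move=> mu_ uM Dz; have z1 := (open_diskP z).1 Dz.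
have M0 : 0 <= M by apply: le_trans (rnorm_ge0 _) (uM _ (expi_unit 0)).
pose k2 (w : C) : C := w / (w - z) ^+ 2.
have far (x w : C) : unit_circle w -> 1 - rnorm x <= rnorm (w - x).
  by move=> /rnorm_unit_circle <-; exact: rnorm_lerB.
pose d := 1 - rnorm z; have d0 : 0 < d by rewrite subr_gt0.
have idc : {within cD, continuous (fun w : C => w)}.
  by apply: continuous_subspaceT => x; exact: ctsC_id.
have mid : circle_meas (fun w : C => w) by exact: continuous_circle_meas.
have minv x : D x -> circle_meas (fun w => (w - x)^-1).
  move=> Dx; apply: continuous_cmeas => // t.
  apply: (cvgCV (nbhs_filter t)); first exact: (unit_disk_neq Dx (expi_unit t)).
  by apply: (cvgCB (nbhs_filter t)); [exact: expi_continuous|exact: cvg_cst].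
have mk x : D x -> circle_meas (fun w => u w * cauchy_kernel x w).
  by move=> Dx; apply: cmeasM => //; exact: cmeasM mid (minv x Dx).
have mk2 : circle_meas (fun w => u w * k2 w).
  apply: cmeasM => //; apply: (@eq_cmeas _ _ _ _
    (fun t => expi t * ((expi t - z)^-1 * (expi t - z)^-1))).
    by move=> t _; rewrite /k2 /= expr2 invfM.
  exact: cmeasM mid (cmeasM (minv z Dz) (minv z Dz)).
have inv_le x w (c : R) : 0 < c -> unit_circle w -> c <= rnorm (w - x) ->
    rnorm (w - x)^-1 <= c^-1.
  by move=> c0 w1 h; rewrite rnormV lef_pV2 ?posrE //; exact: lt_le_trans h.
have ik x : D x -> circle_integrable (fun w => u w * cauchy_kernel x w).
  move=> Dx; have x1 := (open_diskP x).1 Dx.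
  apply: (@circle_integrable_bounded _ _ (M * (1 - rnorm x)^-1)); first exact: mk.
  move=> w w1; rewrite !rnormM ler_pM ?mulr_ge0 ?rnorm_ge0 ?uM //.
  rewrite (rnorm_unit_circle w1) mul1r; apply: inv_le => //; last exact: far.
  by rewrite subr_gt0.
have ik2 : circle_integrable (fun w => u w * k2 w).
  apply: (@circle_integrable_bounded _ _ (M * (d^-1 * d^-1))); first exact: mk2.
  move=> w w1; rewrite !rnormM ler_pM ?mulr_ge0 ?rnorm_ge0 ?uM //.
  rewrite (rnorm_unit_circle w1) mul1r expr2 invfM rnormM.
  by rewrite ler_pM ?rnorm_ge0 //; apply: inv_le => //; exact: far.
apply: (@cderiv_derivable _ _ _ (circle_integral (fun w => u w * k2 w))) => e e0.
(* In the remainder [w - x] is bounded below by [d / 2] and [w - z], which occurs twice, by [d]. *)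
pose K := M * (2 / d ^+ 3).
have K0 : 0 <= K by rewrite mulr_ge0 // divr_ge0 // exprn_ge0 // ltW.
exists (Num.min (d / 2) (e / (K + 1))).
  by rewrite lt_min !divr_gt0 // ltr_wpDl.
move=> x; rewrite lt_min => /andP[xd xe].
have Dx : D x.
  apply/open_diskP; have := rnormD (x - z) z; rewrite subrK; move: xd; rewrite /d; lra.
rewrite -(circle_integralB (ik x Dx) (ik z Dz)) [_ * (x - z)]mulrC -circle_integralZ //.
rewrite -circle_integralB //; last first.
  exact: circle_integrableZ.
  exact: (circle_integrableB (ik x Dx) (ik z Dz)).
have dx w : unit_circle w -> d / 2 <= rnorm (w - x).
  move=> w1; have := far z w w1; have := rnormD (w - x) (x - z).
  by rewrite addrA subrK -/d; lra.
have E w : unit_circle w ->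
    u w * cauchy_kernel x w - u w * cauchy_kernel z w - (x - z) * (u w * k2 w) =
    u w * (w * ((x - z) ^+ 2 * ((w - x)^-1 * ((w - z)^-1 * (w - z)^-1)))).
  move=> w1; have a := unit_disk_neq Dx w1; have b := unit_disk_neq Dz w1.
  by rewrite /cauchy_kernel /k2; field; rewrite a b.
rewrite (eq_circle_integral E).
apply: (@le_trans _ _ (K * rnorm (x - z) ^+ 2)); last first.
  rewrite expr2 mulrA ler_wpM2r ?rnorm_ge0 //.
  have : rnorm (x - z) * (K + 1) < e by rewrite -ltr_pdivlMr // ltr_wpDl.
  have := rnorm_ge0 (x - z); nra.
apply: rnorm_circle_integral_le.
  apply: cmeasM => //; apply: cmeasM => //.
  apply: (@cmeasM _ _ _ _ (fun=> (x - z) ^+ 2)); first exact: cmeas_cst.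
  by apply: cmeasM; [exact: minv|apply: cmeasM; exact: minv].
move=> w w1; rewrite !rnormM (rnorm_unit_circle w1) mul1r [rnorm (x - z) ^+ 2]expr2 /K.
rewrite -[leRHS]mulrA; apply: ler_pM; rewrite ?rnorm_ge0 ?uM ?mulr_ge0 ?rnorm_ge0 //.
rewrite [leLHS]mulrC; apply: ler_pM; rewrite ?mulr_ge0 ?rnorm_ge0 //.
have -> : 2 / d ^+ 3 = (d / 2)^-1 * (d^-1 * d^-1) by field; rewrite gt_eqF.
apply: ler_pM; rewrite ?mulr_ge0 ?rnorm_ge0 //; first by apply: inv_le (dx w w1) => //; rewrite divr_gt0.
by apply: ler_pM; rewrite ?rnorm_ge0 //; apply: inv_le => //; exact: far.
Qed.

End Poisson.

(** * Size of the Poisson kernel near and far from its peak *)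

Section PoissonRadial.
Variable R : realType.
Local Notation C := R[i].
Local Notation mu := (@lebesgue_measure R).

Lemma bounded_integrable (A : set R) (f : R -> R) (M : R) : measurable A ->
  (mu A < +oo)%E -> measurable_fun A f -> (forall t, A t -> `|f t| <= M) ->
  mu.-integrable A (EFin \o f).
Proof.
move=> mA fA mf fM.
apply: measurable_bounded_integrable => //.
exists M; split; first exact: num_real.
by move=> x Mx t At; exact: le_trans (fM t At) (ltW Mx).
Qed.

(** Near 0 the sine is at least half its argument in modulus, and [1 - cos t] is
    [2 * sin (t / 2) ^+ 2]; the half angle also doubles the admissible radius. *)
Lemma one_sub_cos_ge : exists2 rho : R, 0 < rho &
  forall t, `|t| < rho -> t ^+ 2 / 8 <= 1 - cos t.
Proof.
have e0 : 0 < 2^-1 :> R by rewrite invr_gt0.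
have [r r0 H] := is_derive_eps (is_derive_sin (0 : R)) e0.
exists (r + r); first exact: addr_gt0.
move=> t tr; have tr2 : `|t / 2| < r.
  by rewrite normrM normfV (ger0_norm (ler0n _ 2)); lra.
have := H _ tr2; rewrite add0r sin0 cos0 subr0 mul1r => K.
have {}K : `|t / 2| <= 2 * `|sin (t / 2)|.
  have := ler_normD (t / 2 - sin (t / 2)) (sin (t / 2)); rewrite subrK.
  rewrite [`|t / 2 - _|]distrC; lra.
have -> : 1 - cos t = 2 * sin (t / 2) ^+ 2.
  have {1}-> : t = (t / 2) *+ 2 by rewrite -mulr_natr divfK.
  by rewrite cos_mulr2n sin2cos2; ring.
rewrite -real_normK ?num_real // -[sin _ ^+ 2]real_normK ?num_real //.
have -> : `|t| = 2 * `|t / 2|.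
  by rewrite normrM normfV (ger0_norm (ler0n _ 2)); field.
have := normr_ge0 (t / 2); nra.
Qed.

Lemma cos_le_far (s t : R) : 0 < s -> s <= pi -> s <= `|t| -> `|t| <= pi *+ 2 - s ->
  cos t <= cos s.
Proof.
move=> s0 sp st t2; rewrite -(cos_norm t).
have leC (x : R) : s <= x -> x <= pi -> cos x <= cos s.
  move=> sx xp; rewrite le_eqVlt; have [->|xs] := eqVneq s x; first by rewrite eqxx.
  apply/orP; right; rewrite ltr_cos ?in_itv /= ?xp ?sp ?andbT; try lra.
have [tp|tp] := leP `|t| pi; first exact: leC.
have -> : cos `|t| = cos (pi *+ 2 - `|t|).
  by rewrite -cosN -cosD2pi addrC.
apply: leC; first by lra.
by rewrite mulr2n; lra.
Qed.

Lemma rnorm_sq (z : C) : rnorm z ^+ 2 = complex.Re z ^+ 2 + complex.Im z ^+ 2.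
Proof. by rewrite /rnorm normc_def /= sqr_sqrtr // addr_ge0 ?sqr_ge0. Qed.

(** The denominator is written as a sum of two nonnegative terms: the first caps the kernel at the
    scale [1 - r], the second gives its decay in [t - t0]. *)
Lemma poisson_kernel_polar (r t0 t : R) :
  poisson_kernel (r%:C * expi t0) (expi t) =
  (1 - r ^+ 2) / ((1 - r) ^+ 2 + 2 * r * (1 - cos (t - t0))).
Proof.
rewrite /poisson_kernel !rnorm_sq cosB; congr (_ / _).
  rewrite RecM ImcM /=.
  transitivity (1 - r ^+ 2 * (cos t0 ^+ 2 + sin t0 ^+ 2)); first ring.
  by rewrite cos2Dsin2 mulr1.
rewrite RecB ImcB RecM ImcM /= !mul0r subr0 addr0.
have a := sin2cos2 t0; have b := sin2cos2 t.
transitivity (cos t ^+ 2 + sin t ^+ 2 - 2 * r * (cos t * cos t0 + sin t * sin t0)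
  + r ^+ 2 * (cos t0 ^+ 2 + sin t0 ^+ 2)); first ring.
by rewrite a b; ring.
Qed.

(** The 16 is the 2 of [1 - r ^+ 2 <= 2 * (1 - r)] times the 8 of [one_sub_cos_ge]. The first bound
    is weakened to the same constant because [dyadic_shells] uses a single [A]. *)
Lemma poisson_kernel_near : exists2 rho : R, 0 < rho & forall r t0 t,
  1 / 2 <= r -> r < 1 -> `|t - t0| < rho ->
  poisson_kernel (r%:C * expi t0) (expi t) <= 16 / (1 - r) /\
  poisson_kernel (r%:C * expi t0) (expi t) * (t - t0) ^+ 2 <= 16 * (1 - r).
Proof.
have [rho rho0 H] := one_sub_cos_ge; exists rho => // r t0 t r2 r1 tt0.
have := H _ tt0; rewrite poisson_kernel_polar; set c := 1 - cos _; set x := t - t0.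
move=> cx; have h0 : 0 < 1 - r by lra.
have x0 := sqr_ge0 x.
have c0 : 0 <= c by apply: le_trans cx; rewrite divr_ge0.
have h2 : 0 < (1 - r) ^+ 2 by rewrite exprn_gt0.
have rc : c <= 2 * r * c by nra.
have den : 0 < (1 - r) ^+ 2 + 2 * r * c by lra.
have num : 1 - r ^+ 2 <= 2 * (1 - r) by nra.
split.
  rewrite ler_pdivrMr // mulrAC ler_pdivlMr //; nra.
rewrite mulrAC ler_pdivrMr //.
have : (1 - r ^+ 2) * x ^+ 2 <= 2 * (1 - r) * x ^+ 2 by rewrite ler_wpM2r.
have : 16 * (1 - r) * (x ^+ 2 / 8) <= 16 * (1 - r) * ((1 - r) ^+ 2 + 2 * r * c).
  by rewrite ler_wpM2l; lra.
lra.
Qed.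

Lemma poisson_kernel_le (r t0 t : R) : 1 / 2 <= r -> r < 1 ->
  poisson_kernel (r%:C * expi t0) (expi t) <= 2 / (1 - r).
Proof.
move=> r2 r1; rewrite poisson_kernel_polar.
have c1 := cos_le1 (t - t0); have h2 : 0 < (1 - r) ^+ 2 by rewrite exprn_gt0 // subr_gt0.
have h1 : 0 < 1 - r by rewrite subr_gt0.
have den : 0 < (1 - r) ^+ 2 + 2 * r * (1 - cos (t - t0)) by nra.
rewrite ler_pdivrMr // mulrAC ler_pdivlMr //; nra.
Qed.

Lemma poisson_kernel_far (s r t0 t : R) : 1 / 2 <= r -> r < 1 -> 0 < s -> s <= pi ->
  s <= `|t - t0| -> `|t - t0| <= pi *+ 2 - s ->
  poisson_kernel (r%:C * expi t0) (expi t) <= 2 * (1 - r) / (1 - cos s).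
Proof.
move=> r2 r1 s0 sp h1 h2; rewrite poisson_kernel_polar.
have cs : cos s < 1.
  by rewrite -[ltRHS]cos0 ltr_cos ?in_itv /= ?lexx ?pi_ge0 ?(ltW s0) ?sp.
have := cos_le_far s0 sp h1 h2; set c := cos (t - t0) => cc.
have h20 : 0 < (1 - r) ^+ 2 by rewrite exprn_gt0 // subr_gt0.
have c1 : 0 < 1 - cos s by rewrite subr_gt0.
have den : 0 < (1 - r) ^+ 2 + 2 * r * (1 - c) by nra.
rewrite ler_pdivrMr // mulrAC ler_pdivlMr //.
have num : 1 - r ^+ 2 <= 2 * (1 - r) by nra.
have : 1 - cos s <= (1 - r) ^+ 2 + 2 * r * (1 - c) by nra.
have : 0 <= 1 - r ^+ 2 by nra.
move=> n0 dd; apply: ler_pM => //; exact: ltW.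
Qed.

(* The weight [K] is dominated on dyadic shells around [t0], starting from the
   scale [h], by quantities decaying like [1 / (4^j h)], while the mass of [d]
   on the [j]-th shell is at most proportional to [2^j h]. *)
Lemma dyadic_shells (K d : R -> R) (t0 s1 h A eta : R) :
  0 < h -> 0 < s1 -> 0 <= A -> 0 <= eta ->
  (forall t, 0 <= d t) -> (forall t, 0 <= K t) ->
  mu.-integrable (ball t0 s1) (EFin \o d) ->
  mu.-integrable (ball t0 s1) (EFin \o (fun t => K t * d t)) ->
  (forall t, `|t - t0| < s1 -> K t <= A / h) ->
  (forall t, `|t - t0| < s1 -> K t * (t - t0) ^+ 2 <= A * h) ->
  (forall s, 0 < s -> s <= s1 -> \int[mu]_(t in ball t0 s) d t <= eta * s) ->
  \int[mu]_(t in ball t0 s1) (K t * d t) <= 5 * A * eta.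
Proof.
move=> h0 s10 A0 e0 d0 K0 id iKd K1 K2 dV.
(* The minimum cuts the last shell at the radius [s1], which is reached after finitely many
   doublings. *)
pose s (J : nat) := Num.min (2 ^+ J * h) s1.
have s_gt0 J : 0 < s J by rewrite lt_min s10 mulr_gt0 // exprn_gt0.
have s_le J : s J <= s1 by rewrite ge_min lexx orbT.
have sub a b : a <= b -> ball t0 a `<=` ball t0 b by move=> ab; exact: le_ball.
have mb a : measurable (ball t0 a : set R) by exact: measurable_ball.
have intS (f : R -> R) (B : set R) : measurable B -> B `<=` ball t0 s1 ->
    mu.-integrable (ball t0 s1) (EFin \o f) -> mu.-integrable B (EFin \o f).
  by move=> mB Bs; exact: (@integrableS _ _ _ mu _ _ _ (mb s1) mB Bs).
(* a bound [K <= c] on [B] bounds the integral by [c] times the mass of [d] *)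
have bnd (B : set R) a c : 0 <= c -> measurable B -> B `<=` ball t0 a -> 0 < a -> a <= s1 ->
    (forall t, B t -> K t <= c) ->
    \int[mu]_(t in B) (K t * d t) <= c * (eta * a).
  move=> c0 mB Ba a0 as1 Kc.
  have Bs : B `<=` ball t0 s1 by apply: subset_trans Ba _; exact: sub.
  apply: (@le_trans _ _ (\int[mu]_(t in B) (c * d t))).
    apply: le_Rintegral => //; first exact: intS.
      have : mu.-integrable B (fun t => c%:E * (d t)%:E)%E.
        by apply: integrableZl => //; exact: intS.
      by [].
    by move=> t Bt; rewrite ler_wpM2r // Kc.
  rewrite RintegralZl //; last exact: intS.
  rewrite ler_wpM2l //; apply: le_trans (dV a a0 as1).
  have i1 := intS d _ mB Bs id; have i2 := intS d _ (mb a) (sub _ _ as1) id.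
  apply: fine_le; [by apply: (integrable_fin_num _ i1)|by apply: (integrable_fin_num _ i2); exact: mb|].
  apply: ge0_subset_integral => //; last by move=> t _; rewrite lee_fin.
    exact: mb.
  by have /integrableP[] := i2.
(* The ball of radius [h] contributes at most [A * eta] and the [j]-th shell at most
   [A * eta * (2 / 2 ^+ j)]; [5 - 4 / 2 ^+ J] is the resulting partial sum. *)
have main J : \int[mu]_(t in ball t0 (s J)) (K t * d t) <=
    A * eta * (5 - 4 / 2 ^+ J).
  elim: J => [|J IH].
    have := @bnd (ball t0 (s 0%N)) (s 0%N) (A / h).
    rewrite expr0 divr1 => /(_ _ (mb _) (fun t b => b) (s_gt0 _) (s_le _) _) B.
    apply: le_trans (B _ _) _.
    - by rewrite divr_ge0 // ltW.
    - move=> t; rewrite /ball /= distrC => ts; apply: K1; exact: lt_le_trans (s_le 0%N).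
    have : s 0%N <= h by rewrite /s expr0 mul1r ge_min lexx.
    move=> s0h; apply: (@le_trans _ _ (A / h * (eta * h))).
      by rewrite !ler_wpM2l // divr_ge0 // ltW.
    by rewrite (_ : A / h * (eta * h) = A * eta); [lra | field; rewrite gt_eqF].
  have sJ : s J <= s J.+1.
    rewrite /s le_min ge_min ge_min lexx orbT andbT exprS -mulrA.
    by rewrite ler_peMl ?ler1n // mulr_ge0 ?exprn_ge0 // ltW.
  have -> : ball t0 (s J.+1) = ball t0 (s J) `|` (ball t0 (s J.+1) `\` ball t0 (s J)) :> set R.
    by rewrite setDUK //; exact: sub.
  have mD : measurable (ball t0 (s J.+1) `\` ball t0 (s J) : set R) by exact: measurableD.
  rewrite Rintegral_setU //; last 3 first.
  - exact: mb.
  - rewrite setDUK; last exact: sub.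
    by apply: intS => //; exact: sub.
  - by apply/disj_set2P; rewrite setDIK.
  have p0 : 0 < (2 : R) ^+ J by rewrite exprn_gt0.
  have := @bnd (ball t0 (s J.+1) `\` ball t0 (s J)) (s J.+1) (A / (4 ^+ J * h)).
  have q0 : 0 <= A / (4 ^+ J * h) by rewrite divr_ge0 // mulr_ge0 ?exprn_ge0 // ltW.
  move=> /(_ q0 mD _ (s_gt0 _) (s_le _) _) B.
  have {}B : \int[mu]_(t in ball t0 (s J.+1) `\` ball t0 (s J)) (K t * d t) <=
      A / (4 ^+ J * h) * (eta * s J.+1).
    apply: B; first by move=> t [].
    move=> t [] ; rewrite /ball /= distrC => t1 /negP; rewrite -leNgt => t2.
    have ts1 : `|t - t0| < s1 by apply: lt_le_trans (s_le J.+1).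
    (* A point outside the ball of radius [s J] but inside that of radius [s1] forces the minimum
       defining [s J] to be [2 ^+ J * h]. *)
    have t3 : 2 ^+ J * h <= `|t - t0|.
      by move: t2; rewrite /s ge_min => /orP[//|]; rewrite leNgt ts1.
    have ph : 0 < 2 ^+ J * h by rewrite mulr_gt0.
    rewrite ler_pdivlMr ?mulr_gt0 ?exprn_gt0 // -(ler_pM2r h0).
    apply: le_trans (K2 _ ts1); rewrite -mulrA ler_wpM2l //.
    rewrite -[(t - t0) ^+ 2]real_normK ?num_real //.
    have -> : 4 ^+ J * h * h = (2 ^+ J * h) ^+ 2.
      have -> : 4 ^+ J = 2 ^+ J * 2 ^+ J :> R by rewrite -exprMn; congr (_ ^+ _); ring.
      by ring.
    by rewrite ler_sqr ?nnegrE // ltW.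
  apply: le_trans (lerD IH B) _.
  have : s J.+1 <= 2 ^+ J.+1 * h by rewrite /s ge_min lexx.
  move=> sh; have : A / (4 ^+ J * h) * (eta * s J.+1) <=
      A / (4 ^+ J * h) * (eta * (2 ^+ J.+1 * h)) by rewrite ler_wpM2l // ler_wpM2l.
  have -> : A / (4 ^+ J * h) * (eta * (2 ^+ J.+1 * h)) = A * eta * (2 / 2 ^+ J).
    have -> : 4 ^+ J = 2 ^+ J * 2 ^+ J :> R by rewrite -exprMn; congr (_ ^+ _); ring.
    by rewrite exprS; field; rewrite !gt_eqF.
  have -> : A * eta * (5 - 4 / 2 ^+ J.+1) = A * eta * (5 - 4 / 2 ^+ J) + A * eta * (2 / 2 ^+ J).
    by rewrite exprS; field; rewrite gt_eqF.
  by move=> le1; rewrite lerD2l.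
have [J sJ] : exists J, s J = s1.
  have [n nh] : exists n : nat, s1 / h < n%:R.
    by exists (Num.Def.truncn (s1 / h)).+1; rewrite truncnS_gt.
  exists n; apply/min_idPr; rewrite -ler_pdivrMr //; apply: le_trans (ltW nh) _.
  by rewrite -natrX ler_nat ltnW // ltn_expl.
have := main J; rewrite sJ => /le_trans; apply.
have : 0 <= A * eta * (4 / 2 ^+ J) by rewrite !mulr_ge0 // invr_ge0 exprn_ge0.
lra.
Qed.

End PoissonRadial.

(** * Poisson integrals at Lebesgue points *)

Section RadialLimits.
Variable R : realType.
Local Notation C := R[i].
Local Notation mu := (@lebesgue_measure R).
Local Notation D := (@open_disk R).
Local Notation I2pi := (`[0, pi *+ 2]%classic : set R).

Lemma lebesgue_pt_mean (v : R -> R) (M t0 : R) : measurable_fun setT v ->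
  (forall t, `|v t| <= M) -> lebesgue_pt v t0 -> forall eta, 0 < eta ->
  exists2 s2 : R, 0 < s2 & forall s, 0 < s -> s < s2 ->
  \int[mu]_(t in ball t0 s) `|v t - v t0| <= eta * s.
Proof.
(* The average runs over a ball of length [2 * s], hence the threshold [eta / 2]. *)
move=> mv vM lv eta e0; have e20 : 0 < eta / 2 by rewrite divr_gt0.
have : \forall s \near (0 : R)^'+, (davg v t0 s < (eta / 2)%:E)%E.
  by apply: (lv (fun x => (x < (eta / 2)%:E)%E)); exact: (@nbhs_open_ereal_lt R 0 (fun=> eta / 2)).
move=> /nbhs_ballP[s2 /= s20 H]; exists s2 => // s s0 ss2.
have bs : ball_ Num.Def.normr 0 s2 s by rewrite /= sub0r normrN gtr0_norm.
have := H s; rewrite -{1}ball_normE => /(_ bs s0).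
rewrite /davg /iavg /= lebesgue_measure_ball ?(ltW s0) // inver mulrn_eq0 /= (gt_eqF s0).
have id : mu.-integrable (ball t0 s) (EFin \o (fun t => `|v t - v t0|)).
  apply: (@bounded_integrable _ _ _ (M + M)).
  - exact: measurable_ball.
  - by rewrite lebesgue_measure_ball ?(ltW s0) // ltry.
  - apply: measurable_funTS; apply: measurableT_comp => //.
    by apply: measurable_funB.
  - by move=> t _; rewrite normr_id; apply: le_trans (ler_normB _ _) _; rewrite lerD.
have -> : (\int[mu]_(y in ball t0 s) `|(v y - v t0)%:E|)%E =
    (\int[mu]_(t in ball t0 s) `|v t - v t0|)%:E.
  rewrite /Rintegral fineK //; apply: (integrable_fin_num _ id).
  exact: measurable_ball.
rewrite -EFinM lte_fin mulrC ltr_pdivrMr ?mulrn_wgt0 // => /ltW /le_trans; apply.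
by rewrite -mulr_natr; lra.
Qed.

(** Around [t0] the kernel satisfies the hypotheses of [dyadic_shells] at the scale [h = 1 - r], and
    the Lebesgue point condition controls the mass of the oscillation of [v] at all small scales.
    Away from [t0] the kernel is of order [1 - r] uniformly. *)
Lemma poisson_lebesgue_pt (v : R -> R) (M t0 : R) : measurable_fun setT v ->
  (forall t, `|v t| <= M) -> 0 < t0 -> t0 < pi *+ 2 -> lebesgue_pt v t0 ->
  forall e, 0 < e -> \forall r \near (1 : R)^'-,
  \int[mu]_(t in I2pi) (poisson_kernel (r%:C * expi t0) (expi t) * `|v t - v t0|) <= e.
Proof.
move=> mv vM t00 t02 lv e e0.
have M0 : 0 <= M by apply: le_trans (vM 0).
have [rho rho0 Hrho] := poisson_kernel_near R.
(* [dyadic_shells] returns [5 * 16] times this quantity, which is [e / 2]. *)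
have eta0 : 0 < e / 160 by rewrite divr_gt0.
have [s2 s20 Hs2] := lebesgue_pt_mean mv vM lv eta0.
(* Staying below [t0] and [pi *+ 2 - t0] puts the ball inside one period and keeps all other points
   of the period at distance at least [s1] from [t0] modulo [2 pi]. *)
have [s1 [s10 s1rho s1s2 s1t s1t']] : exists s1, [/\ 0 < s1, s1 < rho, s1 < s2,
    s1 < t0 & s1 < pi *+ 2 - t0].
  exists (Num.min (Num.min rho s2) (Num.min t0 (pi *+ 2 - t0)) / 2).
  set m := Num.min _ _; have m0 : 0 < m by rewrite !lt_min rho0 s20 t00 subr_gt0 t02.
  have : m / 2 < m by lra.
  by rewrite {2}/m !lt_min => /andP[/andP[-> ->] /andP[-> ->]]; rewrite divr_gt0.
have s1pi : s1 <= pi by move: s1t s1t'; rewrite mulr2n; lra.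
have cs : 0 < 1 - cos s1.
  by rewrite subr_gt0 -[ltRHS]cos0 ltr_cos ?in_itv /= ?lexx ?pi_ge0 ?(ltW s10) ?s1pi.
(* The far part is at most [B * (1 - r)], to be made at most [e / 2]; dividing by [B + 1] also
   covers [B = 0]. *)
pose B := 2 / (1 - cos s1) * (M + M) * (pi *+ 2).
have B0 : 0 <= B.
  apply: mulr_ge0; last by rewrite mulrn_wge0 ?pi_ge0.
  by apply: mulr_ge0; [rewrite divr_ge0 // ltW | exact: addr_ge0].
have g0 : 0 < e / (2 * (B + 1)) by rewrite divr_gt0 // mulr_gt0 // ltr_wpDl.
near=> r.
have r1 : r < 1 by near: r; exact: nbhs_left_lt.
have r2 : 1 / 2 <= r by apply: ltW; near: r; apply: nbhs_left_gt; lra.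
have r3 : 1 - r <= e / (2 * (B + 1)).
  by apply: ltW; rewrite ltrBlDr -ltrBlDl; near: r; apply: nbhs_left_gt; lra.
have h0 : 0 < 1 - r by rewrite subr_gt0.
have Dr : D (r%:C * expi t0).
  by apply/open_diskP; rewrite rnormM rnorm_expi mulr1 rnorm_real ger0_norm //; clear - r2; lra.
pose K t := poisson_kernel (r%:C * expi t0) (expi t).
pose d t := `|v t - v t0|.
have K0 t : 0 <= K t by exact: poisson_kernel_ge0.
have d0 t : 0 <= d t by exact: normr_ge0.
have dM t : d t <= M + M by apply: le_trans (ler_normB _ _) _; rewrite lerD.
have md : measurable_fun setT d by apply: measurableT_comp => //; exact: measurable_funB.
have mK : measurable_fun setT K.
  by apply: continuous_measurable_fun; exact: poisson_kernel_continuous.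
have [KM KMP] : exists KM, forall t, K t <= KM.
  by exists (2 / (1 - r)) => t; exact: poisson_kernel_le.
have mKd : measurable_fun setT (fun t => K t * d t) by exact: measurable_funM.
have iKd (A : set R) : measurable A -> (mu A < +oo)%E ->
    mu.-integrable A (EFin \o (fun t => K t * d t)).
  move=> mA fA; apply: (@bounded_integrable _ _ _ (KM * (M + M))) => //.
    exact: measurable_funTS.
  by move=> t _; rewrite normrM !ger0_norm //; apply: ler_pM.
have mb : measurable (ball t0 s1 : set R) by exact: measurable_ball.
have fb : (mu (ball t0 s1) < +oo)%E by rewrite lebesgue_measure_ball ?(ltW s10) // ltry.
have bI : ball t0 s1 `<=` I2pi.
  move=> t; rewrite /ball /= ltr_norml in_itv /= => /andP[a b].
  by apply/andP; clear - a b s1t s1t'; split; lra.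
have fI : (mu I2pi < +oo)%E.
  by rewrite /= lebesgue_measure_itv /=; case: ifP => // _; rewrite -EFinB ltry.
have mI : measurable (I2pi `\` ball t0 s1) by apply: measurableD.
have near_part : \int[mu]_(t in ball t0 s1) (K t * d t) <= 5 * 16 * (e / 160).
  apply: (@dyadic_shells _ K d t0 s1 (1 - r)) => //; [exact: ltW| | | | |].
  - apply: (@bounded_integrable _ _ _ (M + M)) => //; first exact: measurable_funTS.
    by move=> t _; rewrite ger0_norm.
  - exact: iKd.
  - by move=> t ts; have [] := Hrho r t0 t r2 r1 (lt_trans ts s1rho).
  - by move=> t ts; have [] := Hrho r t0 t r2 r1 (lt_trans ts s1rho).
  - by move=> s s0 ss1; apply: Hs2 => //; exact: (le_lt_trans ss1 s1s2).
have far_part : \int[mu]_(t in I2pi `\` ball t0 s1) (K t * d t) <=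
    2 * (1 - r) / (1 - cos s1) * (M + M) * (pi *+ 2).
  have c0 : 0 <= 2 * (1 - r) / (1 - cos s1) * (M + M).
    by apply: mulr_ge0; [rewrite divr_ge0 ?mulr_ge0 // ltW | exact: addr_ge0].
  have leD : (mu (I2pi `\` ball t0 s1) <= mu I2pi)%E.
    by apply: le_measure; rewrite ?inE //; exact: subDsetl.
  have fD : (mu (I2pi `\` ball t0 s1) < +oo)%E.
    exact: le_lt_trans leD fI.
  apply: (@le_trans _ _ (\int[mu]_(t in I2pi `\` ball t0 s1)
     (2 * (1 - r) / (1 - cos s1) * (M + M)))).
    apply: le_Rintegral => //; first exact: iKd.
      by apply: (@bounded_integrable _ _ _ (2 * (1 - r) / (1 - cos s1) * (M + M))) => // t _;
        rewrite ger0_norm.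
    move=> t [tI tb]; apply: ler_pM => //; apply: poisson_kernel_far => //.
      by move: tb; rewrite /ball /= => /negP; rewrite -leNgt distrC.
    move: tI; rewrite /= in_itv /= => /andP[a b].
    by rewrite ler_norml; apply/andP; clear - a b s1t s1t'; split; lra.
  rewrite Rintegral_cst // ler_wpM2l //.
  have p0 : 0 <= pi *+ 2 :> R by rewrite mulrn_wge0 ?pi_ge0.
  rewrite [leRHS](_ : _ = fine (mu I2pi)); last by rewrite fine_mu_itv // subr0.
  by apply: fine_le; [rewrite ge0_fin_numE|rewrite ge0_fin_numE|].
rewrite -[I2pi](setDUK bI) Rintegral_setU //; last 2 first.
- by rewrite setDUK //; exact: iKd.
- by apply/disj_set2P; rewrite setDIK.
apply: le_trans (lerD near_part far_part) _.
have -> : 2 * (1 - r) / (1 - cos s1) * (M + M) * (pi *+ 2) = B * (1 - r).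
  by rewrite /B; field; rewrite gt_eqF.
have : B * (1 - r) <= (B + 1) * (e / (2 * (B + 1))).
  by apply: ler_pM => //; [exact: ltW|lra].
have -> : (B + 1) * (e / (2 * (B + 1))) = e / 2 by field; rewrite gt_eqF // ltr_wpDl.
lra.
Unshelve. all: by end_near. Qed.

End RadialLimits.

(** * Integrals of functions that agree off a null set *)

Section NullSets.
Context d (T : measurableType d) (R : realType).
Variable mu : {measure set T -> \bar R}.
Local Open Scope ereal_scope.

Import HBNNSimple.

Let ge0_le_integral_null (f g : T -> \bar R) (N : set T) : measurable N -> mu N = 0 ->
  (forall t, 0 <= f t) -> (forall t, 0 <= g t) -> (forall t, ~ N t -> f t = g t) ->
  \int[mu]_t f t <= \int[mu]_t g t.
Proof.
move=> mN N0 f0 g0 fg; rewrite !ge0_integralTE //.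
apply: ge_ereal_sup => _ [h hf <-]; apply: ereal_sup_ubound.
have mNC : measurable (~` N) by exact: measurableC.
exists (proj_nnsfun h mNC).
  move=> x; rewrite -mrestrict patchE; case: ifPn => [|_]; last exact: g0.
  by rewrite inE => xN; rewrite -fg //; exact: hf.
rewrite -mrestrict -integral_nnsfun // -integralT_nnsfun.
rewrite [RHS](ge0_negligible_integral mN) ?setTD //.
- by apply/measurable_EFinP; exact: measurable_funPT.
- by move=> x _; rewrite lee_fin.
Qed.

(* Neither function needs to be measurable: the integral of a nonnegative
   function is a supremum over simple functions, which can be cut off on the
   null set. *)
Lemma eq_integral_null (f g : T -> \bar R) (D N : set T) : measurable N ->
  mu N = 0 -> (forall t, D t -> ~ N t -> f t = g t) ->
  \int[mu]_(t in D) f t = \int[mu]_(t in D) g t.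
Proof.
move=> mN N0 fg; rewrite integralE [RHS]integralE.
have key (p : \bar R -> \bar R) : (forall x, 0 <= p x) ->
    \int[mu]_(t in D) p (f t) = \int[mu]_(t in D) p (g t).
  move=> p0; rewrite integral_mkcond [RHS]integral_mkcond.
  have r0 (h : T -> \bar R) t : 0 <= ((fun t => p (h t)) \_ D) t.
    by rewrite patchE; case: ifP.
  have E t : ~ N t -> ((fun t => p (f t)) \_ D) t = ((fun t => p (g t)) \_ D) t.
    by move=> nN; rewrite !patchE; case: ifPn => //; rewrite inE => Dt; rewrite fg.
  apply/eqP; rewrite eq_le; apply/andP; split;
    apply: (ge0_le_integral_null mN N0) => // t /E //.
congr (_ - _).
  by rewrite !unlock; apply: (key (fun x => maxe x 0)) => x; rewrite le_max lexx orbT.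
by rewrite !unlock; apply: (key (fun x => maxe (- x) 0)) => x; rewrite le_max lexx orbT.
Qed.

End NullSets.

(** * Radial limits almost everywhere *)

Section RadialLimitsAE.
Variable R : realType.
Local Notation C := R[i].
Local Notation mu := (@lebesgue_measure R).
Local Notation D := (@open_disk R).
Local Notation I2pi := (`[0, pi *+ 2]%classic : set R).

Lemma mu_I2pi_lty : (mu I2pi < +oo)%E.
Proof. by rewrite /= lebesgue_measure_itv /=; case: ifP => // _; rewrite -EFinB ltry. Qed.

(** Fatou's theorem for bounded boundary data. As the kernel has mean 1, the error at [t] is the
    mean of the kernel times [u - u (expi t)], which is small wherever [t] is a Lebesgue point of
    both the real and the imaginary part. *)
Lemma poisson_radial_ae (u : C -> C) (M : R) : circle_meas u ->
  (forall w, unit_circle w -> rnorm (u w) <= M) ->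
  {ae mu, forall t, 0 < t < pi *+ 2 ->
    circle_integral (fun w => u w * (poisson_kernel (r%:C * expi t) w)%:C)
      @[r --> (1 : R)^'-] --> u (expi t)}.
Proof.
move=> mu_ uM; have [m1 m2] := mu_.
have M0 : 0 <= M by apply: le_trans (rnorm_ge0 _) (uM _ (expi_unit 0)).
have part (p : C -> R) : (forall z, `|p z| <= rnorm z) ->
    measurable_fun I2pi (fun t => p (u (expi t))) ->
    {ae mu, forall t, 0 < t < pi *+ 2 -> forall e, 0 < e -> \forall r \near (1 : R)^'-,
      \int[mu]_(s in I2pi) (poisson_kernel (r%:C * expi t) (expi s) *
        `|p (u (expi s)) - p (u (expi t))|) <= e}.
  (* Extension by 0 gives a bounded measurable function on the line, to which Lebesgue
     differentiation applies; only its values in the period are integrated. *)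
  move=> pz mp; pose v := (fun t => p (u (expi t))) \_ I2pi.
  have mv : measurable_fun setT v by apply/(measurable_restrictT _ _).1.
  have vM t : `|v t| <= M.
    rewrite /v patchE; case: ifP => _; last by rewrite normr0.
    by apply: le_trans (pz _) _; apply: uM; exact: expi_unit.
  have : locally_integrable setT v.
    apply: integrable_locally_restrict => //.
    apply: (@bounded_integrable _ _ _ M) => //; first exact: mu_I2pi_lty.
    by move=> t _; apply: le_trans (pz _) _; apply: uM; exact: expi_unit.
  move=> /lebesgue_differentiation; apply: filterS; first exact: (ae_filter_ringOfSetsType mu).
  move=> t lt /andP[t0 t1] e e0.
  have := poisson_lebesgue_pt mv vM t0 t1 lt e0; apply: filterS => r.
  apply: le_trans; rewrite le_eqVlt; apply/orP; left; apply/eqP.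
  have tI : t \in I2pi by rewrite mem_set //= in_itv /= !ltW.
  by apply: eq_Rintegral => s sI; rewrite /v !patchE sI tI.
have := part _ (@norm_Re R) m1; have := part _ (@norm_Im R) m2.
apply: filterS2; first exact: (ae_filter_ringOfSetsType mu).
move=> t H2 H1 t02.
apply/cvgC_distP => e e0; have e20 : 0 < e / 2 by rewrite divr_gt0.
have {}H1 := H1 t02 _ e20; have {}H2 := H2 t02 _ e20.
near=> r.
have h1 : \int[mu]_(s in I2pi) (poisson_kernel (r%:C * expi t) (expi s) *
  `|complex.Re (u (expi s)) - complex.Re (u (expi t))|) <= e / 2 by near: r.
have h2 : \int[mu]_(s in I2pi) (poisson_kernel (r%:C * expi t) (expi s) *
  `|complex.Im (u (expi s)) - complex.Im (u (expi t))|) <= e / 2 by near: r.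
have r1 : r < 1 by near: r; exact: nbhs_left_lt.
have r0 : 0 < r by near: r; apply: nbhs_left_gt.
have Dr : D (r%:C * expi t).
  by apply/open_diskP; rewrite rnormM rnorm_expi mulr1 rnorm_real ger0_norm // ltW.
set z := r%:C * expi t in h1 h2 Dr *.
pose K s := poisson_kernel z (expi s).
have K0 s : 0 <= K s by exact: poisson_kernel_ge0.
have iP (p : C -> R) : (forall z, `|p z| <= rnorm z) ->
    measurable_fun I2pi (fun t => p (u (expi t))) ->
    mu.-integrable I2pi (EFin \o (fun s => K s * `|p (u (expi s)) - p (u (expi t))|)).
  move=> pz mp; have pM s : `|p (u (expi s))| <= M.
    by apply: le_trans (pz _) _; apply: uM; exact: expi_unit.
  apply: (le_integrable _ _ _ (poisson_kernel_integrableZ (M + M) Dr)) => //.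
    apply/measurable_EFinP; apply: measurable_funM.
      by apply: measurable_funTS; apply: continuous_measurable_fun; exact: poisson_kernel_continuous.
    by apply: measurableT_comp => //; apply: measurable_funB.
  move=> s _; rewrite lee_fin [leLHS]normrM normr_id (ger0_norm (K0 s)).
  rewrite [leRHS]ger0_norm; last by rewrite mulr_ge0 ?addr_ge0 // K0.
  rewrite [leRHS]mulrC ler_wpM2l //.
  by apply: le_trans (ler_normB _ _) _; rewrite lerD.
have ik : circle_integrable (fun w => u w * (poisson_kernel z w)%:C).
  exact: poisson_integrable uM Dr.
have ik1 : circle_integrable (fun w => (poisson_kernel z w)%:C).
  apply: (@cintegrable_dom _ _ _ mu I2pi _ (fun t => poisson_kernel z (expi t))) => //.
  - exact: poisson_kernel_meas.
  - exact: poisson_kernel_integrable.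
  - by move=> s _ /=; rewrite rnorm_real ger0_norm ?poisson_kernel_ge0.
rewrite -[u (expi t)]mulr1 -(circle_integral_poisson_kernel Dr) -circle_integralZ //.
rewrite -circle_integralB //; last exact: circle_integrableZ.
pose g w := poisson_kernel z w * `|complex.Re (u w) - complex.Re (u (expi t))| +
  poisson_kernel z w * `|complex.Im (u w) - complex.Im (u (expi t))|.
have i1 := iP _ (@norm_Re R) m1; have i2 := iP _ (@norm_Im R) m2.
apply: le_lt_trans (@le_rnorm_circle_integral _ _ g _ _ _) _.
- by apply: circle_integrableB => //; exact: circle_integrableZ.
- exact: (integrableD _ i1 i2).
- move=> w w1; rewrite -mulrBl rnormM rnorm_real ger0_norm ?poisson_kernel_ge0 //.
  rewrite /g -mulrDr mulrC ler_wpM2l ?poisson_kernel_ge0 //.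
  by rewrite rnorm_distC; apply: le_trans (rnorm_ReIm _) _; rewrite RecB ImcB.
rewrite /g RintegralD //.
rewrite mulrC ltr_pdivrMr ?pi2_gt0 //; apply: le_lt_trans (lerD h1 h2) _.
rewrite -splitr -[ltLHS]mulr1 ltr_pM2l //.
by have := pi_ge2 R; rewrite mulr2n; lra.
Unshelve. all: by end_near. Qed.

End RadialLimitsAE.

(** * Summable sequences *)

Section Summable.
Variable R : realType.
Local Notation C := R[i].
Implicit Types (x y : nat -> C) (B q : R).

(** A bound on all partial sums carries the constant along and yields convergence at the same
    time. *)
Definition l1_le x B := forall N, \sum_(0 <= n < N) rnorm (x n) <= B.

Lemma l1_le_ge0 x B : l1_le x B -> 0 <= B.
Proof. by move=> /(_ 0%N); rewrite big_geq. Qed.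

Lemma l1_le_term x B n : l1_le x B -> rnorm (x n) <= B.
Proof.
move=> /(_ n.+1); rewrite big_nat_recr //=; apply: le_trans.
by rewrite lerDr sumr_ge0 // => i _; exact: rnorm_ge0.
Qed.

Lemma nonneg_series_cvg (v : nat -> R) B : (forall n, 0 <= v n) ->
  (forall N, \sum_(0 <= n < N) v n <= B) -> cvgn (series v).
Proof.
move=> v0 vB; apply: nondecreasing_is_cvgn.
  by apply/nondecreasing_seqP => n; rewrite /series /= big_nat_recr //= lerDl.
by exists B => _ [n _ <-]; exact: vB.
Qed.

Lemma l1_le_cvg x B : l1_le x B -> cvgn (series x).
Proof.
move=> xB; apply: cvg_series_rnorm.
by apply: nonneg_series_cvg xB => n; exact: rnorm_ge0.
Qed.

Lemma l1_le_lim x B : l1_le x B -> rnorm (limn (series x)) <= B.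
Proof.
move=> xB; apply: (rnorm_cvg_le (l1_le_cvg xB)) => n.
exact: le_trans (rnorm_sum _ _ _) (xB n).
Qed.

Lemma l1_leM (m : nat -> C) q x B : (forall n, rnorm (m n) <= q) -> l1_le x B ->
  l1_le (fun n => m n * x n) (q * B).
Proof.
move=> mq xB N; have q0 : 0 <= q by apply: le_trans (rnorm_ge0 _) (mq 0%N).
apply: (@le_trans _ _ (\sum_(0 <= n < N) q * rnorm (x n))).
  by apply: ler_sum => n _; rewrite rnormM ler_wpM2r ?rnorm_ge0.
by rewrite -mulr_sumr ler_wpM2l.
Qed.

Lemma l1_leD x y B B' : l1_le x B -> l1_le y B' ->
  l1_le (fun n => x n + y n) (B + B').
Proof.
move=> xB yB N; apply: le_trans (lerD (xB N) (yB N)).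
by rewrite -big_split /=; apply: ler_sum => n _; exact: rnormD.
Qed.

Lemma l1_leB x y B B' : l1_le x B -> l1_le y B' ->
  l1_le (fun n => x n - y n) (B + B').
Proof.
move=> xB yB N; apply: le_trans (lerD (xB N) (yB N)).
by rewrite -big_split /=; apply: ler_sum => n _; exact: rnormB_le.
Qed.

Lemma cvg_sumr (I : Type) (s : seq I) (f : nat -> I -> R) (l : I -> R) :
  (forall i, f J i @[J --> \oo] --> l i) ->
  \sum_(i <- s) f J i @[J --> \oo] --> \sum_(i <- s) l i.
Proof.
move=> fl; elim: s => [|i s IH].
  by rewrite big_nil; under eq_cvg do rewrite big_nil; exact: cvg_cst.
by rewrite big_cons; under eq_cvg do rewrite big_cons; exact: cvgD.
Qed.

(** Lower semicontinuity of the l1 norm under coordinatewise limits: only finite sums have to pass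
    to the limit. *)
Lemma l1_le_limit (y : nat -> nat -> C) x B : (forall J, l1_le (y J) B) ->
  (forall n, y J n @[J --> \oo] --> x n) -> l1_le x B.
Proof.
move=> yB yx N.
have cv : \sum_(0 <= n < N) rnorm (y J n) @[J --> \oo] --> \sum_(0 <= n < N) rnorm (x n).
  by apply: cvg_sumr => n; exact: rnorm_cvg.
rewrite -(cvg_lim _ cv) //; apply: limr_le; first exact: cvgP cv.
by apply: nearW => J; exact: yB.
Qed.

Lemma limn_seriesB x y B B' : l1_le x B -> l1_le y B' ->
  limn (series (fun n => x n - y n)) = limn (series x) - limn (series y).
Proof.
move=> xB yB; apply: cvgC_lim.
have -> : series (fun n => x n - y n) = (fun N => series x N - series y N).
  by apply/funext => N; rewrite /series /= sumrB.
by apply: cvgCB; [exact: (l1_le_cvg xB)|exact: (l1_le_cvg yB)].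
Qed.

(* Neumann series for [M = 1 - E], where [E] contracts l1 with ratio [q]; it
   is run as the fixed point iteration [y := a + E y]. *)
Section Neumann.
Variables (E : nat -> nat -> C) (q : R).
Hypothesis q1 : q < 1.
Hypothesis Eq : forall n, l1_le (E ^~ n) q.

Let q0 : 0 <= q. Proof. exact: l1_le_ge0 (Eq 0%N). Qed.

Definition l1_op x (k : nat) : C := limn (series (fun n => E k n * x n)).

Lemma l1_op_row x B k : l1_le x B -> l1_le (fun n => E k n * x n) (q * B).
Proof. by apply: l1_leM => n; exact: (l1_le_term _ (Eq n)). Qed.

(** The hypothesis on [E] bounds its columns, and the largest column norm is what controls an
    operator on l1. Truncating the inner sum at [J] makes the exchange of sums finite; [l1_le_limit]
    removes the truncation. *)
Lemma l1_op_le x B : l1_le x B -> l1_le (l1_op x) (q * B).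
Proof.
move=> xB; apply: (@l1_le_limit (fun J k => series (fun n => E k n * x n) J)).
  move=> J K.
  apply: (@le_trans _ _ (\sum_(0 <= k < K) \sum_(0 <= n < J) rnorm (E k n) * rnorm (x n))).
    apply: ler_sum => k _; apply: le_trans (rnorm_sum _ _ _) _.
    by apply: ler_sum => n _; rewrite rnormM.
  rewrite exchange_big /=.
  apply: (@le_trans _ _ (\sum_(0 <= n < J) q * rnorm (x n))).
    by apply: ler_sum => n _; rewrite -mulr_suml ler_wpM2r ?rnorm_ge0 //; exact: Eq.
  by rewrite -mulr_sumr ler_wpM2l.
by move=> k; exact: (l1_le_cvg (l1_op_row k xB)).
Qed.

Lemma l1_opB x y B B' : l1_le x B -> l1_le y B' ->
  l1_op (fun n => x n - y n) = (fun k => l1_op x k - l1_op y k).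
Proof.
move=> xB yB; apply/funext => k.
rewrite /l1_op -(limn_seriesB (l1_op_row k xB) (l1_op_row k yB)).
by congr (limn (series _)); apply/funext => n; rewrite mulrBr.
Qed.

Lemma neumann_l1 a B : l1_le a B -> exists b B', l1_le b B' /\
  forall k, b k = a k + l1_op b k.
Proof.
move=> aB; have B0 := l1_le_ge0 aB.
pose fix y J := if J is J'.+1 then (fun k => a k + l1_op (y J') k) else (fun=> 0 : C).
have y0 : l1_le (y 0%N) 0.
  by move=> N; rewrite big1 // => n _; rewrite rnorm0.
have yl1 J : exists BJ, l1_le (y J) BJ.
  elim: J => [|J [BJ IH]]; first by exists 0.
  by exists (B + q * BJ); apply: l1_leD => //; exact: l1_op_le.
have ystep J : l1_le (fun n => y J.+1 n - y J n) (q ^+ J * B).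
  elim: J => [|J IH].
    rewrite expr0 mul1r; have := l1_op_le y0; rewrite mulr0 => op0.
    have := l1_leB (l1_leD aB op0) y0; rewrite !addr0.
    by [].
  have [BJ yJ] := yl1 J; have [BJ1 yJ1] := yl1 J.+1.
  have -> : (fun n => y J.+2 n - y J.+1 n) = l1_op (fun n => y J.+1 n - y J n).
    by rewrite (l1_opB yJ1 yJ); apply/funext => n /=; rewrite opprD addrACA subrr add0r.
  by rewrite exprS -mulrA; exact: l1_op_le.
have d1 : 0 < 1 - q by rewrite subr_gt0.
(* The bound is uniform in [m], so it survives the limit and becomes the distance from the iterates
   to the fixed point. *)
have ydist J m : l1_le (fun n => y (J + m)%N n - y J n) (q ^+ J * B / (1 - q)).
  suff H : l1_le (fun n => y (J + m)%N n - y J n) (q ^+ J * B * ((1 - q ^+ m) / (1 - q))).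
    move=> N; apply: le_trans (H N) _.
    rewrite ler_wpM2l ?mulr_ge0 ?exprn_ge0 // ler_pdivrMr // mulVf ?gt_eqF //.
    by rewrite lerBlDr lerDl exprn_ge0.
  elim: m => [|m IH].
    rewrite addn0 expr0 subrr mul0r mulr0 => N; rewrite big1 // => n _.
    by rewrite subrr rnorm0.
  have := l1_leD (ystep (J + m)%N) IH.
  have -> : q ^+ (J + m) * B + q ^+ J * B * ((1 - q ^+ m) / (1 - q)) =
     q ^+ J * B * ((1 - q ^+ m.+1) / (1 - q)).
    by rewrite exprD exprS; field; rewrite gt_eqF.
  rewrite addnS; congr l1_le; apply/funext => n.
  by rewrite addrA subrK.
have geo N : \sum_(0 <= J < N) q ^+ J = (1 - q ^+ N) / (1 - q).
  elim: N => [|N IH]; first by rewrite big_geq // expr0 subrr mul0r.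
  by rewrite big_nat_recr //= IH exprS; field; rewrite gt_eqF.
have ycv n : cvgn (y ^~ n).
  pose e J := y J.+1 n - y J n.
  have : cvgn (series e).
    apply: (@l1_le_cvg _ (B / (1 - q))) => N.
    apply: (@le_trans _ _ (\sum_(0 <= J < N) q ^+ J * B)).
      by apply: ler_sum => J _; exact: (l1_le_term n (ystep J)).
    rewrite -mulr_suml mulrC ler_wpM2l // geo ler_pdivrMr // mulVf ?gt_eqF //.
    by rewrite lerBlDr lerDl exprn_ge0.
  have -> // : series e = y ^~ n.
  by apply/funext => N; rewrite /series /= telescope_sumr // /y subr0.
pose b n := limn (y ^~ n); pose B' := B / (1 - q).
have bdist J : l1_le (fun n => b n - y J n) (q ^+ J * B').
  rewrite /B' mulrA; apply: (l1_le_limit (ydist J)) => n.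
  apply: cvgCB; last exact: cvg_cst.
  have := ycv n; rewrite -(cvg_shiftn J) => H; apply: cvg_trans H.
  by apply: near_eq_cvg; apply: nearW => m; rewrite /= addnC.
have b0 : l1_le b B'.
  by have := bdist 0%N; rewrite expr0 mul1r; under eq_fun do rewrite subr0.
exists b, B'; split => // k; apply/eqP; rewrite -subr_eq0 opprD addrA -rnorm_eq0.
rewrite eq_le rnorm_ge0 andbT.
(* Since [y J.+1] is [a] plus the image of [y J], the residual of [b] is a difference of two
   iteration errors, each at most [q ^+ J * B']. *)
have main J : rnorm (b k - a k - l1_op b k) <= q ^+ J * (2 * B').
  have [BJ yJ] := yl1 J.
  have -> : b k - a k - l1_op b k = (b k - y J.+1 k) - l1_op (fun n => b n - y J n) k.
    by rewrite (l1_opB b0 yJ) /=; ring.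
  apply: le_trans (rnormB_le _ _) _.
  have h1 := l1_le_term k (bdist J.+1); have h2 := l1_le_term k (l1_op_le (bdist J)).
  have B'0 : 0 <= B' by exact: l1_le_ge0 b0.
  have : q * (q ^+ J * B') <= q ^+ J * B'.
    by apply: ler_piMl; [apply: mulr_ge0 => //; exact: exprn_ge0|exact: ltW].
  by move: h1; rewrite exprS -mulrA; lra.
have cv : q ^+ J * (2 * B') @[J --> \oo] --> (0 : R).
  have -> : (fun J => q ^+ J * (2 * B')) = geometric (2 * B') q.
    by apply/funext => J; rewrite /geometric /= mulrC.
  by apply: cvg_geometric; rewrite ger0_norm.
rewrite -(cvg_lim _ cv) //; apply: limr_ge; first exact: cvgP cv.
by apply: nearW => J; exact: main.
Qed.

End Neumann.
End Summable.

(** * Circle integrals of functions equal almost everywhere *)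

Section CircleIntegralAE.
Variable R : realType.
Local Notation C := R[i].
Local Notation mu := (@lebesgue_measure R).
Local Notation I2pi := (`[0, pi *+ 2]%classic : set R).

(** This form suits [boundary_value], whose values are uncontrolled where the radial limit fails to
    exist, so that measurability is not at hand. The endpoints 0 and [2 pi], about which the premise
    is silent, are added to the null set. *)
Lemma circle_integral_ae (f1 f2 : C -> C) :
  {ae mu, forall t, 0 < t < pi *+ 2 -> f1 (expi t) = f2 (expi t)} ->
  circle_integral f1 = circle_integral f2.
Proof.
move=> [N [mN N0 sN]].
pose N' := N `|` ([set 0] `|` [set pi *+ 2]).
have mN' : measurable N' by apply: measurableU => //; apply: measurableU.
have N'0 : mu N' = 0%E.
  have mS : measurable ([set 0] `|` [set pi *+ 2] : set R) by apply: measurableU.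
  have S0 : mu ([set 0] `|` [set pi *+ 2]) = 0%E.
    by rewrite null_set_setU //; exact: lebesgue_measure_set1.
  by rewrite null_set_setU.
have E t : I2pi t -> ~ N' t -> f1 (expi t) = f2 (expi t).
  rewrite /= in_itv /= => /andP[t0 t1] nN'; apply: contrapT => ne; apply: nN'.
  have [->|t0'] := eqVneq t 0; first by right; left.
  have [->|t1'] := eqVneq t (pi *+ 2); first by right; right.
  left; apply: sN => H; apply: ne; apply: H.
  by rewrite !lt_neqAle eq_sym t0' t1' t0 t1.
rewrite /circle_integral /Rintegral; congr (fine _ / _ +i* (fine _ / _)).
  by apply: (eq_integral_null mN' N'0) => t /E e /e ->.
by apply: (eq_integral_null mN' N'0) => t /E e /e ->.
Qed.

End CircleIntegralAE.

(** * The synthesis operator *)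

Section Synthesis.
Variable R : realType.
Local Notation C := R[i].
Local Notation mu := (@lebesgue_measure R).
Local Notation D := (@open_disk R).
Local Notation I2pi := (`[0, pi *+ 2]%classic : set R).
Variables (g : nat -> C -> C) (K : R).
Hypothesis gA : forall n, disk_algebra (g n).
Hypothesis gK : forall w, unit_circle w -> l1_le (fun k => g k w) K.

Let K0 : 0 <= K. Proof. exact: l1_le_ge0 (gK (expi_unit 0)). Qed.

Definition bdry_sum (c : nat -> C) (w : C) : C := limn (series (fun k => c k * g k w)).

Section BoundedCoefficients.
Variables (c : nat -> C) (B : R).
Hypothesis cB : forall k, rnorm (c k) <= B.

Let B0 : 0 <= B. Proof. by apply: le_trans (rnorm_ge0 _) (cB 0%N). Qed.

Lemma bdry_sum_l1 w : unit_circle w -> l1_le (fun k => c k * g k w) (B * K).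
Proof. by move=> w1; apply: l1_leM => //; exact: gK. Qed.

Lemma bdry_sum_cvg w : unit_circle w ->
  series (fun k => c k * g k w) @ \oo --> bdry_sum c w.
Proof. by move=> w1; exact: (l1_le_cvg (bdry_sum_l1 w1)). Qed.

Lemma bdry_sum_le w : unit_circle w -> rnorm (bdry_sum c w) <= B * K.
Proof. by move=> w1; exact: (l1_le_lim (bdry_sum_l1 w1)). Qed.

Lemma circle_meas_disk_algebra n : circle_meas (g n).
Proof. by apply: continuous_circle_meas; have [] := gA n. Qed.

Lemma partial_sum_meas N : circle_meas (fun w => series (fun k => c k * g k w) N).
Proof.
apply: (@cmeas_sum _ _ _ _ (fun k t => c k * g k (expi t))) => k.
by apply: cmeasM; [exact: cmeas_cst|exact: circle_meas_disk_algebra].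
Qed.

Lemma bdry_sum_meas : circle_meas (bdry_sum c).
Proof.
apply: (@cmeas_lim _ _ _ _ (fun N t => series (fun k => c k * g k (expi t)) N)) => //.
  exact: partial_sum_meas.
by move=> t _; apply: bdry_sum_cvg; exact: expi_unit.
Qed.

Lemma circle_integrableM_disk_algebra (f : C -> C) k : circle_integrable f ->
  circle_integrable (fun w => f w * g k w).
Proof.
move=> fi; have [gc _] := gA k; have [M gM] := closed_disk_bounded gc.
apply: (@cintegrableM _ _ _ mu I2pi (f \o @expi R) (g k \o @expi R) M) => //.
  exact: circle_meas_disk_algebra.
by move=> t _; apply: gM; exact/closed_disk_circle/expi_unit.
Qed.

Lemma partial_sum_integral (f : C -> C) N : circle_integrable f ->
  circle_integral (fun w => f w * series (fun k => c k * g k w) N) =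
  series (fun k => circle_integral (fun w => f w * g k w) * c k) N.
Proof.
move=> fi; rewrite /series /=.
rewrite (@eq_circle_integral _ _
  (fun w => \sum_(0 <= k < N) c k * (f w * g k w))); last first.
  by move=> w _; rewrite mulr_sumr; apply: eq_bigr => k _; rewrite mulrCA.
rewrite circle_integral_sum.
  apply: eq_bigr => k _; rewrite [RHS]mulrC.
  exact: (@circle_integralZ _ (c k) _ (circle_integrableM_disk_algebra k fi)).
by move=> k; exact: (@circle_integrableZ _ (c k) _ (circle_integrableM_disk_algebra k fi)).
Qed.

Lemma partial_sum_le w N : unit_circle w ->
  rnorm (series (fun k => c k * g k w) N) <= B * K.
Proof.
move=> w1; apply: le_trans (rnorm_sum _ _ _) _.
exact: (bdry_sum_l1 w1 N).
Qed.

(** Dominated convergence with majorant [B * K * rnorm (f w)]. With a kernel for [f] it gives the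
    Cauchy and Poisson representations; with [f] in L1, the moment formula and the weak* convergence
    of the series. *)
Lemma pairing_series (f : C -> C) : circle_integrable f ->
  series (fun k => circle_integral (fun w => f w * g k w) * c k) @ \oo -->
  circle_integral (fun w => f w * bdry_sum c w).
Proof.
move=> fi.
have -> : series (fun k => circle_integral (fun w => f w * g k w) * c k) =
    (fun N => circle_integral (fun w => f w * series (fun k => c k * g k w) N)).
  by apply/funext => N; rewrite partial_sum_integral.
apply: (@circle_integral_cvg _ _ _ (fun w => B * K * rnorm (f w))).
- move=> N; apply: cmeasM; first exact: (cintegrable_meas fi).
  exact: partial_sum_meas.
- move=> w w1; apply: cvgCM; first exact: cvg_cst.
  exact: bdry_sum_cvg.
- have ir : mu.-integrable I2pi (fun t => (rnorm (f (expi t)))%:E).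
    exact: (integrable_rnorm _ fi).
  have : mu.-integrable I2pi (fun t => (B * K)%:E * (rnorm (f (expi t)))%:E)%E.
    exact: integrableZl.
  by [].
- move=> N w w1; rewrite rnormM mulrC ler_wpM2r ?rnorm_ge0 //.
  exact: partial_sum_le.
Qed.

Lemma series_cauchy_integral z : D z -> series (fun k => c k * g k z) @ \oo -->
  circle_integral (fun w => bdry_sum c w * cauchy_kernel z w).
Proof.
move=> Dz.
have -> : series (fun k => c k * g k z) =
    series (fun k => circle_integral (fun w => cauchy_kernel z w * g k w) * c k).
  congr (series _); apply/funext => k; rewrite mulrC; congr (_ * _).
  rewrite -(cauchy_formula (gA k) Dz).
  by apply: eq_circle_integral => w _; rewrite mulrC.
rewrite (@eq_circle_integral _ _ (fun w => cauchy_kernel z w * bdry_sum c w)).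
  exact: (pairing_series (circle_integrable_cauchy_kernel Dz)).
by move=> w _; rewrite mulrC.
Qed.

Lemma circle_integrable_poisson_kernel z : D z ->
  circle_integrable (fun w => (poisson_kernel z w)%:C).
Proof.
move=> Dz; apply: (eq_circle_integrable _ (@poisson_integrable _ (fun=> 1) 1 _ _ _ Dz)).
- by move=> w _; rewrite mul1r.
- exact: cmeas_cst.
- by move=> w _; rewrite rnorm1.
Qed.

Lemma series_poisson_integral z : D z -> series (fun k => c k * g k z) @ \oo -->
  circle_integral (fun w => bdry_sum c w * (poisson_kernel z w)%:C).
Proof.
move=> Dz.
have -> : series (fun k => c k * g k z) =
    series (fun k => circle_integral (fun w => (poisson_kernel z w)%:C * g k w) * c k).
  congr (series _); apply/funext => k; rewrite mulrC; congr (_ * _).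
  rewrite -(poisson_formula (gA k) Dz).
  by apply: eq_circle_integral => w _; rewrite mulrC.
rewrite (@eq_circle_integral _ _ (fun w => (poisson_kernel z w)%:C * bdry_sum c w)).
  exact: (pairing_series (circle_integrable_poisson_kernel Dz)).
by move=> w _; rewrite mulrC.
Qed.

(** Defining the function by the Cauchy integral yields analyticity by differentiation under the
    integral, without locally uniform convergence of the series in the disk. *)
Definition synth_fun : C -> C :=
  (fun z => circle_integral (fun w => bdry_sum c w * cauchy_kernel z w)) \_ D.

Lemma synth_funE z : D z ->
  synth_fun z = circle_integral (fun w => bdry_sum c w * cauchy_kernel z w).
Proof. by move=> Dz; rewrite /synth_fun patchE mem_set. Qed.

(** Both integrals are limits of the same partial sums at [z]. *)
Lemma synth_fun_poisson z : D z ->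
  synth_fun z = circle_integral (fun w => bdry_sum c w * (poisson_kernel z w)%:C).
Proof.
move=> Dz; rewrite synth_funE //.
exact: cvgC_unique (series_cauchy_integral Dz) (series_poisson_integral Dz).
Qed.

Lemma synth_fun_le z : D z -> rnorm (synth_fun z) <= B * K.
Proof.
move=> Dz; rewrite synth_fun_poisson //.
by apply: poisson_bound => //; [exact: bdry_sum_meas|exact: bdry_sum_le].
Qed.

Lemma synth_fun_bounded_analytic : bounded_analytic synth_fun.
Proof.
split.
- by move=> z Dz; rewrite /synth_fun patchE memNset.
- move=> z Dz; have := cauchy_integral_derivable bdry_sum_meas bdry_sum_le Dz.
  apply: near_eq_derivable; have := open_disk_near Dz; apply: filterS => w Dw.
  by rewrite synth_funE.
- by exists (B * K) => z; exact: synth_fun_le.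
Qed.

Lemma synth_fun_radial : {ae mu, forall t, 0 < t < pi *+ 2 ->
  boundary_value synth_fun (expi t) = bdry_sum c (expi t)}.
Proof.
have := poisson_radial_ae bdry_sum_meas bdry_sum_le.
apply: filterS; first exact: (ae_filter_ringOfSetsType mu).
move=> t H /H {}H; rewrite /boundary_value; apply: cvgC_lim.
apply: cvg_trans H; apply: near_eq_cvg; near=> r.
have r1 : r < 1 by near: r; exact: nbhs_left_lt.
have r0 : 0 < r by near: r; exact: nbhs_left_gt.
rewrite synth_fun_poisson //.
by apply/open_diskP; rewrite rnormM rnorm_expi mulr1 rnorm_real ger0_norm // ltW.
Unshelve. all: by end_near. Qed.

End BoundedCoefficients.

Lemma linf_le (c : linf R) k : rnorm (c k) <= supnorm setT c.
Proof. by apply: supnorm_ub => //; exact: linf_bounded. Qed.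

Lemma synth_subproof (c : linf R) : synth_fun c \in @Hinf_pred R.
Proof. by apply/asboolP; exact: (synth_fun_bounded_analytic (linf_le c)). Qed.

Definition synth (c : linf R) : Hinf R := MkHinf (synth_subproof c).

Lemma Hinf_ext (h h' : Hinf R) : (forall z, D z -> h z = h' z) -> h = h'.
Proof.
move=> hh'; apply/val_inj/funext => z /=.
have [Dz|Dz] := pselect (D z); first exact: hh'.
by have /asboolP[-> //] := HinfP h; have /asboolP[-> //] := HinfP h'.
Qed.

Lemma synth_linear : linear synth.
Proof.
move=> l c d; apply: Hinf_ext => z Dz.
rewrite -[RHS]/(l * synth_fun c z + synth_fun d z) -[LHS]/(synth_fun (l *: c + d) z).
have H1 := series_cauchy_integral (linf_le c) Dz.
have H2 := series_cauchy_integral (linf_le d) Dz.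
have := series_cauchy_integral (linf_le (l *: c + d)) Dz.
rewrite -!synth_funE // in H1 H2 * => H3.
apply: cvgC_unique H3 _.
have -> : series (fun k => (l *: c + d : linf R) k * g k z) =
   (fun N => l * series (fun k => c k * g k z) N + series (fun k => d k * g k z) N).
  apply/funext => N; rewrite /series /= mulr_sumr -big_split /=.
  apply: eq_bigr => k _; rewrite [LHS](_ : _ = (l * c k + d k) * g k z) //.
  by ring.
by apply: cvgCD; [apply: cvgCM; [exact: cvg_cst|exact: H1]|exact: H2].
Qed.

Lemma synth_pairing (c : linf R) (f : L1_circle R) :
  Hinf_pairing (synth c) f = circle_integral (fun w => sval f w * bdry_sum c w).
Proof.
apply: circle_integral_ae; have := synth_fun_radial (linf_le c).
apply: filterS; first exact: (ae_filter_ringOfSetsType mu).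
by move=> t H /H <-.
Qed.

End Synthesis.

(** * Weak* topologies *)

Section WeakStarConvergence.
Variable R : realType.
Local Notation C := R[i].

(** Applied twice, to the pairing map and to each coordinate of the pointwise topology, this reduces
    weak* convergence to the convergence of every single pairing. *)
Lemma cvg_initial_topology (S : choiceType) (U : topologicalType) (p : S -> U)
    (T : Type) (F : set_system T) (FF : Filter F) (f : T -> S) (s : S) :
  (fun x => p (f x)) @ F --> p s ->
  (f : T -> initial_topology p) @ F --> (s : initial_topology p).
Proof.
move=> H A [B [[W oW <-] /= Ws WB]].
have : nbhs (p s) W by apply: open_nbhs_nbhs.
move=> nW; have HW : F [set x | W (p (f x))] := H W nW.
by apply: (@filterS _ F FF _ _ _ HW) => x; exact: (WB (f x)).
Qed.

Lemma cvg_ptws_eval (I : Type) (V : topologicalType) (F : set_system (I -> V))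
    (FF : Filter F) (f : I -> V) (i : I) :
  F --> (f : {ptws I -> V}) -> (fun g : I -> V => g i) @ F --> f i.
Proof.
move=> /cvg_sup/(_ i) Fi A nA; apply: Fi.
exact: (@initial_continuous (I -> V) V (fun g => g i) f A nA).
Qed.

Lemma cvg_linf_wstar (T : Type) (F : set_system T) (FF : Filter F)
    (f : T -> linf R) (c : linf R) :
  (forall a, linf_pairing (f x) a @[x --> F] --> linf_pairing c a) ->
  (f : T -> linf_wstar R) @ F --> (c : linf_wstar R).
Proof.
move=> H; apply: (@cvg_initial_topology _ {ptws ell1 R -> C} (@linf_pairing R)).
by apply/cvg_sup => a; apply: cvg_initial_topology; exact: H.
Qed.

Lemma cvg_Hinf_wstar (T : Type) (F : set_system T) (FF : Filter F)
    (f : T -> Hinf R) (h : Hinf R) :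
  (forall a, Hinf_pairing (f x) a @[x --> F] --> Hinf_pairing h a) ->
  (f : T -> Hinf_wstar R) @ F --> (h : Hinf_wstar R).
Proof.
move=> H; apply: (@cvg_initial_topology _ {ptws L1_circle R -> C} (@Hinf_pairing R)).
by apply/cvg_sup => a; apply: cvg_initial_topology; exact: H.
Qed.

Lemma linf_pairing_continuous (a : ell1 R) :
  continuous (fun c : linf_wstar R => linf_pairing c a).
Proof.
move=> c; have : (@linf_pairing R : linf_wstar R -> {ptws ell1 R -> C}) @ c -->
    (linf_pairing c : {ptws ell1 R -> C}).
  exact: (@initial_continuous (linf R) {ptws ell1 R -> C} (@linf_pairing R) c).
by move=> cc; exact: (@cvg_ptws_eval _ _ _ (fmap_filter _ (nbhs_filter c)) _ a cc).
Qed.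

Lemma Hinf_pairing_continuous (f : L1_circle R) :
  continuous (fun h : Hinf_wstar R => Hinf_pairing h f).
Proof.
move=> h; have : (@Hinf_pairing R : Hinf_wstar R -> {ptws L1_circle R -> C}) @ h -->
    (Hinf_pairing h : {ptws L1_circle R -> C}).
  exact: (@initial_continuous (Hinf R) {ptws L1_circle R -> C} (@Hinf_pairing R) h).
by move=> cc; exact: (@cvg_ptws_eval _ _ _ (fmap_filter _ (nbhs_filter h)) _ f cc).
Qed.

Lemma lipschitz_within_continuous (V W : normedModType C) (A : set V) (f : V -> W)
    (k : R) : (forall x y, A x -> A y -> rnorm (f x - f y) <= k * rnorm (x - y)) ->
  {within A, continuous f}.
Proof.
move=> Af; apply/subspace_continuousP => x Ax.
apply/(@cvgrPdist_lt _ W _ _ (within_filter A (nbhs_filter x))) => -[e e'].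
rewrite ltcE /= => /andP[/eqP -> e0].
have d0 : 0 < e / (`|k| + 1) by rewrite divr_gt0 // ltr_wpDl.
have := @cvgr_dist_lt _ V _ (nbhs x) (nbhs_filter x) id x (@cvg_id _ (nbhs x)).
move=> /(_ (e / (`|k| + 1))%:C); rewrite ltcR => /(_ d0).
apply: filterS => y; rewrite !rnormE !ltcR => xy Ay.
apply: le_lt_trans (Af _ _ Ax Ay) _.
have k1 : 0 < `|k| + 1 by rewrite ltr_wpDl.
apply: (@le_lt_trans _ _ ((`|k| + 1) * rnorm (x - y))).
  by rewrite ler_wpM2r ?rnorm_ge0 //; have := ler_norm k; lra.
by rewrite mulrC -ltr_pdivlMr.
Qed.

Lemma lipschitz_continuous (V W : normedModType C) (f : V -> W)
    (k : R) : (forall x y, rnorm (f x - f y) <= k * rnorm (x - y)) -> continuous f.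
Proof.
move=> H; apply/continuous_subspace_setT; apply: lipschitz_within_continuous => x y _ _.
exact: H.
Qed.

Lemma rnorm_linf (c : linf R) : rnorm c = supnorm setT c.
Proof. by []. Qed.

Lemma rnorm_Hinf (h : Hinf R) : rnorm h = supnorm (@open_disk R) h.
Proof. by []. Qed.

End WeakStarConvergence.

(** * Moments, weak* continuity and the norm bound of the synthesis operator *)

Section SynthesisContinuity.
Variable R : realType.
Local Notation C := R[i].
Local Notation mu := (@lebesgue_measure R).
Local Notation D := (@open_disk R).
Local Notation I2pi := (`[0, pi *+ 2]%classic : set R).
Variables (g : nat -> C -> C) (K : R).
Hypothesis gA : forall n, disk_algebra (g n).
Hypothesis gK : forall w, unit_circle w -> l1_le (fun k => g k w) K.

(* Choosing unimodular coefficients aligned with the moments reduces the l1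
   bound to the bound of a single integral. *)
Lemma moments_l1 (f : C -> C) : circle_integrable f ->
  exists B, l1_le (fun k => circle_integral (fun w => f w * g k w)) B.
Proof.
move=> fi; pose m k := circle_integral (fun w => f w * g k w).
exists ((pi *+ 2)^-1 * \int[mu]_(t in I2pi) (K * rnorm (f (expi t)))) => N.
(* Where [m k = 0] the inverse of 0 is 0, so [c k = 0], which satisfies both claims below. *)
pose c k := conjc (m k) / (rnorm (m k))%:C.
have c1 k : rnorm (c k) <= 1.
  rewrite rnormM rnorm_conj rnormV rnorm_real ger0_norm ?rnorm_ge0 //.
  have [->|m0] := eqVneq (rnorm (m k)) 0; first by rewrite mul0r.
  by rewrite divff.
have mc k : m k * c k = (rnorm (m k))%:C.
  rewrite mulrA mulc_conj expr2 realcM.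
  have [->|m0] := eqVneq (rnorm (m k)) 0; first by rewrite (_ : 0%:C = 0 :> C) // !mul0r.
  by rewrite mulfK // (inj_eq (@complexI R) _ 0).
have E : (\sum_(0 <= k < N) rnorm (m k))%:C =
    circle_integral (fun w => f w * series (fun k => c k * g k w) N).
  rewrite (partial_sum_integral gA c N fi) rmorph_sum /series /=.
  by apply: eq_bigr => k _; rewrite -mc.
have s0 : 0 <= \sum_(0 <= k < N) rnorm (m k).
  by apply: sumr_ge0 => k _; exact: rnorm_ge0.
rewrite -(ger0_norm s0) -rnorm_real E.
have ir : mu.-integrable I2pi (fun t => (rnorm (f (expi t)))%:E).
  exact: (integrable_rnorm _ fi).
have iK : mu.-integrable I2pi (fun t => K%:E * (rnorm (f (expi t)))%:E)%E.
  exact: integrableZl.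
have le w : unit_circle w -> rnorm (f w * series (fun k => c k * g k w) N) <= K * rnorm (f w).
  move=> w1; rewrite rnormM mulrC ler_wpM2r ?rnorm_ge0 //.
  by have := partial_sum_le gK c1 N w1; rewrite mul1r.
apply: (@le_rnorm_circle_integral _ _ (fun w => K * rnorm (f w))) => //.
apply: (@cintegrable_dom _ _ _ mu I2pi _ (fun t => K * rnorm (f (expi t)))) => //.
  by apply: cmeasM; [exact: (cintegrable_meas fi)|exact: partial_sum_meas].
by move=> t _; apply: le; exact: expi_unit.
Qed.

Lemma moments_summable (f : L1_circle R) :
  cvgn (series (fun k => rnorm (circle_integral (fun w => sval f w * g k w)))).
Proof.
have [B mB] := moments_l1 (svalP f).
by apply: nonneg_series_cvg mB => k; exact: rnorm_ge0.
Qed.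

(** The preadjoint of [synth]: pairing [synth c] with [f] is pairing [c] with these moments, so
    weak* continuity is immediate. *)
Definition moments (f : L1_circle R) : ell1 R :=
  exist (fun a : nat -> C => cvgn (series (fun n => rnorm (a n)))) _
    (@moments_summable f).

Lemma synth_pairing_moments (c : linf R) (f : L1_circle R) :
  Hinf_pairing (synth gA gK c) f = linf_pairing c (moments f).
Proof.
rewrite synth_pairing; apply/esym/cvgC_lim.
exact: (pairing_series gA gK (linf_le c) (svalP f)).
Qed.

Lemma synth_wstar_continuous :
  continuous (synth gA gK : linf_wstar R -> Hinf_wstar R).
Proof.
move=> c; apply: (cvg_Hinf_wstar (nbhs_filter (c : linf_wstar R))) => f.
under eq_fun do rewrite synth_pairing_moments.
by rewrite synth_pairing_moments; exact: linf_pairing_continuous.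
Qed.

Lemma toHinf_boundary_value n w : unit_circle w ->
  g n (r%:C * w) @[r --> (1 : R)^'-] --> g n w.
Proof.
move=> w1; have [gc _] := gA n.
have H : (fun r : R => r%:C * w) @ (1 : R)^'- --> within (@closed_disk R) (nbhs w).
  move=> P nP; have : \forall r \near (1 : R)^'-, closed_disk (r%:C * w) -> P (r%:C * w).
    have : (fun r : R => r%:C * w) @ (1 : R)^'- --> w.
      rewrite -[X in _ --> X]mul1r; apply: cvgCM; last exact: cvg_cst.
      by apply: cvgC_real; apply: cvg_at_left_filter; exact: cvg_id.
    by move=> cv; exact: (cv _ nP).
  move=> Pr; suff : \forall r \near (1 : R)^'-, P (r%:C * w) by [].
  near=> r; have : closed_disk (r%:C * w) -> P (r%:C * w) by near: r.
  apply; apply/closed_diskP; rewrite rnormM (rnorm_unit_circle w1) mulr1 rnorm_real.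
  have r1 : r < 1 by near: r; exact: nbhs_left_lt.
  have r0 : 0 < r by near: r; exact: nbhs_left_gt.
  by rewrite ger0_norm // ltW.
by apply: cvg_comp H _; have /within_closed_diskP := gc; apply; exact: closed_disk_circle.
Unshelve. all: by end_near. Qed.

Lemma series_toHinfE (c : nat -> C) N z : D z ->
  (series (fun n => c n *: toHinf (gA n)) N : Hinf R) z = series (fun n => c n * g n z) N.
Proof.
move=> Dz; rewrite /series /=; elim: N => [|N IH]; first by rewrite !big_geq.
rewrite !big_nat_recr //= -IH -[LHS]/(_ + c N * (g N \_ D) z).
by rewrite patchE mem_set.
Qed.

Lemma series_toHinf_pairing (c : linf R) (f : L1_circle R) N :
  Hinf_pairing (series (fun n => c n *: toHinf (gA n)) N) f =
  series (fun k => circle_integral (fun w => sval f w * g k w) * c k) N.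
Proof.
rewrite -(partial_sum_integral gA c N (svalP f)); apply: eq_circle_integral => w w1.
congr (_ * _); rewrite /boundary_value; apply: cvgC_lim.
have H : series (fun n => c n * g n (r%:C * w)) N @[r --> (1 : R)^'-] -->
    series (fun n => c n * g n w) N.
  apply: (@cvgC_sum _ _ _ _ (fun n r => c n * g n (r%:C * w))) => n.
  by apply: cvgCM; [exact: cvg_cst|exact: toHinf_boundary_value].
apply: cvg_trans H; apply: near_eq_cvg; near=> r.
rewrite series_toHinfE //; apply/open_diskP.
rewrite rnormM (rnorm_unit_circle w1) mulr1 rnorm_real.
have r1 : r < 1 by near: r; exact: nbhs_left_lt.
have r0 : 0 < r by near: r; exact: nbhs_left_gt.
by rewrite ger0_norm // ltW.
Unshelve. all: by end_near. Qed.

Lemma synth_series_wstar (c : linf R) :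
  (series (fun n => c n *: toHinf (gA n)) : nat -> Hinf_wstar R) @ \oo -->
  (synth gA gK c : Hinf_wstar R).
Proof.
apply: cvg_Hinf_wstar => f.
under eq_fun do rewrite series_toHinf_pairing.
rewrite synth_pairing; exact: (pairing_series gA gK (linf_le c) (svalP f)).
Qed.

Lemma synth_norm_le (c : linf R) : rnorm (synth gA gK c) <= K * rnorm c.
Proof.
rewrite rnorm_Hinf rnorm_linf mulrC; apply: supnorm_le; first exact: open_disk_neq0.
by move=> z Dz; exact: (synth_fun_le gA gK (linf_le c)).
Qed.

Lemma synthB (c d : linf R) : synth gA gK (c - d) = synth gA gK c - synth gA gK d.
Proof.
rewrite -[c - d]addrC -scaleN1r synth_linear scaleN1r addrC //.
Qed.

Lemma synth_norm_continuous : continuous (synth gA gK).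
Proof.
apply: (@lipschitz_continuous _ _ _ _ K) => c d.
by rewrite -synthB; exact: synth_norm_le.
Qed.

End SynthesisContinuity.

(** * Bumps at peak points *)

Section Bump.
Variable R : realType.
Local Notation C := R[i].
Local Notation mu := (@lebesgue_measure R).
Local Notation I2pi := (`[0, pi *+ 2]%classic : set R).

Lemma ae_exists_itv (u v : R) (P : R -> Prop) : u < v -> {ae mu, forall t, P t} ->
  exists2 t, u < t < v & P t.
Proof.
move=> uv [N [mN N0 sN]]; apply: contrapT => H.
have sub : `]u, v[%classic `<=` N.
  move=> t tuv; apply: sN => Pt; by apply: H; exists t.
have : (mu `]u, v[%classic <= mu N)%E by apply: le_measure; rewrite ?inE.
rewrite N0 leNgt => /negP; apply.
by rewrite /= lebesgue_measure_itv /= lte_fin uv -EFinB lte_fin subr_gt0.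
Qed.

Section BumpAt.
Variables (phi : C -> C) (eta t0 : R).
Hypothesis phi_cts : {within @closed_disk R, continuous phi}.
Hypothesis eta_gt0 : 0 < eta.
Hypothesis t0_ge0 : 0 <= t0.
Hypothesis t0_lt : t0 < pi *+ 2.
Hypothesis phi1 : phi (expi t0) = 1.

(** The interval is taken to the right of [t0], so that it fits in the period even when [t0 = 0]. *)
Lemma near_one_itv : exists rho, [/\ 0 < rho, t0 + rho <= pi *+ 2 &
  forall t, t0 <= t <= t0 + rho -> rnorm (phi (expi t) - 1) <= eta].
Proof.
have c1 : (fun t => phi (expi t)) @ t0 --> (1 : C).
  rewrite -phi1 -(retract_id (closed_disk_circle (expi_unit t0))).
  have -> : (fun t => phi (expi t)) = (fun t => (phi \o @retract R) (expi t)).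
    by apply/funext => t /=; rewrite retract_id //; exact/closed_disk_circle/expi_unit.
  apply: (cvgC_comp (nbhs_filter t0)); last exact: expi_continuous.
  exact: retract_comp_continuous.
have /(cvgC_distP (nbhs_filter t0))/(_ _ eta_gt0) /nbhs_ballP[r /= r0 H] := c1.
have p0 : 0 < pi *+ 2 - t0 by rewrite subr_gt0.
exists (Num.min (r / 2) (pi *+ 2 - t0)); split.
- by rewrite lt_min divr_gt0.
- by rewrite -lerBrDl ge_min lexx orbT.
move=> t /andP[t1]; rewrite -lerBlDl le_min => /andP[t2 _].
rewrite rnorm_distC; apply: ltW; apply: H; rewrite -ball_normE /= distrC ger0_norm; lra.
Qed.

Let near_one (w : C) := rnorm (phi w - 1) <= eta.

(** The density is carried by the whole set where [phi] is close to 1, so that its support condition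
    is the estimate itself; the interval of [near_one_itv] only shows that this set has positive
    measure. *)
Lemma bump_exists : exists p : C -> R,
  [/\ forall w, 0 <= p w, forall w, p w != 0 -> rnorm (phi w - 1) <= eta,
      mu.-integrable I2pi (fun t => (p (expi t))%:E)
    & \int[mu]_(t in I2pi) p (expi t) = pi *+ 2].
Proof.
pose E := I2pi `&` [set t | near_one (expi t)].
have mE : measurable E.
  have mq : measurable_fun I2pi (fun t => rnorm (phi (expi t) - 1)).
    apply: cmeas_rnorm => //.
    apply: (@cmeasD _ _ _ _ (fun t => phi (expi t)) (fun=> -1)).
      exact: continuous_circle_meas.
    exact: cmeas_cst.
  rewrite (_ : E = I2pi `&` (fun t => rnorm (phi (expi t) - 1)) @^-1` `]-oo, eta]).
    by apply: mq.
  by rewrite /E; congr setI; apply/seteqP; split => t; rewrite /= in_itv.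
have Efin : (mu E < +oo)%E.
  by apply: le_lt_trans (mu_I2pi_lty R); apply: le_measure; rewrite ?inE //; exact: subIsetl.
have [rho [rho0 rho2 Hrho]] := near_one_itv.
have Epos : 0 < fine (mu E).
  apply: (@lt_le_trans _ _ (fine (mu `[t0, t0 + rho]%classic))).
    by rewrite fine_mu_itv ?lerDl ?(ltW rho0) //; lra.
  apply: fine_le; rewrite ?ge0_fin_numE //.
    by rewrite /= lebesgue_measure_itv /=; case: ifP => // _; rewrite -EFinB ltry.
  apply: le_measure; rewrite ?inE // => t; rewrite /= in_itv /= => /andP[t1 t2].
  split; last by apply: Hrho; rewrite t1 t2.
  by rewrite /= in_itv /= (le_trans t0_ge0 t1) (le_trans t2 rho2).
(* The normalized measure is [dt / (2 pi)], so a total integral of [2 pi] means mass 1. *)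
pose kappa := pi *+ 2 / fine (mu E).
have k0 : 0 <= kappa by apply: divr_ge0; [rewrite mulrn_wge0 // pi_ge0 | exact: ltW].
have pE t : I2pi t -> kappa * (near_one (expi t))%:R = kappa * \1_E t.
  by move=> tI; rewrite indicE /E; congr (_ * (nat_of_bool _)%:R);
    apply/idP/idP => [h|]; [rewrite inE|rewrite inE => -[]].
have i1 : mu.-integrable I2pi (EFin \o (\1_E : R -> R)).
  apply: (@bounded_integrable _ _ _ 1) => //; first exact: mu_I2pi_lty.
  by move=> t _; rewrite ger0_norm // indicE; case: (_ \in _).
exists (fun w => kappa * (near_one w)%:R); split.
- by move=> w; rewrite mulr_ge0.
- by move=> w; rewrite mulf_eq0 negb_or => /andP[_]; rewrite pnatr_eq0 eqb0 negbK.
- have : mu.-integrable I2pi (fun t => kappa%:E * (\1_E t)%:E)%E by exact: integrableZl.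
  apply: eq_integrable => // t; rewrite inE => tI; rewrite -EFinM; congr EFin.
  exact/esym/pE.
under eq_Rintegral => t do [rewrite inE => tI; rewrite pE //].
rewrite RintegralZl // /Rintegral integral_indic // setIC.
rewrite (_ : I2pi `&` E = E) ?divfK ?gt_eqF //.
by rewrite /E setIA setIid.
Qed.

End BumpAt.

(* Integration against a probability density carried by a set [A] sees only
   the values on [A]. *)
Lemma bump_bound (p : C -> R) (A : set C) (h : C -> C) (c : R) :
  (forall w, 0 <= p w) -> (forall w, p w != 0 -> A w) ->
  mu.-integrable I2pi (fun t => (p (expi t))%:E) ->
  \int[mu]_(t in I2pi) p (expi t) = pi *+ 2 ->
  circle_meas h -> (forall w, unit_circle w -> A w -> rnorm (h w) <= c) ->
  circle_integrable (fun w => (p w)%:C * h w) /\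
  rnorm (circle_integral (fun w => (p w)%:C * h w)) <= c.
Proof.
move=> p0 pA ip p1 mh hc.
have ic : mu.-integrable I2pi (fun t => c%:E * (p (expi t))%:E)%E by exact: integrableZl.
have bd w : unit_circle w -> rnorm ((p w)%:C * h w) <= c * p w.
  move=> w1; rewrite rnormM rnorm_real ger0_norm //.
  have [->|pw] := eqVneq (p w) 0; first by rewrite mul0r mulr0.
  by rewrite mulrC ler_wpM2r //; apply: hc => //; exact: pA.
have ii : circle_integrable (fun w => (p w)%:C * h w).
  apply: (@cintegrable_dom _ _ _ mu I2pi _ (fun t => c * p (expi t))) => //.
    apply: cmeasM => //; split; first by have /integrableP[/measurable_EFinP] := ip.
    exact: measurable_cst.
  by move=> t _; apply: bd; exact: expi_unit.
split=> //.
apply: le_trans (@le_rnorm_circle_integral _ _ (fun w => c * p w) ii ic bd) _.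
by rewrite RintegralZl // p1 mulrCA mulVf ?mulr1 // gt_eqF // pi2_gt0.
Qed.

End Bump.

(** * Peaking families: injectivity and the inverse *)

Section Peaking.
Variable R : realType.
Local Notation C := R[i].
Local Notation mu := (@lebesgue_measure R).
Local Notation D := (@open_disk R).
Local Notation I2pi := (`[0, pi *+ 2]%classic : set R).
Variables (G : nat -> set C) (g : nat -> C -> C) (tau : nat -> R).
Variables (delta : nat -> R) (S eps : R).
Hypothesis G_disj : forall m n w, m <> n -> G m w -> G n w -> False.
Hypothesis gA : forall n, disk_algebra (g n).
Hypothesis g_le1 : forall n w, unit_circle w -> rnorm (g n w) <= 1.
Hypothesis g_off : forall n w, unit_circle w -> ~ G n w -> rnorm (g n w) <= delta n.
Hypothesis delta_ge0 : forall n, 0 <= delta n.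
Hypothesis delta_sum : forall N, \sum_(0 <= n < N) delta n <= S.
Hypothesis S_eps : S < eps.
Hypothesis eps1 : eps < 1.
Hypothesis tau_ge0 : forall n, 0 <= tau n.
Hypothesis tau_lt : forall n, tau n < pi *+ 2.
Hypothesis g_tau : forall n, g n (expi (tau n)) = 1.

Let delta_le n : delta n <= S.
Proof.
apply: le_trans (delta_sum n.+1); rewrite big_nat_recr //= lerDr.
by apply: sumr_ge0 => i _; exact: delta_ge0.
Qed.

Lemma sum_kronecker_le (N n : nat) (e : R) : 0 <= e ->
  \sum_(0 <= k < N) (k == n)%:R * e <= e.
Proof.
move=> e0; have [nN|nN] := ltnP n N; last first.
  rewrite big_nat_cond big1 // => k /andP[/andP[_ kN] _].
  by rewrite (ltn_eqF (leq_trans kN nN)) mul0r.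
rewrite (bigD1_seq n) ?mem_index_iota ?iota_uniq //= eqxx mul1r big1 ?addr0 //.
by move=> k /negbTE ->; rewrite mul0r.
Qed.

Lemma peak_l1 w : unit_circle w -> l1_le (fun k => g k w) (1 + eps).
Proof.
move=> w1 N.
(* Disjointness allows at most one arc through [w]. If there is none, 0 is a harmless choice, since
   the term of index [n] is only bounded by 1. *)
have [n Hn] : exists n, forall k, k <> n -> ~ G k w.
  have [[n Gn]|H] := pselect (exists n, G n w).
    by exists n => k kn Gk; exact: G_disj kn Gk Gn.
  by exists 0%N => k _ Gk; apply: H; exists k.
apply: (@le_trans _ _ (\sum_(0 <= k < N) (delta k + (k == n)%:R * 1))).
  apply: ler_sum => k _; rewrite mulr1; have [->|kn] := eqVneq k n.
    by apply: le_trans (g_le1 n w1) _; rewrite lerDr.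
  by rewrite addr0; apply: g_off => //; apply: Hn; exact/eqP.
rewrite big_split /= addrC lerD //; first exact: sum_kronecker_le.
exact: le_trans (delta_sum N) (ltW S_eps).
Qed.

(** The first bound lets [S + eta] fit below [eps]. The second makes [1 - eta] exceed [eps], so that
    closeness of [g n] to 1 is impossible where [|g n| <= delta n], that is, off the arc. *)
Let eta := Num.min (eps - S) ((1 - eps) / 2).

Let eta_gt0 : 0 < eta.
Proof. by rewrite lt_min subr_gt0 S_eps divr_gt0 // subr_gt0. Qed.

Let eta_le : S + eta <= eps.
Proof. by rewrite -lerBrDl ge_min lexx. Qed.

Let peak n : set C := [set w | rnorm (g n w - 1) <= eta].

Lemma peak_sub n w : unit_circle w -> peak n w -> G n w.
Proof.
move=> w1 pw; apply: contrapT => nG; have := g_off w1 nG.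
have e1 : eta <= (1 - eps) / 2 by rewrite ge_min lexx orbT.
have := rnorm_lerB 1 (g n w); rewrite rnorm1 rnorm_distC.
have := delta_le n; move: pw; rewrite /peak /=.
by have := eps1; have := S_eps; lra.
Qed.

(** On the [n]-th peak all other arcs are missed, so the sequence of values [g k w] is l1-close to
    the [n]-th unit vector. *)
Lemma peak_kronecker n k w : unit_circle w -> peak n w ->
  rnorm ((k == n)%:R - g k w) <= delta k + (k == n)%:R * eta.
Proof.
move=> w1 pw; have [->|kn] := eqVneq k n.
  by rewrite rnorm_distC mul1r; apply: le_trans pw _; rewrite lerDr.
rewrite sub0r rnormN mul0r addr0; apply: g_off => // Gk.
by apply: (G_disj _ Gk (peak_sub w1 pw)); exact/eqP.
Qed.

Lemma kronecker_bound_sum n N :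
  \sum_(0 <= k < N) (delta k + (k == n)%:R * eta) <= eps.
Proof.
rewrite big_split /=; apply: le_trans eta_le; apply: lerD; first exact: delta_sum.
by apply: sum_kronecker_le; exact: ltW.
Qed.

Lemma series_kronecker (b : nat -> C) n :
  series (fun k => (k == n)%:R * b k) @ \oo --> b n.
Proof.
apply: cvg_near_cst; exists n.+1 => // N /= nN.
rewrite /series /= (bigD1_seq n) ?mem_index_iota ?iota_uniq //= eqxx mul1r big1 ?addr0 //.
by move=> k /negbTE ->; rewrite mul0r.
Qed.

Notation T := (synth gA peak_l1).

Lemma bdry_sum_peak (c : linf R) n w : unit_circle w -> peak n w ->
  rnorm (c n - bdry_sum g c w) <= eps * supnorm setT c.
Proof.
move=> w1 pw.
have l1 : l1_le (fun k => (k == n)%:R - g k w) eps.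
  move=> N; apply: le_trans (kronecker_bound_sum n N).
  by apply: ler_sum => k _; exact: peak_kronecker.
have H := l1_leM (linf_le c) l1; rewrite mulrC.
have -> : c n - bdry_sum g c w = limn (series (fun k => c k * ((k == n)%:R - g k w))).
  apply/esym/cvgC_lim.
  have -> : series (fun k => c k * ((k == n)%:R - g k w)) =
     (fun N => series (fun k => (k == n)%:R * c k) N - series (fun k => c k * g k w) N).
    apply/funext => N; rewrite /series /= -sumrB; apply: eq_bigr => k _.
    by rewrite mulrBr mulrC.
  apply: cvgCB; first exact: series_kronecker.
  exact: (bdry_sum_cvg peak_l1 (linf_le c) w1).
exact: l1_le_lim H.
Qed.

(** The radial limit is known almost everywhere and perhaps not at the peak point; the comparison
    with [c n] is made at a good point of an interval on which [g n] stays within [eta] of 1. *)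
Lemma synth_norm_ge (c : linf R) : (1 - eps) * rnorm c <= rnorm (T c).
Proof.
suff H n : rnorm (c n) <= rnorm (T c) + eps * rnorm c.
  have : rnorm c <= rnorm (T c) + eps * rnorm c.
    by rewrite {1}rnorm_linf; apply: supnorm_le => //; exists 0%N.
  by lra.
have [gc _] := gA n.
have [rho [rho0 rho2 Hrho]] := near_one_itv gc eta_gt0 (tau_lt n) (g_tau n).
have := poisson_radial_ae (bdry_sum_meas gA peak_l1 (linf_le c)) (bdry_sum_le peak_l1 (linf_le c)).
have tr : tau n < tau n + rho by rewrite ltrDl.
move=> /(ae_exists_itv tr)[t /andP[t1 t2] Ht].
have t02 : 0 < t < pi *+ 2.
  by rewrite (le_lt_trans (tau_ge0 n) t1) (lt_le_trans t2 rho2).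
have pt : peak n (expi t) by apply: Hrho; rewrite !ltW.
have {}Ht := Ht t02.
have ub : rnorm (bdry_sum g c (expi t)) <= rnorm (T c).
  have cv := rnorm_cvg (at_left_proper_filter (1 : R)) Ht; rewrite -(cvg_lim _ cv) //.
  apply: limr_le; first exact: cvgP cv.
  near=> r.
  have r1 : r < 1 by near: r; exact: nbhs_left_lt.
  have r0 : 0 < r by near: r; exact: nbhs_left_gt.
  have Dr : D (r%:C * expi t).
    by apply/open_diskP; rewrite rnormM rnorm_expi mulr1 rnorm_real ger0_norm // ltW.
  rewrite -(synth_fun_poisson gA peak_l1 (linf_le c) Dr).
  by apply: (@supnorm_ub _ _ D (T c)) => //; exact: Hinf_bounded.
have := bdry_sum_peak c (expi_unit t) pt; rewrite -rnorm_linf.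
have := rnorm_lerB (c n) (bdry_sum g c (expi t)); lra.
Unshelve. all: by end_near. Qed.

Lemma bumps_exist : exists p : nat -> C -> R, forall n,
  [/\ forall w, 0 <= p n w, forall w, p n w != 0 -> peak n w,
      mu.-integrable I2pi (fun t => (p n (expi t))%:E)
    & \int[mu]_(t in I2pi) p n (expi t) = pi *+ 2].
Proof.
have /choice[p Hp] : forall n, exists p : C -> R, [/\ forall w, 0 <= p w,
    forall w, p w != 0 -> peak n w, mu.-integrable I2pi (fun t => (p (expi t))%:E)
    & \int[mu]_(t in I2pi) p (expi t) = pi *+ 2].
  move=> n; have [gc _] := gA n.
  exact: (bump_exists gc eta_gt0 (tau_ge0 n) (tau_lt n) (g_tau n)).
by exists p.
Qed.

(* The matrix [int p_n g_k] is within [eps] of the identity, hence invertible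
   on l1 by a Neumann series, so every element of l1 is the moment sequence of
   a combination of bumps. *)
Lemma moments_onto (a : nat -> C) (B : R) : l1_le a B ->
  exists2 f : C -> C, circle_integrable f &
    forall k, circle_integral (fun w => f w * g k w) = a k.
Proof.
move=> aB; have [p Hp] := bumps_exist.
have p0 n w : 0 <= p n w by have [+ _ _ _] := Hp n; apply.
have pP n w : p n w != 0 -> peak n w by have [_ + _ _] := Hp n; apply.
have ip n : mu.-integrable I2pi (fun t => (p n (expi t))%:E) by have [] := Hp n.
have p1 n : \int[mu]_(t in I2pi) p n (expi t) = pi *+ 2 by have [] := Hp n.
have mg k : circle_meas (g k) by exact: circle_meas_disk_algebra.
have bb n h c : circle_meas h -> (forall w, unit_circle w -> peak n w -> rnorm (h w) <= c) ->
    circle_integrable (fun w => (p n w)%:C * h w) /\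
    rnorm (circle_integral (fun w => (p n w)%:C * h w)) <= c.
  exact: (bump_bound (p0 n) (@pP n) (ip n) (p1 n)).
pose M k n := circle_integral (fun w => (p n w)%:C * g k w).
pose E k n := circle_integral (fun w => (p n w)%:C * ((k == n)%:R - g k w)).
have pC n : circle_integrable (fun w => (p n w)%:C * 1).
  by apply: (bb n _ 1 (cmeas_cst _ 1) _).1 => w _ _; rewrite rnorm1.
have pg n k : circle_integrable (fun w => (p n w)%:C * g k w).
  by apply: (bb n _ 1 (mg k) _).1 => w w1 _; exact: g_le1.
have pint n : circle_integral (fun w => (p n w)%:C * 1) = 1.
  rewrite (@eq_circle_integral _ _ (fun w => (p n w)%:C)); last by move=> w _; rewrite mulr1.
  by rewrite circle_integral_real p1 mulVf // gt_eqF // pi2_gt0.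
have ME k n : M k n = (k == n)%:R - E k n.
  have -> : E k n = (k == n)%:R * circle_integral (fun w => (p n w)%:C * 1) - M k n.
    rewrite -circle_integralZ // -circle_integralB //; last exact: circle_integrableZ.
    by apply: eq_circle_integral => w _; ring.
  by rewrite pint mulr1 opprB addrC subrK.
(* A column is indexed by a bump: [p n] lives on the [n]-th peak, where the integrand of each entry
   is bounded by the corresponding term of [kronecker_bound_sum]. *)
have El1 n : l1_le (E ^~ n) eps.
  move=> N; apply: le_trans (kronecker_bound_sum n N); apply: ler_sum => k _.
  apply: (bb n _ _ _ _).2; last by move=> w w1 pw; exact: peak_kronecker.
  have mc : circle_meas (fun=> (k == n)%:R - 0 : C) by exact: cmeas_cst.
  apply: (@eq_cmeas _ _ _ _ (fun t => (k == n)%:R + (-1) * g k (expi t))).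
    by move=> t _; rewrite mulN1r.
  apply: cmeasD; first exact: cmeas_cst.
  by apply: cmeasM; [exact: cmeas_cst|exact: mg].
have [b [B' [bB' Hb]]] := neumann_l1 eps1 El1 aB.
have Mb k : series (fun n => M k n * b n) @ \oo --> a k.
  have -> : series (fun n => M k n * b n) =
      (fun N => series (fun n => (n == k)%:R * b n) N - series (fun n => E k n * b n) N).
    apply/funext => N; rewrite /series /= -sumrB; apply: eq_bigr => n _.
    by rewrite ME mulrBl eq_sym.
  have -> : a k = b k - l1_op E b k by rewrite Hb addrK.
  apply: cvgCB; first exact: series_kronecker.
  exact: (l1_le_cvg (l1_op_row El1 k bB')).
(* The peaks lie in disjoint arcs, so at each point of the circle at most one bump is nonzero and
   the series [\sum_n b n * p n] converges pointwise; [G_] collects the moduli into an increasing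
   majorant. *)
pose G_ w N := \sum_(0 <= n < N) rnorm (b n) * p n w.
have Gub w : unit_circle w -> exists Bw, forall N, G_ w N <= Bw.
  move=> w1; have [[n pn]|H] := pselect (exists n, p n w != 0); last first.
    exists 0 => N; rewrite /G_ big1 // => n _.
    have [->|pn] := eqVneq (p n w) 0; first by rewrite mulr0.
    by case: H; exists n.
  exists (rnorm (b n) * p n w) => N.
  apply: (@le_trans _ _ (\sum_(0 <= k < N) (k == n)%:R * (rnorm (b n) * p n w))).
    apply: ler_sum => k _; have [->|kn] := eqVneq k n; first by rewrite mul1r.
    have [->|pk] := eqVneq (p k w) 0; first by rewrite mulr0 mul0r.
    exfalso; apply: (@G_disj k n w); first exact/eqP.
      exact: (peak_sub w1 (pP _ _ pk)).
    exact: (peak_sub w1 (pP _ _ pn)).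
  by apply: sum_kronecker_le; rewrite mulr_ge0 ?rnorm_ge0.
pose h N w := \sum_(0 <= n < N) b n * (p n w)%:C.
pose f w := limn (h ^~ w).
have hl1 w : unit_circle w -> exists Bw, l1_le (fun n => b n * (p n w)%:C) Bw.
  move=> w1; have [Bw HB] := Gub w w1; exists Bw => N; apply: le_trans (HB N).
  by apply: ler_sum => n _; rewrite rnormM rnorm_real ger0_norm.
have hf w : unit_circle w -> h ^~ w @ \oo --> f w.
  by move=> w1; have [Bw HB] := hl1 w w1; exact: (l1_le_cvg HB).
pose Gr w := limn (G_ w).
have Gcv w : unit_circle w -> cvgn (G_ w).
  move=> w1; have [Bw HB] := Gub w w1.
  by apply: (@nonneg_series_cvg _ _ Bw) => // n; rewrite mulr_ge0 ?rnorm_ge0.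
have Gle w N : unit_circle w -> G_ w N <= Gr w.
  move=> w1; apply: nondecreasing_cvgn_le; last exact: Gcv.
  by apply/nondecreasing_seqP => n; rewrite /G_ big_nat_recr //= lerDl mulr_ge0 ?rnorm_ge0.
have hG w N : unit_circle w -> rnorm (h N w) <= Gr w.
  move=> w1; apply: le_trans (Gle w N w1); apply: le_trans (rnorm_sum _ _ _) _.
  by apply: ler_sum => n _; rewrite rnormM rnorm_real ger0_norm.
have mp n : measurable_fun I2pi (fun t => p n (expi t)).
  by have /integrableP[/measurable_EFinP] := ip n.
have iGN N : mu.-integrable I2pi (fun t => (G_ (expi t) N)%:E).
  elim: N => [|N IH].
    apply: (@eq_integrable _ _ _ _ _ _ (cst 0%E)) => //; last exact: integrable0.
    by move=> t _; rewrite /G_ big_geq.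
  have i1 : mu.-integrable I2pi (fun t => (rnorm (b N))%:E * (p N (expi t))%:E)%E.
    exact: integrableZl.
  have : mu.-integrable I2pi (fun t => (G_ (expi t) N)%:E +
      (rnorm (b N))%:E * (p N (expi t))%:E)%E by exact: integrableD.
  by apply: eq_integrable => // t _; rewrite /G_ big_nat_recr.
have intGN N : \int[mu]_(t in I2pi) G_ (expi t) N = (\sum_(0 <= n < N) rnorm (b n)) * (pi *+ 2).
  elim: N => [|N IH].
    rewrite big_geq // mul0r; under eq_Rintegral do rewrite /G_ big_geq //.
    by rewrite Rintegral_cst // mul0r.
  have i1 : mu.-integrable I2pi (fun t => (rnorm (b N))%:E * (p N (expi t))%:E)%E.
    exact: integrableZl.
  have -> : \int[mu]_(t in I2pi) G_ (expi t) N.+1 =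
      \int[mu]_(t in I2pi) (G_ (expi t) N + rnorm (b N) * p N (expi t)).
    by apply: eq_Rintegral => t _; rewrite /G_ big_nat_recr.
  have -> : \int[mu]_(t in I2pi) (G_ (expi t) N + rnorm (b N) * p N (expi t)) =
      \int[mu]_(t in I2pi) G_ (expi t) N +
      \int[mu]_(t in I2pi) (rnorm (b N) * p N (expi t)) by apply: RintegralD => //; exact: iGN.
  have -> : \int[mu]_(t in I2pi) (rnorm (b N) * p N (expi t)) =
      rnorm (b N) * \int[mu]_(t in I2pi) p N (expi t).
    by apply: RintegralZl => //; exact: ip.
  by rewrite IH p1 big_nat_recr //= mulrDl.
(* All bumps have the same integral and [b] is in l1, so monotone convergence bounds the integral of
   [Gr]; it then dominates the partial sums and their products with [g k]. *)
have iG : mu.-integrable I2pi (fun t => (Gr (expi t))%:E).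
  have mGN N : measurable_fun I2pi (fun t => (G_ (expi t) N)%:E).
    by have /integrableP[] := iGN N.
  have mG : measurable_fun I2pi (fun t => (Gr (expi t))%:E).
    apply: (emeasurable_fun_cvg (fun N t => (G_ (expi t) N)%:E) _ mGN) => t _.
    by apply: cvg_EFin; [exact: nearW|exact: Gcv (expi_unit t)].
  apply/integrableP; split=> //.
  have Gr0 w : unit_circle w -> 0 <= Gr w.
    by move=> w1; have := Gle w 0%N w1; rewrite /G_ big_geq.
  rewrite (_ : (\int[mu]_(t in I2pi) `|(Gr (expi t))%:E|)%E =
     (\int[mu]_(t in I2pi) limn (fun N => (G_ (expi t) N)%:E))%E); last first.
    apply: eq_integral => t _; rewrite gee0_abs ?lee_fin ?Gr0 //; last exact: expi_unit.
    by apply/esym/cvg_lim => //; apply: cvg_EFin; [exact: nearW|exact: Gcv (expi_unit t)].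
  rewrite monotone_convergence //; last 2 first.
  - move=> N t _; rewrite lee_fin; apply: sumr_ge0 => n _.
    by rewrite mulr_ge0 ?rnorm_ge0.
  - move=> t _ m n mn; rewrite lee_fin /G_ [leRHS](big_cat_nat _ mn) //= lerDl.
    by apply: sumr_ge0 => k _; rewrite mulr_ge0 ?rnorm_ge0.
  apply: (@le_lt_trans _ _ (B' * (pi *+ 2))%:E); last exact: ltry.
  have EI N : (\int[mu]_(t in I2pi) (G_ (expi t) N)%:E)%E =
      ((\sum_(0 <= n < N) rnorm (b n)) * (pi *+ 2))%:E.
    by rewrite -intGN /Rintegral fineK //; apply: (integrable_fin_num _ (iGN N)).
  have pp : 0 <= pi *+ 2 :> R by rewrite ltW // pi2_gt0.
  apply: lime_le.
    apply: ereal_nondecreasing_is_cvgn => m n mn; rewrite !EI lee_fin ler_wpM2r //.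
    by rewrite [leRHS](big_cat_nat _ mn) //= lerDl sumr_ge0 // => k _; exact: rnorm_ge0.
  by apply: nearW => N; rewrite EI lee_fin ler_wpM2r //; exact: bB'.
have mh N : circle_meas (h N).
  apply: (@cmeas_sum _ _ _ _ (fun n t => b n * (p n (expi t))%:C)) => n.
  by apply: cmeasM; [exact: cmeas_cst|split; [exact: mp|exact: measurable_cst]].
exists f.
  apply: (@cintegrable_dom _ _ _ mu I2pi _ (fun t => Gr (expi t))) => //.
    apply: (@cmeas_lim _ _ _ _ (fun N t => h N (expi t))) => //.
    by move=> t _; exact: hf (expi_unit t).
  move=> t _; apply: (rnorm_cvg_le (hf _ (expi_unit t))) => N.
  exact: hG (expi_unit t).
move=> k.
have E1 : series (fun n => M k n * b n) = (fun N => circle_integral (fun w => h N w * g k w)).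
  apply/funext => N; rewrite /series /=.
  rewrite (@eq_circle_integral _ _
      (fun w => \sum_(0 <= n < N) b n * ((p n w)%:C * g k w))); last first.
    by move=> w _; rewrite /h mulr_suml; apply: eq_bigr => n _; rewrite mulrA.
  rewrite circle_integral_sum; last by move=> n; exact: (@circle_integrableZ _ (b n) _ (pg n k)).
  by apply: eq_bigr => n _; rewrite (@circle_integralZ _ (b n) _ (pg n k)) mulrC.
have cv : (fun N => circle_integral (fun w => h N w * g k w)) @ \oo -->
    circle_integral (fun w => f w * g k w).
  apply: (@circle_integral_cvg _ (fun N w => h N w * g k w) (fun w => f w * g k w) Gr).
  - by move=> N; exact: (cmeasM (mh N) (mg k)).
  - by move=> w w1; apply: cvgCM; [exact: hf|exact: cvg_cst].
  - exact: iG.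
  move=> N w w1; rewrite rnormM -[leRHS]mulr1.
  by apply: ler_pM; rewrite ?rnorm_ge0 ?hG ?g_le1.
by apply: cvgC_unique cv _; rewrite -E1; exact: Mb.
Qed.

(** On the image, pairing the inverse of [h] with [a] becomes pairing [h] with a fixed [f], which is
    weak* continuous by definition of the topology. *)
Lemma linf_pairing_range (a : ell1 R) : exists f : L1_circle R,
  forall c : linf R, linf_pairing c a = Hinf_pairing (T c) f.
Proof.
have [B aB] : exists B, l1_le (sval a) B.
  exists (limn (series (fun n => rnorm (sval a n)))) => N.
  apply: (@nondecreasing_cvgn_le _ (series (fun n => rnorm (sval a n)))).
    apply/nondecreasing_seqP => n; rewrite /series /= big_nat_recr //= lerDl.
    exact: rnorm_ge0.
  exact: (svalP a).
have [f fi fa] := moments_onto aB.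
exists (exist _ f fi) => c; rewrite synth_pairing_moments /linf_pairing.
by congr (limn (series _)); apply/funext => n; rewrite /= fa.
Qed.

Lemma synth_inj : injective T.
Proof.
move=> c d Tcd; apply/eqP; rewrite -subr_eq0 -normr_le0 rnormE lecR.
have e1 : 0 < 1 - eps by rewrite subr_gt0.
rewrite -(pmulr_rle0 _ e1); apply: le_trans (synth_norm_ge _) _.
by rewrite synthB Tcd subrr /rnorm normr0.
Qed.

Definition synth_inv (h : Hinf R) : linf R := xget 0 [set c | T c = h].

Lemma synthK : cancel T synth_inv.
Proof.
move=> c; apply: synth_inj; rewrite /synth_inv.
by case: xgetP => [d _ //|/(_ c)]; move=> H; case: H.
Qed.

Lemma synth_homeo_wstar : homeo_onto_image (T : linf_wstar R -> Hinf_wstar R)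
  (synth_inv : Hinf_wstar R -> linf_wstar R).
Proof.
split; [exact: synthK|exact: synth_wstar_continuous|].
set A := range _; apply/subspace_continuousP => h [c _ <-].
have FF := within_filter A (nbhs_filter (T c : Hinf_wstar R)).
apply: (cvg_linf_wstar FF) => a; have [f Hf] := linf_pairing_range a.
have E d : linf_pairing (synth_inv (T d)) a = Hinf_pairing (T d) f by rewrite synthK Hf.
move=> U nU; have {}nU : nbhs (Hinf_pairing (T c) f) U by rewrite -E.
have := @Hinf_pairing_continuous R f (T c) U nU.
apply: (@filterS _ (nbhs (T c : Hinf_wstar R)) (nbhs_filter _)) => x Ux [d _ Td].
by move: Ux; rewrite /= -Td E.
Qed.

Lemma synth_inv_norm_le (h : Hinf R) : range T h ->
  rnorm (synth_inv h) <= (1 - eps)^-1 * rnorm h.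
Proof.
move=> [c _ <-]; rewrite synthK mulrC ler_pdivlMr ?subr_gt0 // mulrC.
exact: synth_norm_ge.
Qed.

Lemma synth_inv_norm_continuous : {within range T, continuous synth_inv}.
Proof.
apply: (@lipschitz_within_continuous _ _ _ _ _ (1 - eps)^-1) => _ _ [c _ <-] [d _ <-].
rewrite !synthK mulrC ler_pdivlMr ?subr_gt0 // mulrC -synthB.
exact: synth_norm_ge.
Qed.

Lemma synth_homeo_norm : homeo_onto_image T synth_inv.
Proof.
split; [exact: synthK|exact: synth_norm_continuous|exact: synth_inv_norm_continuous].
Qed.

End Peaking.

(** * Reduction of angles modulo [2 pi], and the theorem *)

Lemma expi_natmul (R : realType) (s : R) n : expi (s + pi *+ 2 *+ n) = expi s.
Proof.
by elim: n => [|n IH]; [rewrite addr0|rewrite [_ *+ n.+1]mulrSr addrA expiD2pi].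
Qed.

(** An arc may be parametrized over any real interval, whereas the bumps need the peak parameter in
    one fixed period. *)
Lemma expi_mod (R : realType) (s : R) :
  exists t, [/\ 0 <= t, t < pi *+ 2 & expi t = expi s].
Proof.
have p0 : 0 < pi *+ 2 :> R by exact: pi2_gt0.
pose k := Num.floor (s / (pi *+ 2)); exists (s - pi *+ 2 *~ k).
have /andP[k1 k2] := floor_itv (s / (pi *+ 2)); rewrite -/k in k1 k2.
rewrite -mulrzr; split.
- by rewrite subr_ge0 mulrC -ler_pdivlMr.
- by rewrite ltrBlDl -[X in _ + X]mulr1 -mulrDr mulrC -ltr_pdivrMr // -[X in _ + X]/(1%:~R) -intrD.
rewrite mulrzr; case: k {k1 k2} => n; last by rewrite NegzE mulrNz opprK; exact: expi_natmul.
by rewrite -(expi_natmul (s - _) n) subrK.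
Qed.

Theorem theorem3p2 (R : realType) (Gam : nat -> set R[i]) (a : nat -> R[i])
  (eps : R) (delta : nat -> R) (g : nat -> R[i] -> R[i])
  (Gam_arc : forall n, open_arc (Gam n))
  (Gam_disj : forall m n, m <> n -> closure (Gam m) `&` closure (Gam n) = set0)
  (a_Gam : forall n, Gam n (a n))
  (eps_gt0 : 0 < eps)
  (delta_gt0 : forall n, 0 < delta n)
  (sum_delta : (\sum_(0 <= n <oo) (delta n)%:E < eps%:E)%E)
  (eps_lt1 : eps < 1)
  (gA : forall n, disk_algebra (g n))
  (g_a : forall n, g n (a n) = 1)
  (g_lt1 : forall n z, unit_circle z -> z <> a n -> `|g n z| < 1)
  (g_lt_delta : forall n z, unit_circle z -> ~ Gam n z ->
     `|g n z| < (delta n)%:C) :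
  exists (T : {linear linf R -> Hinf R}) (Tinv : Hinf R -> linf R),
    [/\ forall c : linf R,
          (series (fun n => c n *: toHinf (gA n)) : nat -> Hinf_wstar R) @ \oo
            --> (T c : Hinf_wstar R),
        homeo_onto_image (T : linf_wstar R -> Hinf_wstar R)
          (Tinv : Hinf_wstar R -> linf_wstar R),
        homeo_onto_image (T : linf R -> Hinf R) Tinv,
        (opnorm setT T <= (1 + eps)%:E)%E
      & (opnorm (range T) Tinv <= ((1 - eps)^-1)%:E)%E].
Proof.
have G_disj m n w : m <> n -> Gam m w -> Gam n w -> False.
  move=> mn Gm Gn; have := Gam_disj m n mn; apply/eqP/set0P; exists w.
  by split; exact: subset_closure.
have g_le1 n w : unit_circle w -> rnorm (g n w) <= 1.
  move=> w1; have [->|wa] := pselect (w = a n); first by rewrite g_a rnorm1.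
  by rewrite rnorm_le; apply/ltW/g_lt1.
have g_off n w : unit_circle w -> ~ Gam n w -> rnorm (g n w) <= delta n.
  by move=> w1 Gw; rewrite rnorm_le; apply/ltW/g_lt_delta.
have delta_ge0 n : 0 <= delta n by exact: ltW.
(* [S] is the sum itself read in [R]; its strict distance from [eps] is what the choice of [eta]
   consumes. *)
have [S delta_sum S_eps] : exists2 S,
    forall N, \sum_(0 <= n < N) delta n <= S & S < eps.
  have ub N : ((\sum_(0 <= n < N) delta n)%:E <= \sum_(0 <= n <oo) (delta n)%:E)%E.
    by rewrite -sumEFin; apply: nneseries_lim_ge => n _ _; rewrite lee_fin.
  case: (\sum_(0 <= n <oo) _)%E sum_delta ub => [S|//|] SE ub.
    by exists S => // N; rewrite -lee_fin.
  by have := ub 0%N.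
have /choice[tau /all_and3[tau_ge0 tau_lt tau_a]] : forall n, exists t,
    [/\ 0 <= t, t < pi *+ 2 & expi t = a n].
  move=> n; have [x [y [_ _ GE]]] := Gam_arc n.
  by have := a_Gam n; rewrite GE => -[s _ <-]; exact: expi_mod.
have g_tau n : g n (expi (tau n)) = 1 by rewrite tau_a.
pose gK := peak_l1 G_disj g_le1 g_off delta_ge0 delta_sum S_eps.
pose TM := GRing.isLinear.Build _ _ _ _ _ (synth_linear gA gK).
pose T : {linear linf R -> Hinf R} := HB.pack (synth gA gK) TM.
exists T, (synth_inv G_disj gA g_le1 g_off delta_ge0 delta_sum S_eps); split.
- by move=> c; exact: synth_series_wstar.
- exact: (synth_homeo_wstar _ _ _ _ _ _ _ _ tau_ge0 tau_lt g_tau).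
- exact: (synth_homeo_norm _ _ _ _ _ _ _ _ tau_ge0 tau_lt g_tau).
- apply: ge_ereal_sup => _ [c [_ c1] <-]; rewrite lee_fin.
  apply: le_trans (synth_norm_le gA gK c) _.
  by rewrite -[leRHS]mulr1 ler_pM2l // addr_gt0.
- apply: ge_ereal_sup => _ [h [Th h1] <-]; rewrite lee_fin.
  apply: le_trans (synth_inv_norm_le eps_lt1 tau_ge0 tau_lt g_tau Th) _.
  by rewrite -[leRHS]mulr1 ler_pM2l // invr_gt0 subr_gt0.
Qed.
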